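(* There is an isomorphism of commutative rings $\Theta(\mathfrak{T}) \cong \mathbf{Z}[u,v]/(uv)$, where $\mathfrak{T}$ is the class of tree structures and $\Theta(\mathfrak{T})$ is the ring carrying the universal measure for $\mathfrak{T}$.
   Context: **Trees.** A tree is a finite connected simple graph without cycles (the empty tree and the one-point tree are allowed; the vertex of the one-point tree counts as a leaf). A vertex of valence one is a leaf; other vertices are nodes. For a tree $T$, let $L(T)$ be the set of leaves with the quaternary relation $R$: $R(x_1,x_2;y_1,y_2)$ holds iff the four leaves are distinct and the shortest path joining $x_1$ and $x_2$ has a common edge with the shortest path joining $y_1$ and $y_2$. A tree structure is a finite set with a quaternary relation isomorphic to some $L(T)$. $\mathfrak{T}$ is the class of tree structures (it is a Fraïssé class). **Embeddings and amalgamations.** An embedding $X\to Y$ of structures is an injection inducing an isomorphism of $X$ with its image carrying the induced (restricted) relation. Given embeddings $i_1\colon X\to Y_1$, $i_2\colon X\to Y_2$ in $\mathfrak{T}$, an amalgamation of $Y_1$ and $Y_2$ over $X$ is a triple $(Z,j_1,j_2)$ with $Z\in\mathfrak{T}$ and embeddings $j_\alpha\colon Y_\alpha\to Z$ such that $j_1i_1=j_2i_2$ and $Z=\operatorname{im}(j_1)\cup\operatorname{im}(j_2)$. Amalgamations are taken up to isomorphism (isomorphisms $Z\to Z'$ compatible with the $j$'s). **The ring $\Theta(\mathfrak{T})$.** It is the commutative ring generated by symbols $[i]$, one for each embedding $i\colon X\to Y$ in $\mathfrak{T}$, subject to the relations: (a) $[i]=1$ if $i$ is an isomorphism; (b) $[j\circ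 i]=[j]\cdot[i]$ for composable embeddings $i,j$; (c) if $i\colon X\to Y$ and $X\to X'$ are embeddings and $i'_\alpha\colon X'\to Y'_\alpha$ ($1\le\alpha\le n$) are the various amalgamations of $Y$ and $X'$ over $X$, then $[i]=\sum_{\alpha=1}^n[i'_\alpha]$. *)

(* Defs.v *)
From HB Require Import structures.
(* [monalg] also declares a notation [{mpoly R[n]}], for another type. *)
From mathcomp Require Import -(notations) monalg.
From mathcomp Require Import mpoly.
From mathcomp Require Import all_boot all_algebra.
From mathcomp Require Import boolp.

Set Implicit Arguments.
Unset Strict Implicit.
Unset Printing Implicit Defensive.

Import GRing.Theory.
Local Open Scope ring_scope.
Local Open Scope quotient_scope.

(* [quo S] is the quotient of [R] by the ideal generated by [S].
   [{ideal_quot _}] of [ring_quotient] only carries a ring structure when the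
   ideal is proper; here the quotient may be the zero ring, so it is a
   [comPzRingType]. *)

Section IdealQuotient.
Variables (R : comNzRingType) (S : R -> Prop).

Definition in_ideal (x : R) : Prop :=
  exists n (a s : 'I_n -> R), (forall k, S (s k)) /\ x = \sum_k a k * s k.

Definition ideal : {pred R} := fun x => `[< in_ideal x >].

Lemma idealP x : reflect (in_ideal x) (x \in ideal).
Proof. exact: asboolP. Qed.

Lemma ideal_gen x : S x -> x \in ideal.
Proof.
move=> Sx; apply/idealP; exists 1%N, (fun=> 1), (fun=> x).
by rewrite big_ord1 mul1r.
Qed.

Lemma ideal0 : 0 \in ideal.
Proof.
apply/idealP; exists 0%N, (fun=> 0), (fun=> 0).
by split=> [[]//|]; rewrite big_ord0.
Qed.

Lemma idealD x y : x \in ideal -> y \in ideal -> x + y \in ideal.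
Proof.
move=> /idealP[n [a [s [Ss ->]]]] /idealP[m [b [t [St ->]]]].
apply/idealP; exists (n + m)%N.
exists (fun k => match split k with inl i => a i | inr j => b j end).
exists (fun k => match split k with inl i => s i | inr j => t j end).
split=> [k|]; first by case: (split k).
rewrite big_split_ord /=; congr (_ + _); apply: eq_bigr => i _.
  by rewrite (unsplitK (inl i)).
by rewrite (unsplitK (inr i)).
Qed.

Lemma idealMl r x : x \in ideal -> r * x \in ideal.
Proof.
move=> /idealP[n [a [s [Ss ->]]]].
apply/idealP; exists n, (fun k => r * a k), s; split=> //.
by rewrite mulr_sumr; apply: eq_bigr => k _; rewrite mulrA.
Qed.

Lemma ideal_zmod_closed : zmod_closed ideal.
Proof.
split=> [|x y Ix Iy]; first exact: ideal0.
by apply: idealD => //; rewrite -mulN1r; apply: idealMl.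
Qed.

HB.instance Definition _ := GRing.isZmodClosed.Build R ideal ideal_zmod_closed.

Definition quo : Type := Quotient.quot ideal.

HB.instance Definition _ := EqQuotient.on quo.
HB.instance Definition _ := GRing.Zmodule.on quo.

Definition quo_pi (x : R) : quo := \pi_quo x.

Lemma quo_piP x y : quo_pi x = quo_pi y <-> x - y \in ideal.
Proof.
by rewrite [x - y \in _](Quotient.idealrBE ideal); split=> /eqP.
Qed.

Lemma quo_reprK : cancel (@repr _ quo) quo_pi.
Proof. exact: reprK. Qed.

Definition quo_one : quo := quo_pi 1.
Definition quo_mul (x y : quo) : quo := quo_pi (repr x * repr y).

Lemma quo_piM x y : quo_pi (x * y) = quo_mul (quo_pi x) (quo_pi y).
Proof.
apply/quo_piP.
set x' := repr _; set y' := repr _.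
have -> : x * y - x' * y' = y * (x - x') + x' * (y - y').
  by rewrite !mulrBr (mulrC y x) (mulrC y x') addrA subrK.
by apply: idealD; apply: idealMl; apply/quo_piP; rewrite quo_reprK.
Qed.

Lemma quo_piD x y : quo_pi (x + y) = quo_pi x + quo_pi y.
Proof. by rewrite /quo_pi !piE. Qed.

Lemma quo_mulA : associative quo_mul.
Proof.
move=> x y z; rewrite -[x]quo_reprK -[y]quo_reprK -[z]quo_reprK.
by rewrite -!quo_piM mulrA.
Qed.

Lemma quo_mulC : commutative quo_mul.
Proof. by move=> x y; rewrite /quo_mul mulrC. Qed.

Lemma quo_mul1 : left_id quo_one quo_mul.
Proof. by move=> x; rewrite -[x]quo_reprK -quo_piM mul1r. Qed.

Lemma quo_mulDl : left_distributive quo_mul +%R.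
Proof.
move=> x y z; rewrite -[x]quo_reprK -[y]quo_reprK -[z]quo_reprK.
by rewrite -quo_piD -!quo_piM mulrDl quo_piD.
Qed.

HB.instance Definition _ :=
  GRing.Zmodule_isComPzRing.Build quo quo_mulA quo_mulC quo_mul1 quo_mulDl.

Lemma quo_pi_zmod_morphism : zmod_morphism quo_pi.
Proof. by move=> x y; rewrite /quo_pi !piE. Qed.

HB.instance Definition _ :=
  GRing.isZmodMorphism.Build R quo quo_pi quo_pi_zmod_morphism.

Lemma quo_pi_monoid_morphism : monoid_morphism quo_pi.
Proof. by split=> // x y; rewrite quo_piM. Qed.

HB.instance Definition _ :=
  GRing.isMonoidMorphism.Build R quo quo_pi quo_pi_monoid_morphism.

End IdealQuotient.

Section Tree.
Variables (V : finType) (e : rel V).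

(* A duplicate-free closed walk of length at least 3 is a graph cycle. *)
Definition is_tree : Prop :=
  [/\ symmetric e, irreflexive e, (forall x y, connect e x y)
    & forall c : seq V, ucycle e c -> (size c < 3)%N].

(* The second disjunct is the one-point tree. *)
Definition is_leaf (x : V) : bool :=
  (#|[pred y | e x y]| == 1%N) || (#|V| == 1%N).

(* The walk is the sequence [x :: p]. *)
Definition shortest_path (x y : V) (p : seq V) : Prop :=
  [/\ path e x p, last x p = y
    & forall q, path e x q -> last x q = y -> (size p <= size q)%N].

(* The edge {a, b} is undirected. *)
Definition path_edge (x : V) (p : seq V) (a b : V) : Prop :=
  (a, b) \in zip (x :: p) p \/ (b, a) \in zip (x :: p) p.

Definition tree_rel (x1 x2 y1 y2 : V) : Prop :=
  uniq [:: x1; x2; y1; y2] /\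
  exists p q a b,
    [/\ shortest_path x1 x2 p, shortest_path y1 y2 q,
        path_edge x1 p a b & path_edge y1 q a b].

Definition leaf : Type := {x : V | is_leaf x}.

Definition leaf_rel (x1 x2 y1 y2 : leaf) : Prop :=
  tree_rel (val x1) (val x2) (val y1) (val y2).

End Tree.

Definition quaternary (T : Type) : Type := T -> T -> T -> T -> Prop.

Definition preserves (X Y : Type) (RX : quaternary X) (RY : quaternary Y)
    (f : X -> Y) : Prop :=
  forall x1 x2 y1 y2,
    RX x1 x2 y1 y2 <-> RY (f x1) (f x2) (f y1) (f y2).

(* Finiteness of [X] follows from that of the tree. *)
Definition is_tree_structure (X : Type) (RX : quaternary X) : Prop :=
  exists (V : finType) (e : rel V), is_tree e /\
  exists f : X -> leaf e, bijective f /\ preserves RX (@leaf_rel V e) f.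

Record treeStr := TreeStr {
  ts_carrier :> Type;
  ts_rel : quaternary ts_carrier;
  ts_proof : is_tree_structure ts_rel
}.

Record embedding (X Y : treeStr) := Embedding {
  emb_fun :> X -> Y;
  emb_inj : injective emb_fun;
  emb_rel : preserves (@ts_rel X) (@ts_rel Y) emb_fun
}.

Lemma emb_comp_inj (X Y Z : treeStr) (j : embedding Y Z) (i : embedding X Y) :
  injective (j \o i).
Proof. by apply: inj_comp; apply: emb_inj. Qed.

Lemma emb_comp_rel (X Y Z : treeStr) (j : embedding Y Z) (i : embedding X Y) :
  preserves (@ts_rel X) (@ts_rel Z) (j \o i).
Proof.
by move=> x1 x2 y1 y2; apply: iff_trans (emb_rel i _ _ _ _) (emb_rel j _ _ _ _).
Qed.

Definition emb_comp (X Y Z : treeStr) (j : embedding Y Z) (i : embedding X Y) :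
  embedding X Z := Embedding (@emb_comp_inj _ _ _ j i) (@emb_comp_rel _ _ _ j i).

Section Amalgamation.
Variables (X Y1 Y2 : treeStr) (i1 : embedding X Y1) (i2 : embedding X Y2).

Record amalgamation := Amalgamation {
  am_str : treeStr;
  am_inl : embedding Y1 am_str;
  am_inr : embedding Y2 am_str;
  am_comm : forall x, am_inl (i1 x) = am_inr (i2 x);
  am_cover : forall z, (exists y, am_inl y = z) \/ (exists y, am_inr y = z)
}.

Definition am_iso (A B : amalgamation) : Prop :=
  exists f : embedding (am_str A) (am_str B),
    [/\ bijective f, forall y, f (am_inl A y) = am_inl B y
      & forall y, f (am_inr A y) = am_inr B y].

(* [A] lists each isomorphism class of amalgamations exactly once. *)
Definition am_enumeration n (A : 'I_n -> amalgamation) : Prop :=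
  (forall B, exists a, am_iso (A a) B) /\
  (forall a b, am_iso (A a) (A b) -> a = b).

End Amalgamation.

Record symbol := Symbol {
  sym_dom : treeStr;
  sym_cod : treeStr;
  sym_emb : embedding sym_dom sym_cod
}.

(* The polynomial ring over [int] with one variable for each embedding. *)
Definition symbol_ring : comNzRingType := malg (cmonom {classic symbol}) int.

Definition sym (X Y : treeStr) (i : embedding X Y) : symbol_ring :=
  mkmalgU (ucm (Symbol i : {classic symbol})) 1.

(* [am_inr (A a)] is the embedding of X' into the a-th amalgamation. *)
Inductive Theta_relation : symbol_ring -> Prop :=
| Theta_iso (X Y : treeStr) (i : embedding X Y) :
    bijective i -> Theta_relation (sym i - 1)
| Theta_comp (X Y Z : treeStr) (j : embedding Y Z) (i : embedding X Y) :
    Theta_relation (sym (emb_comp j i) - sym j * sym i)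
| Theta_amalg (X Y X' : treeStr) (i : embedding X Y) (k : embedding X X')
    n (A : 'I_n -> amalgamation i k) :
    am_enumeration A ->
    Theta_relation (sym i - \sum_(a < n) sym (am_inr (A a))).

Definition Theta : comPzRingType := quo Theta_relation.

Definition Zuv : comPzRingType :=
  quo (fun p : {mpoly int[2]} => p = 'X_0 * 'X_1).

(* Main.v *)
Require Import Defs.
From HB Require Import structures.
From mathcomp Require Import finmap.
From mathcomp Require Import -(notations) monalg.
From mathcomp Require Import mpoly.
From mathcomp Require Import all_boot all_algebra perm.
From mathcomp Require Import boolp ring zify.

(** A tree structure is the same thing as a system of quartets: write
    [q a b c d] when some edge of the tree separates the distinct leaves a, b
    from the distinct leaves c, d.  Then R(x1, x2; y1, y2) says that x1, x2 are
    separated by a quartet that also separates y1 from y2, and R and [q]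
    determine each other.  Six universal axioms characterize the relations [q]
    ([tree_quartets], [quartets_tree_structure]), so that graphs disappear from
    the rest of the argument.

    Adding a leaf y to a tree with leaf set X means choosing a point of the
    tree, and this point is known from the partition of X into the directions
    at it: a and b are in the same direction when [q a b y w] for some w
    ([branch], [place]).  There are two blocks when the point lies on an edge,
    and k blocks when it is a node of valence k.  Every embedding is a
    composite of one-point extensions ([factor_one_point]), so that a measure is
    known from its values on them.

    Existence.  Over any commutative ring with elements u, v such that uv = 0,
    give a one-point extension a weight that depends on the number k of blocks
    and, when k = 2, on the number s of singleton blocks only: u - v, u, u + v
    for k = 2 and s = 0, 1, 2, and a function affine in k for k >= 3 ([wt]).
    The product of the weights along a chain of one-point extensions does not
    depend on the order in which the points are added, because
    u(u - v) = u^2 ([weight_comm]); it defines a multiplicative function [mu] of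
    embeddings.  Additivity over amalgamations
    passes through composites, hence reduces to a pair of one-point extensions y
    and z of X ([additive_all]).  There, if y and z sit at different places,
    the amalgamation is unique and the block structure seen from y is unchanged
    as far as the weight is concerned; if they sit at the same place, y may be
    equal to z, form a cherry with z, be attached at the same node as z, or be
    separated from z along the edge that carries both, and the weights of these
    cases add up ([weight_additive]).  So [mu] is a homomorphism from
    Theta to Z[u,v]/(uv).

    Uniqueness.  Let psi be multiplicative and additive, let u be its value on
    the extension of the star with three leaves by a point on an edge, and define
    v by its value on the extension by a point at the center.  Additivity of a
    pair (y, z) over X computes the value of y over X from the values over
    X with z added, and conversely gives the value of one
    amalgamation once the value over X and those of the other amalgamations are
    known.  Going up from three leaves, every one-point extension of n + 1 leaves
    is reached in this way after deleting a well chosen leaf ([level_up]), so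
    that psi is the weight on all one-point extensions.  Adding two points to
    the same edge at a leaf of the star in the two possible orders gives
    u(u - v) = u^2, that is uv = 0 ([psi_uv0]).  Applied to the classes in Theta
    this provides the inverse homomorphism. *)

Set Implicit Arguments.
Unset Strict Implicit.
Unset Printing Implicit Defensive.

(** * Quartet systems *)

(** [q a b c d] stands for the split ab|cd.  In [quart_trans], c and d
    are both on the side of e across from a, b.  In [quart_sub], the fifth leaf e
    lies on one of the sides of the split, and may replace d or b
    accordingly. *)
Record quartets (T : eqType) (q : T -> T -> T -> T -> bool) : Prop := Quartets {
  quartC : forall a b c d, q a b c d = q b a c d;
  quartS : forall a b c d, q a b c d = q c d a b;
  quart_neq : forall a b c d, q a b c d -> (a != b) && (a != c);
  quart_excl : forall a b c d, q a b c d -> ~~ q a c b d;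
  quart_trans : forall a b c d e, q a b c e -> q a b d e -> c != d -> q a b c d;
  quart_sub : forall a b c d e, q a b c d -> e != a -> e != c ->
    q a b c e || q a e c d
}.

(** Two splits fit in a common tree exactly when one of the four intersections
    of their sides is empty. *)
Definition compatible (T : Type) (A B : pred T) : Prop :=
  exists s t, forall x, ~~ ((A x == s) && (B x == t)).

(** The quartets displayed by a family of splits, each given by one side. *)
Definition separated (T : eqType) (I : Type) (S : I -> pred T) a b c d : bool :=
  [&& a != b, c != d &
    `[< exists i, [/\ S i a = S i b, S i c = S i d & S i a <> S i c] >]].

Lemma separatedP (T : eqType) (I : Type) (S : I -> pred T) a b c d :
  reflect ([/\ a != b, c != d & exists i s,
             [/\ S i a = s, S i b = s, S i c = ~~ s & S i d = ~~ s]])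
          (separated S a b c d).
Proof.
apply: (iffP and3P) => -[-> -> H]; split=> //.
  have /asboolP[i [Eab Ecd N]] := H; exists i, (S i a); move: Eab Ecd N.
  by case: (S i a); case: (S i b); case: (S i c); case: (S i d).
apply/asboolP; case: H => i [s [ia ib ic id]]; exists i; rewrite ia ib ic id.
by split=> //; case: (s).
Qed.

(** Only exclusion and transitivity involve two splits; a violation would place
    a leaf in each of the four intersections of their sides.  The lemma is
    applied to the edges of a tree, and to the splits of a tree with a leaf
    added. *)
Lemma separated_quartets (T : eqType) (I : Type) (S : I -> pred T) :
  (forall i j, compatible (S i) (S j)) -> quartets (separated S).
Proof.
move=> cS; split.
- move=> a b c d; apply/separatedP/separatedP=> -[ab cd [i [s [*]]]];
  by split=> //; [rewrite eq_sym | exists i, s].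
- move=> a b c d; apply/separatedP/separatedP=> -[ab cd [i [s [*]]]];
  by split=> //; exists i, (~~ s); rewrite negbK.
- move=> a b c d /separatedP[-> _ [i [s [Ea _ Ec _]]]]; apply/eqP=> Eac.
  by move: Ec; rewrite -Eac Ea; case: s {Ea}.
- move=> a b c d /separatedP[ab cd [i [s [ia ib ic id]]]].
  apply/negP=> /separatedP[ac bd [j [t [ja jc jb jd]]]].
  have [s' [t' H]] := cS i j.
  move: (H a) (H b) (H c) (H d).
  rewrite ia ib ic id ja jb jc jd.
  by move: s t s' t' {ia ib ic id ja jb jc jd H} => [] [] [] [].
- move=> a b c d e /separatedP[ab ce [i [s [ia ib ic ie]]]].
  move=> /separatedP[_ de [j [t [ja jb jd je]]]] cd.
  apply/separatedP; split=> //.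
  case Eid: (S i d == ~~ s); first by exists i, s; rewrite (eqP Eid).
  case Ejc: (S j c == ~~ t); first by exists j, t; rewrite (eqP Ejc).
  have [s' [t' H]] := cS i j; exfalso.
  have {}Eid : S i d = s by move: Eid; case: (S i d) (s) => -[].
  have {}Ejc : S j c = t by move: Ejc; case: (S j c) (t) => -[].
  move: (H a) (H c) (H d) (H e).
  rewrite ia ic ie Eid ja jd je Ejc.
  by move: s t s' t' {ia ib ic ie ja jb jd je H Eid Ejc} => [] [] [] [].
- move=> a b c d e /separatedP[ab cd [i [s [ia ib ic id]]]] ea ec.
  apply/orP; case Eie: (S i e == s); [right|left]; apply/separatedP.
    by split=> //; [rewrite eq_sym | exists i, s; rewrite (eqP Eie)].
  split=> //; first by rewrite eq_sym.
  by exists i, s; split=> //; move: Eie; case: (S i e) (s) => -[].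
Qed.

(** * Trees give quartets *)

Section Sides.
Variables (V : finType) (e : rel V).
Hypothesis treeV : is_tree e.

Definition is_edge (a b x y : V) :=
  ((x == a) && (y == b)) || ((x == b) && (y == a)).

Definition cut (a b : V) : rel V := [rel x y | e x y && ~~ is_edge a b x y].

(** The component of a once the edge ab is removed. *)
Definition side (a b : V) : pred V := connect (cut a b) a.

Let symV : symmetric e. Proof. by case: treeV. Qed.

Lemma cut_sym a b : symmetric (cut a b).
Proof.
move=> x y; rewrite /cut /= symV; congr (_ && ~~ _).
by rewrite /is_edge orbC ![(y == _) && _]andbC.
Qed.

Lemma connect_cut_sym a b : connect_sym (cut a b).
Proof. exact/sym_connect_sym/cut_sym. Qed.

Lemma side_edge a b : e a b -> ~~ side a b b.
Proof.
case: treeV => _ irrV _ acyc eab; apply/negP=> /connectP[p pp Eb].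
case/shortenP: pp Eb => p' pp' up' _ Eb.
have pe : path e a p'.
  by apply: sub_path pp' => x y /andP[].
have := acyc (a :: p'); rewrite /ucycle /cycle rcons_path pe -Eb symV eab up'.
move=> /(_ isT); case: p' pp' Eb {up' pe} => [_ Eb|c [|d s]] //=.
  by move: eab; rewrite Eb irrV.
by move=> + Ec; rewrite -Ec /cut /= /is_edge !eqxx /= andbF.
Qed.

Lemma side_cut a b c d : cut a b c d -> side a b c = side a b d.
Proof.
by move=> cd; apply/idP/idP => h; apply: connect_trans h (connect1 _) => //;
  rewrite cut_sym.
Qed.

Lemma side_step a b x y : e x y -> side a b x != side a b y -> is_edge a b x y.
Proof.
move=> exy; apply: contraR => H; apply/eqP/side_cut.
by rewrite /cut /= exy.
Qed.

Lemma path_edge_cons (x y a b : V) (p : seq V) :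
  path_edge x (y :: p) a b <-> is_edge a b x y \/ path_edge y p a b.
Proof.
rewrite /path_edge /is_edge /= !inE !xpair_eqE ![_ == x]eq_sym ![_ == y]eq_sym.
split.
  by case=> /orP[->|->]; rewrite ?orbT /=; auto.
by case=> [/orP[->|->]|[->|->]]; rewrite ?orbT /=; auto.
Qed.

(** The endpoints of a path that changes side are separated, so that one of its
    steps leaves the side, and only the removed edge does. *)
Lemma cross_edge a b x p :
  path e x p -> side a b x != side a b (last x p) -> path_edge x p a b.
Proof.
elim: p x => [|y p IH] x /=; first by rewrite eqxx.
move=> /andP[exy pp] N; apply/path_edge_cons.
case E: (side a b x == side a b y); last by left; apply: side_step; rewrite ?E.
by right; apply: IH => //; rewrite -(eqP E).
Qed.

Lemma cut_path a b x p : path e x p -> a \notin x :: p \/ b \notin x :: p ->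
  side a b x = side a b (last x p).
Proof.
elim: p x => [|y p IH] x //= /andP[exy pp] N.
rewrite -IH //; last first.
  by case: N => N; [left|right]; apply: contra N; rewrite !inE => ->; rewrite orbT.
apply: side_cut; rewrite /cut /= exy /is_edge /=; move: N; rewrite !inE.
by rewrite !negb_or !negb_and ![_ == a]eq_sym ![_ == b]eq_sym;
  case=> /and3P[-> -> _]; rewrite ?orbT.
Qed.

(** A path without repetition uses the removed edge at most once, hence ends
    on the other side if it uses it at all. *)
Lemma uniq_cross_edge a b x p : e a b -> path e x p -> uniq (x :: p) ->
  path_edge x p a b -> side a b x != side a b (last x p).
Proof.
move=> eab; elim: p x => [|y p IH] x; first by move=> _ _ [].
move=> /andP[exy pp] /andP[xp up] /path_edge_cons; rewrite [last _ _]/=.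
have Nab : side a b a != side a b b.
  by rewrite (negbTE (side_edge eab)) /side connect0.
case E : (is_edge a b x y); [move=> _ | case=> // h].
  have <- : side a b y = side a b (last y p).
    by apply: cut_path pp _; case/orP: E => /andP[/eqP <- _]; auto.
  by case/orP: E => /andP[/eqP-> /eqP->] //; rewrite eq_sym.
have -> : side a b x = side a b y by apply: side_cut; rewrite /cut /= exy E.
exact: IH.
Qed.

Lemma shortest_uniq x y p : shortest_path e x y p -> uniq (x :: p).
Proof.
case=> pp Ey mp; move: Ey; case/shortenP: (pp) => p' pp' up' sub Ey.
apply: (leq_size_uniq up'); last by rewrite ltnS; apply: mp.
by move=> z; rewrite !inE => /orP[->//|/sub->]; rewrite orbT.
Qed.

Lemma shortest_exists x y : exists p, shortest_path e x y p.
Proof.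
case: treeV => _ _ conV _; have /connectP[p pp Ey] := conV x y.
pose P n := `[< exists2 p, path e x p & last x p = y /\ size p = n >].
have exP : exists n, P n by exists (size p); apply/asboolP; exists p.
have [n /asboolP[p' pp' [Ey' sz]] minn] := ex_minnP exP.
exists p'; split=> // r pr Er; rewrite sz; apply: minn.
by apply/asboolP; exists r.
Qed.

Lemma path_edge_edge x p a b : path e x p -> path_edge x p a b -> e a b.
Proof.
elim: p x => [|y p IH] x; first by move=> _ [].
move=> /andP[exy pp] /path_edge_cons[|]; last exact: IH.
by case/orP=> /andP[/eqP <- /eqP <-] //; rewrite symV.
Qed.

(** The paths of the definition only matter through the edges on them, and an
    edge of a tree lies on the path from x to y exactly when removing it
    separates x from y. *)
Lemma tree_relE x1 x2 y1 y2 : tree_rel e x1 x2 y1 y2 <->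
  uniq [:: x1; x2; y1; y2] /\ exists a b, [/\ e a b,
    side a b x1 != side a b x2 & side a b y1 != side a b y2].
Proof.
split=> -[u].
  case=> [p [q [a [b [sp sq ep eq]]]]]; split=> //; exists a, b.
  have eab : e a b by case: sp => pp _ _; exact: path_edge_edge ep.
  split=> //.
    by have := uniq_cross_edge eab _ (shortest_uniq sp) ep; case: sp => pp -> _; exact.
  by have := uniq_cross_edge eab _ (shortest_uniq sq) eq; case: sq => pp -> _; exact.
case=> a [b [eab sx sy]]; split=> //.
have [p sp] := shortest_exists x1 x2; have [q sq] := shortest_exists y1 y2.
exists p, q, a, b; split=> //.
  by case: sp => pp Ep _; apply: cross_edge => //; rewrite Ep.
by case: sq => pp Ep _; apply: cross_edge => //; rewrite Ep.
Qed.

Lemma side_cover a b x : e a b -> side a b x \/ connect (cut a b) b x.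
Proof.
move=> eab; case: treeV => _ _ conV _; have /connectP[p + ->] := conV a x.
elim/last_ind: p => [|p y IH]; first by left; apply: connect0.
rewrite rcons_path last_rcons => /andP[pp exy].
case E: (is_edge a b (last a p) y).
  by case/orP: E => /andP[_ /eqP->]; [right|left]; apply: connect0.
have cxy : cut a b (last a p) y by rewrite /cut /= exy E.
by case: (IH pp) => h; [left|right]; apply: connect_trans h (connect1 cxy).
Qed.

Lemma side_flip a b x : e a b -> side b a x = ~~ side a b x.
Proof.
move=> eab.
have E : side b a x = connect (cut a b) b x.
  by apply: eq_connect => y z; rewrite /cut /= /is_edge orbC.
rewrite E; have [ax|bx] := side_cover x eab.
  rewrite ax; apply/negP=> bx; have /negP := side_edge eab; apply.
  by apply: connect_trans ax _; rewrite connect_cut_sym.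
rewrite bx; apply/esym/negP=> ax; have /negP := side_edge eab; apply.
by apply: connect_trans ax _; rewrite connect_cut_sym.
Qed.

Lemma cut_cross a b c d x y : connect (cut a b) x y ->
  side c d x != side c d y -> connect (cut a b) x c.
Proof.
move=> /connectP[p pp ->] N.
have pe : path e x p by apply: sub_path pp => ? ? /andP[].
have := cross_edge pe N.
elim: p x pp {N pe} => [|z p IH] x; first by move=> _ [].
move=> /andP[cxz pp] /path_edge_cons[|h]; last first.
  by apply: connect_trans (connect1 cxz) (IH _ pp h).
case/orP=> /andP[/eqP Ex /eqP Ez]; first by rewrite Ex connect0.
by rewrite -Ez; exact: connect1.
Qed.

(** If cd is not the edge ab, then cd lies in one component of the complement
    of ab and ab in one component of the complement of cd; the two other
    components are disjoint. *)
Lemma side_compatible a b c d : e a b -> e c d ->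
  compatible (side a b) (side c d).
Proof.
move=> eab ecd.
case E : (is_edge a b c d).
  case/orP: E => /andP[/eqP-> /eqP->].
    by exists true, false => x; case: (side a b x).
  exists true, true => x; apply/negP=> /andP[/eqP ax /eqP bx].
  have := side_edge eab; rewrite /side => /negP; apply.
  apply: connect_trans ax _; rewrite connect_cut_sym.
  move: bx; rewrite /side; congr (is_true _); apply: eq_connect => y z.
  by rewrite /cut /= /is_edge orbC.
have cd : side a b c = side a b d by apply: side_cut; rewrite /cut /= ecd E.
have ab : side c d a = side c d b.
  apply: side_cut; rewrite /cut /= eab /is_edge; move: E; rewrite /is_edge.
  by rewrite ![c == _]eq_sym ![d == _]eq_sym => /norP[/negbTE-> ]; rewrite andbC => ->.
exists (~~ side a b c), (~~ side c d a) => x; apply/negP=> /andP[/eqP abx /eqP cdx].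
have [o ox oE] : exists2 o, connect (cut a b) o x & side c d o = side c d a.
  by have [h|h] := side_cover x eab; [exists a | exists b].
have xc : connect (cut a b) x c.
  apply: (@cut_cross a b c d x o); first by rewrite connect_cut_sym.
  by rewrite cdx oE; case: (side c d a).
have : side a b x = side a b c.
  by rewrite /side (same_connect_r (connect_cut_sym a b) xc).
by rewrite abx; case: (side a b c).
Qed.

(** The splits are the edges.  R is recovered from the quartets because the
    edge separating x1 from x2 and y1 from y2 groups x1 with either y1 or y2. *)
Lemma tree_quartets : exists2 q : leaf e -> leaf e -> leaf e -> leaf e -> bool,
  quartets q & forall x1 x2 y1 y2,
    @leaf_rel V e x1 x2 y1 y2 <-> q x1 y1 x2 y2 || q x1 y2 x2 y1.
Proof.
pose S (i : {ab : V * V | e ab.1 ab.2}) (x : leaf e) := side (val i).1 (val i).2 (val x).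
exists (separated S).
  by apply: separated_quartets => -[[a b] /= eab] [[c d] /= ecd];
    have [s [t H]] := side_compatible eab ecd; exists s, t => x; apply: H.
move=> x1 x2 y1 y2; rewrite /leaf_rel tree_relE; split.
  case=> u [a [b [eab]]] s1 s2.
  pose i : {ab : V * V | e ab.1 ab.2} := Sub (a, b) eab.
  have : uniq [:: x1; x2; y1; y2] by rewrite -(map_inj_uniq val_inj).
  rewrite /= !inE !negb_or => /and4P[/and3P[n1 n2 n3] /andP[n4 n5] n6 _].
  apply/orP; case Es : (side a b (val x1) == side a b (val y1)).
    left; apply/separatedP; split=> //; exists i, (side a b (val x1)).
    rewrite /S /= (eqP Es); split=> //.
      by move: s1; rewrite -(eqP Es); case: (side _ _ (val x1)); case: (side _ _ (val x2)).
    by move: s2; case: (side _ _ (val y1)); case: (side _ _ (val y2)).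
  right; apply/separatedP; split=> //; exists i, (side a b (val x1)).
  rewrite /S /=; move: Es s1 s2.
  by case: (side _ _ (val x1)); case: (side _ _ (val x2));
    case: (side _ _ (val y1)); case: (side _ _ (val y2)).
have main z1 z2 z3 z4 : separated S z1 z2 z3 z4 ->
   uniq [:: z1; z2; z3; z4] /\ exists a b, [/\ e a b,
    side a b (val z1) != side a b (val z3) & side a b (val z2) != side a b (val z4)]
    /\ (side a b (val z1) != side a b (val z4)).
  case/separatedP=> n12 n34 [[[a b] /= eab]] [s []]; rewrite /S /= => h1 h2 h3 h4.
  split; last by exists a, b; rewrite h1 h2 h3 h4; case: s {h1 h2 h3 h4}.
  have D x y : side a b (val x) = s -> side a b (val y) = ~~ s -> x != y.
    by move=> hx hy; apply/eqP=> E; move: hy; rewrite -E hx; case: s {hx h1 h2 h3 h4}.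
  by rewrite /= !inE !negb_or n12 n34 !D.
case/orP=> /main[u [a [b [[eab h1 h2] h3]]]]; split.
- move: u; rewrite -(map_inj_uniq val_inj) /= !inE !negb_or.
  by move=> /and4P[/and3P[-> -> ->] /andP[n1 ->] -> _]; rewrite eq_sym n1.
- by exists a, b.
- move: u; rewrite -(map_inj_uniq val_inj) /= !inE !negb_or.
  move=> /and4P[/and3P[-> -> ->] /andP[n1 n2] n3 _].
  by rewrite n3 [_ x2 == _ y2]eq_sym n1 [_ y1 == _ y2]eq_sym n2.
- by exists a, b; split=> //; rewrite eq_sym.
Qed.

End Sides.

(** * Splits of a quartet system *)

(** Closes a quartet equal to a hypothesis up to the eight symmetries of ab|cd. *)
Ltac quart_sym Hq := solve
  [ assumption
  | rewrite (quartC Hq); assumption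
  | rewrite (quartS Hq); assumption
  | rewrite (quartS Hq) (quartC Hq); assumption
  | rewrite (quartC Hq) (quartS Hq); assumption
  | rewrite (quartC Hq) (quartS Hq) (quartC Hq); assumption
  | rewrite (quartS Hq) (quartC Hq) (quartS Hq); assumption
  | rewrite (quartS Hq) (quartC Hq) (quartS Hq) (quartC Hq); assumption ].

Section QuartetTheory.
Variables (T : eqType) (q : T -> T -> T -> T -> bool).
Hypothesis Hq : quartets q.
Implicit Types a b c d e : T.

Lemma quart_uniq a b c d : q a b c d -> uniq [:: a; b; c; d].
Proof.
move=> h; have h1 : q b a c d by quart_sym Hq.
have h2 : q c d a b by quart_sym Hq.
have h3 : q b a d c by quart_sym Hq.
have h4 : q a b d c by quart_sym Hq.
rewrite /= !inE !negb_or.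
have /andP[-> ->] := quart_neq Hq h; have /andP[_ ->] := quart_neq Hq h1.
have /andP[-> _] := quart_neq Hq h2; have /andP[_ ->] := quart_neq Hq h3.
by have /andP[_ ->] := quart_neq Hq h4.
Qed.

Lemma quart_ne a b c d : q a b c d ->
  [/\ a <> b, a <> c, a <> d, b <> c & b <> d /\ c <> d].
Proof.
move/quart_uniq; rewrite /= !inE !negb_or.
by move=> /and4P[/and3P[/eqP ? /eqP ? /eqP ?] /andP[/eqP ? /eqP ?] /eqP ? _].
Qed.

Lemma quart_excl1 a b c d : q a b c d -> q a c b d -> False.
Proof. by move=> h h'; have := quart_excl Hq h; rewrite h'. Qed.

Lemma quart_excl2 a b c d : q a b c d -> q a d b c -> False.
Proof. by move=> h h'; apply: (@quart_excl1 a b d c); quart_sym Hq. Qed.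

Lemma quart_subP a b c d e : q a b c d -> e <> a -> e <> c ->
  q a b c e \/ q a e c d.
Proof. by move=> h /eqP ea /eqP ec; apply/orP; apply: (quart_sub Hq). Qed.

Lemma quart_transP a b c d e : q a b c e -> q a b d e -> c <> d -> q a b c d.
Proof. by move=> h1 h2 /eqP; apply: (quart_trans Hq) h1 h2. Qed.

End QuartetTheory.

Section Splits.
Variables (T : finType) (q : T -> T -> T -> T -> bool).
Hypothesis Hq : quartets q.

(** One side of a split all of whose quartets hold. *)
Definition split_set (C : {set T}) : Prop :=
  forall a b c d, a \in C -> b \in C -> c \notin C -> d \notin C ->
    a <> b -> c <> d -> q a b c d.

(** In a tree, the leaves other than w that hang from the path joining p and t,
    as seen from w: the smallest side of a split that contains p and t and not
    w. *)
Definition cluster (w p t : T) : {set T} := [set x | (x != w) && ~~ q p t x w].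

Lemma cluster_split w p t : p <> t -> split_set (cluster w p t).
Proof.
move=> pt.
have s1 a c : a \in cluster w p t -> c \notin cluster w p t -> c <> w ->
    a <> p -> q p a c w.
  rewrite !inE negb_and !negbK => /andP[/eqP aw Na] /orP[/eqP//|h] cw ap.
  have ac : a <> c by move=> E; move: Na; rewrite E h.
  have [h1|//] := quart_subP Hq h ap ac.
  case/negP: Na; apply: (@quart_transP _ q Hq _ _ _ _ c) => //; quart_sym Hq.
have s2 a b c : a \in cluster w p t -> b \in cluster w p t ->
    c \notin cluster w p t -> c <> w -> a <> b -> q a b c w.
  move=> aC bC cC cw ab.
  have [ap|/eqP ap] := eqVneq a p; first by rewrite ap; apply: s1 => //; congruence.
  have [bp|/eqP bp] := eqVneq b p.
    by rewrite bp (quartC Hq); apply: s1.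
  rewrite (quartS Hq); apply: (@quart_transP _ q Hq _ _ _ _ p) => //.
    by have h := s1 a c aC cC cw ap; quart_sym Hq.
  by have h := s1 b c bC cC cw bp; quart_sym Hq.
move=> a b c d aC bC cC dC ab cd.
have [cw|/eqP cw] := eqVneq c w.
  have h : q a b d w by apply: s2 => //; congruence.
  by rewrite cw; quart_sym Hq.
have [dw|/eqP dw] := eqVneq d w; first by rewrite dw; apply: s2.
by apply: (@quart_transP _ q Hq _ _ _ _ w) => //; apply: s2.
Qed.

Lemma cluster_mem w p t : p <> w -> t <> w ->
  [/\ p \in cluster w p t, t \in cluster w p t & w \notin cluster w p t].
Proof.
move=> /eqP pw /eqP tw; rewrite !inE pw tw eqxx /=; split=> //; apply/negP.
  by move/(quart_ne Hq)=> [].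
by move/(quart_ne Hq)=> [].
Qed.

(** Every quartet is displayed by a split, taken with the side that avoids a
    prescribed leaf w: the cluster of the pair that lies across from w. *)
Lemma cluster_separates w a b c d : q a b c d ->
  exists2 C : {set T}, w \notin C /\ split_set C &
    [/\ a \in C, b \in C, c \notin C & d \notin C] \/
    [/\ c \in C, d \in C, a \notin C & b \notin C].
Proof.
have main x y z t : q x y z t -> z = w \/ q x y z w ->
  exists2 C : {set T}, w \notin C /\ split_set C &
    [/\ x \in C, y \in C, z \notin C & t \notin C].
  move=> h zw; have [xy xz xt yz [yt zt]] := quart_ne Hq h.
  have [xw yw] : x <> w /\ y <> w.
    by case: zw => [<-//|/(quart_ne Hq)[? ? ? ? []]].
  have [xC yC wC] := cluster_mem xw yw.
  exists (cluster w x y); first by split=> //; apply: cluster_split.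
  split=> //.
    by rewrite inE negb_and !negbK; case: zw => [->|->]; rewrite ?eqxx ?orbT.
  rewrite inE negb_and !negbK; have [//|/eqP tw] := eqVneq t w; rewrite /=.
  case: zw => [zw|zw]; first by rewrite -zw; quart_sym Hq.
  by apply: (@quart_transP _ q Hq _ _ _ _ z); quart_sym Hq.
move=> h; have h' : q c d a b by quart_sym Hq.
have [/eqP E|/eqP cw] := boolP (c == w).
  by have [C H1 H2] := main a b c d h (or_introl E); exists C => //; left.
have [/eqP E|/eqP aw] := boolP (a == w).
  by have [C H1 H2] := main c d a b h' (or_introl E); exists C => //; right.
have [h1|h1] := quart_subP Hq h (not_eq_sym aw) (not_eq_sym cw).
  by have [C H1 H2] := main a b c d h (or_intror h1); exists C => //; left.
have h2 : q c d a w by quart_sym Hq.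
by have [C H1 H2] := main c d a b h' (or_intror h2); exists C => //; right.
Qed.

(** Two sides that avoid w and meet in x are nested: otherwise a leaf in each
    difference would give the contradictory quartets xy|zw and xz|yw. *)
Lemma split_laminar w (C D : {set T}) x : split_set C -> split_set D ->
  w \notin C -> w \notin D -> x \in C -> x \in D -> C \subset D \/ D \subset C.
Proof.
move=> sC sD wC wD xC xD.
have [CD|/subsetPn[y yC yD]] := boolP (C \subset D); [by left|right].
apply/subsetP=> z zD; apply: contraT => zC.
have ne (E : {set T}) s t : s \in E -> t \notin E -> s <> t.
  by move=> sE + st; rewrite -st sE.
have h1 : q x y z w by apply: sC => //; apply: (ne D).
have h2 : q x z y w by apply: sD => //; apply: (ne C).
by case: (quart_excl1 Hq h1 h2).
Qed.

End Splits.

(** * Trees from quartet systems *)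

Section Rooted.
Variables (V : finType) (root : V) (par : V -> V) (ht : V -> nat).
Hypothesis ht_par : forall x, x != root -> ht x < ht (par x).

Definition par_rel : rel V :=
  [rel x y | (x != root) && (par x == y) || (y != root) && (par y == x)].

Lemma par_rel_sym : symmetric par_rel.
Proof. by move=> x y; rewrite /par_rel /= orbC. Qed.

Lemma par_edge x : x != root -> par_rel x (par x).
Proof. by move=> xr; rewrite /par_rel /= xr eqxx. Qed.

Lemma connect_root x : connect par_rel x root.
Proof.
have [n] := ubnP (\max_y ht y - ht x).
elim: n x => // n IH x le; have [->|xr] := eqVneq x root; first exact: connect0.
apply: connect_trans (connect1 (par_edge xr)) (IH _ _).
have h1 := ht_par xr; have h2 : ht (par x) <= \max_y ht y by apply: leq_bigmax.
rewrite -ltnS; apply: leq_trans le; rewrite ltnS ltn_sub2l //.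
exact: leq_trans h2.
Qed.

(** On a cycle, the two neighbours of a vertex of least height would both be
    its parent. *)
Lemma rooted_tree : is_tree par_rel.
Proof.
split.
- exact: par_rel_sym.
- move=> x; rewrite /par_rel /= orbb; apply/negP=> /andP[/ht_par + /eqP E].
  by rewrite E ltnn.
- move=> x y; apply: connect_trans (connect_root x) _.
  by rewrite (sym_connect_sym par_rel_sym) connect_root.
- move=> c uc; rewrite ltnNge; apply/negP=> sz.
  have [x0 x0c] : exists x, x \in c by case: c sz {uc} => // x c _; exists x; rewrite mem_head.
  have [x xc minx] := arg_minnP (P := mem c) ht x0c.
  have [i c' Ec] := rot_to xc.
  move: uc; rewrite -(rot_ucycle i) Ec => uc.
  have {}sz : 2 < size (x :: c') by rewrite -Ec size_rot.
  have {}minx y : y \in x :: c' -> par_rel x y -> y = par x.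
    rewrite -Ec mem_rot => yc /orP[/andP[_ /eqP<-]//|/andP[yr /eqP E]].
    by have := minx y yc; rewrite leqNgt -E ht_par.
  move: uc => /andP[]; case: c' sz minx {Ec} => // y [//|z s] _ minx.
  rewrite /cycle; set s' := z :: s; rewrite rcons_path => /andP[/= /andP[exy _]].
  rewrite par_rel_sym => exl /andP[_ /andP[ys' _]].
  have Ey : y = par x by apply: minx => //; rewrite !inE eqxx orbT.
  have El : last z s = par x by apply: minx; rewrite // inE [_ \in y :: _]inE mem_last !orbT.
  by move: ys'; rewrite Ey -El mem_last.
Qed.

End Rooted.

Section QuartetTree.
Variables (X : finType) (q : X -> X -> X -> X -> bool) (r : X).
Hypothesis Hq : quartets q.

(** The tree rooted at the leaf r has the sides of splits that avoid r as its
    vertices other than the root, which is the full set; inclusion is the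
    descendant relation. *)
Definition is_vertex (C : {set X}) : bool :=
  (C == setT) || [&& C != set0, r \notin C & `[< split_set q C >]].

Definition vertex := {C : {set X} | is_vertex C}.

Lemma vertexT_subproof : is_vertex setT. Proof. by rewrite /is_vertex eqxx. Qed.
Definition vertexT : vertex := Sub setT vertexT_subproof.

(** By [split_laminar] the vertices containing a given one form a chain, so
    that the smallest one is the parent. *)
Definition vpar (C : vertex) : vertex :=
  [arg min_(D < vertexT | val C \proper val D) #|val D|].

Definition vht (C : vertex) : nat := #|val C|.

Lemma vertexN0 (C : vertex) : exists x, x \in val C.
Proof.
have /orP[/eqP->|/and3P[/set0Pn //]] := valP C.
by exists r; rewrite inE.
Qed.

Lemma vertex_laminar (C D : vertex) x : x \in val C -> x \in val D ->
  val C \subset val D \/ val D \subset val C.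
Proof.
have /orP[/eqP->|/and3P[_ rC /asboolP sC]] := valP C; first by rewrite subsetT; right.
have /orP[/eqP->|/and3P[_ rD /asboolP sD]] := valP D; first by rewrite subsetT; left.
exact: (split_laminar Hq sC sD rC rD).
Qed.

Lemma vparP (C : vertex) : C != vertexT -> val C \proper val (vpar C) /\
  (forall D : vertex, val C \proper val D -> val (vpar C) \subset val D).
Proof.
move=> CT; rewrite /vpar; case: arg_minnP.
  by rewrite properT; apply: contra CT => /eqP E; apply/eqP/val_inj.
move=> P CP minP; split=> // D CD; have [x xC] := vertexN0 C.
have xP := subsetP (proper_sub CP) x xC; have xD := subsetP (proper_sub CD) x xC.
have [//|DP] := vertex_laminar xP xD.
have := minP D CD; rewrite leqNgt; apply: contraR => h.
by apply: proper_card; rewrite properE DP.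
Qed.

Lemma vht_par (C : vertex) : C != vertexT -> vht C < vht (vpar C).
Proof. by move=> /vparP[/proper_card]. Qed.

Definition vrel : rel vertex := par_rel vertexT vpar.

Lemma vertex_tree : is_tree vrel.
Proof. exact: rooted_tree vht_par. Qed.

(** The edge above C separates the descendants of C from the rest. *)
Lemma vside (C D : vertex) : C != vertexT ->
  side vrel C (vpar C) D = (val D \subset val C).
Proof.
move=> CT; apply/idP/idP.
  move=> h.
  have cl : closed (cut vrel C (vpar C)) [pred E : vertex | val E \subset val C].
    apply: intro_closed => [|E F /andP[/orP[]/andP[ET /eqP <-]] NE EC].
    - exact/sym_connect_sym/cut_sym/vertex_tree.
    - rewrite inE; have [_ -> //] := vparP ET.
      rewrite properEneq; move: EC; rewrite inE => ->; rewrite andbT.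
      by apply: contra NE => /eqP/val_inj ->; rewrite /is_edge !eqxx.
    - apply: subset_trans EC; have [/proper_sub //] := vparP ET.
  by have := closed_connect cl h; rewrite !inE subxx => <-.
have [n] := ubnP (#|val C| - #|val D|); elim: n D => // n IH D le DC.
have [->|DneC] := eqVneq D C; first exact: connect0.
have DpC : val D \proper val C.
  by rewrite properEneq DC andbT; apply: contra DneC => /eqP/val_inj->.
have DT : D != vertexT.
  by apply: contraTneq DpC => ->; rewrite properE subsetT andbC.
have [DP minP] := vparP DT.
have PC := minP _ DpC.
apply: (@connect_trans _ _ (vpar D)).
  apply: IH => //; have := proper_card DP; have := subset_leq_card PC.
  by move=> h1 h2; rewrite -ltnS; apply: leq_trans le; rewrite ltnS ltn_sub2l // (leq_trans h2).
apply: connect1; rewrite (cut_sym vertex_tree); apply/andP; split; first exact: par_edge.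
rewrite /is_edge (negbTE DneC) /= negb_and orbC.
have [E|//] := eqVneq (vpar D) C; rewrite /=.
apply: contraTneq DC => ->.
by have [+ _] := vparP CT; rewrite properE => /andP[].
Qed.

(** The leaf r is the root itself; the other leaves are the singletons. *)
Definition leaf_set (x : X) : {set X} := if x == r then setT else [set x].

Lemma leaf_set_vertex x : is_vertex (leaf_set x).
Proof.
rewrite /leaf_set; case: eqP => [_|/eqP xr]; first exact: vertexT_subproof.
apply/orP; right; rewrite [r \in _]inE [r == x]eq_sym xr andTb.
apply/andP; split; first by apply/set0Pn; exists x; rewrite inE.
by apply/asboolP=> a b c d; rewrite !inE => /eqP-> /eqP->.
Qed.

Definition leaf_vertex x : vertex := Sub (leaf_set x) (leaf_set_vertex x).

Lemma rootC_vertex : (exists x, x != r) -> is_vertex [set~ r].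
Proof.
move=> [x xr]; apply/orP; right; rewrite !inE eqxx /=; apply/andP; split.
  by apply/set0Pn; exists x; rewrite !inE.
by apply/asboolP=> a b c d; rewrite !inE !negbK => _ _ /eqP-> /eqP->.
Qed.

Lemma card1_unique (T : finType) (P : pred T) x : P x -> (forall y, P y -> y = x) ->
  #|P| == 1.
Proof.
move=> Px uP; apply/eqP; rewrite -(card1 x); apply: eq_card => y.
by rewrite !inE; apply/idP/eqP => [|->//]; apply: uP.
Qed.

(** The root has valence one because its only child is the complement of r. *)
Lemma leaf_vertex_leaf x : is_leaf vrel (leaf_vertex x).
Proof.
rewrite /is_leaf; have [xr|xr] := eqVneq x r.
  have -> : leaf_vertex x = vertexT by apply: val_inj; rewrite /= /leaf_set xr eqxx.
  have [/existsP /rootC_vertex vr|/existsPn N] := boolP [exists x, x != r].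
    apply/orP; left; pose R : vertex := Sub [set~ r] vr.
    have RT : R != vertexT.
      by apply/eqP=> /(congr1 val)/setP/(_ r); rewrite /= !inE eqxx.
    have RP : vpar R = vertexT.
      apply/val_inj/eqP; rewrite -subTset; have [h _] := vparP RT.
      apply/subsetP => y _; have [s [z zP]] := properP h.
      rewrite /= !inE negbK => /eqP Ez; have [->|yr] := eqVneq y r; first by rewrite -Ez.
      by apply: (subsetP s); rewrite /= !inE.
    apply: (@card1_unique _ _ R); first by rewrite /vrel /par_rel /= RT RP eqxx orbT.
    move=> D /orP[/andP[/eqP//]|/andP[DT /eqP DP]].
    have DR : val D \subset [set~ r].
      apply/subsetP=> y yD; rewrite !inE; apply: contraTneq yD => ->.
      by have /orP[|/and3P[]//] := valP D; move/eqP=> E; case/eqP: DT; apply: val_inj.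
    apply/eqP; apply: contraT => DneR; have [_ /(_ R)] := vparP DT.
    rewrite DP properEneq DR andbT => /(_ DneR)/subsetP/(_ r).
    by rewrite !inE eqxx => /(_ isT).
  apply/orP; right; apply: (@card1_unique _ _ vertexT) => // D _.
  have [y yD] := vertexN0 D; have /orP[/eqP E|/and3P[_ rD _]] := valP D.
    exact: val_inj.
  by move: (N y); rewrite negbK => /eqP yr; rewrite -yr yD in rD.
apply/orP; left; have lT : leaf_vertex x != vertexT.
  apply/eqP=> /(congr1 val)/setP/(_ r).
  by rewrite /= /leaf_set (negbTE xr) !inE eq_sym (negbTE xr).
apply: (@card1_unique _ _ (vpar (leaf_vertex x))).
  by rewrite /vrel /par_rel /= lT eqxx.
move=> D /orP[/andP[_ /eqP->//]|/andP[DT /eqP DP]]; exfalso.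
have [h _] := vparP DT; move: h; rewrite DP /= /leaf_set (negbTE xr).
have [y yD] := vertexN0 D; move=> /properP[/subsetP s [z]].
by rewrite inE => /eqP -> ; have := s y yD; rewrite inE => /eqP <-; rewrite yD.
Qed.

(** A vertex C that is neither the root nor a singleton has a parent and, as
    it properly contains a singleton vertex, a child. *)
Lemma leaf_vertexP (C : vertex) : is_leaf vrel C -> exists x, C = leaf_vertex x.
Proof.
have [-> _|CT] := eqVneq C vertexT.
  by exists r; apply: val_inj; rewrite /= /leaf_set eqxx.
have rC : r \notin val C.
  by have /orP[/eqP E|/and3P[]//] := valP C; case/eqP: CT; apply: val_inj.
have [x xC] := vertexN0 C.
have xr : x != r by apply: contraNneq rC => <-.
have [E _|xneC] := eqVneq (leaf_vertex x) C; first by exists x.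
have xpC : val (leaf_vertex x) \proper val C.
  rewrite properEneq (inj_eq val_inj) xneC /= /leaf_set (negbTE xr).
  by apply/subsetP=> y; rewrite inE => /eqP->.
rewrite /is_leaf => /orP[|/eqP V1]; last first.
  have := max_card (pred2 C vertexT); rewrite card2 V1.
  by rewrite CT.
have [D DC maxD] := arg_maxnP (P := fun D : vertex => val D \proper val C) vht xpC.
have DT : D != vertexT by apply: contraTneq DC => ->; rewrite properE subsetT andbC.
have DP : vpar D = C.
  have [h1 h2] := vparP DT; apply/eqP; apply: contraT => ne.
  have /maxD : val (vpar D) \proper val C by rewrite properEneq (inj_eq val_inj) ne h2.
  by rewrite /= leqNgt vht_par.
move=> /eqP c1; have : #|pred2 (vpar C) D| <= #|[pred y | vrel C y]|.
  apply: subset_leq_card; apply/subsetP=> E; rewrite !inE.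
  by case/orP=> /eqP->; rewrite /vrel /par_rel /= ?CT ?DT ?DP eqxx ?orbT.
rewrite c1 card2; have [E|//] := eqVneq (vpar C) D.
have := vht_par CT; rewrite E ltnNge => /negP[]; apply: ltnW.
exact: proper_card.
Qed.

Lemma leaf_subset x (C : vertex) : C != vertexT ->
  (val (leaf_vertex x) \subset val C) = (x \in val C).
Proof.
move=> CT; rewrite /= /leaf_set; have [->|xr] := eqVneq x r; last by rewrite sub1set.
rewrite subTset (_ : (r \in val C) = false).
  by apply/negbTE; apply: contra CT => /eqP E; apply/eqP/val_inj.
apply/negbTE; have /orP[/eqP E|/and3P[]//] := valP C.
by case/eqP: CT; apply: val_inj.
Qed.

Lemma leaf_vertex_inj : injective leaf_vertex.
Proof.
move=> x y /(congr1 val)/=; rewrite /leaf_set; case: eqP => [->|xr]; case: eqP => [->//|yr].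
- by move/setP/(_ r); rewrite !inE eq_sym => /esym/eqP.
- by move/setP/(_ r); rewrite !inE eq_sym => /eqP.
- exact: set1_inj.
Qed.

Lemma leaf_vertex_rel x1 x2 y1 y2 :
  tree_rel vrel (leaf_vertex x1) (leaf_vertex x2) (leaf_vertex y1) (leaf_vertex y2)
  <-> q x1 y1 x2 y2 || q x1 y2 x2 y1.
Proof.
have linj := leaf_vertex_inj.
have -> := tree_relE vertex_tree.
have -> : uniq [:: leaf_vertex x1; leaf_vertex x2; leaf_vertex y1; leaf_vertex y2] =
    uniq [:: x1; x2; y1; y2] by exact: (map_inj_uniq linj [:: x1; x2; y1; y2]).
split.
  move=> -[u [A [B [eAB s1 s2]]]].
  have [C CT [s1' s2']] : exists2 C : vertex, C != vertexT &
     (x1 \in val C) != (x2 \in val C) /\ (y1 \in val C) != (y2 \in val C).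
    case/orP: eAB (eAB) => /andP[AT /eqP AB] eAB; [exists A | exists B] => //;
      subst; move: s1 s2; rewrite ?[side _ _ (vpar B) _](side_flip vertex_tree) //.
      by rewrite !vside // !leaf_subset.
    rewrite !(side_flip vertex_tree _ (par_edge _ AT)) !(inj_eq negb_inj).
    by rewrite !vside // !leaf_subset.
  have /orP[/eqP E|/and3P[_ _ /asboolP sC]] := valP C; first by case/eqP: CT; apply: val_inj.
  move: u; rewrite /= !inE !negb_or.
  move=> /and4P[/and3P[n1 n2 n3] /andP[n4 n5] n6 _].
  have {}sC a b c d : a \in val C -> b \in val C -> c \notin val C -> d \notin val C ->
    a != b -> c != d -> q a b c d by move=> ? ? ? ? /eqP ? /eqP ?; apply: sC.
  have {}sC' a b c d : a \in val C -> b \in val C -> c \notin val C -> d \notin val C ->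
    a != b -> c != d -> q c d a b by move=> *; rewrite (quartS Hq); apply: sC.
  case h1: (x1 \in val C) s1'; case h2: (x2 \in val C) => // _;
  case h3: (y1 \in val C) s2'; case h4: (y2 \in val C) => // _; apply/orP.
  - by left; apply: sC; rewrite ?h1 ?h2 ?h3 ?h4.
  - by right; apply: sC; rewrite ?h1 ?h2 ?h3 ?h4 // eq_sym.
  - by right; apply: sC'; rewrite ?h1 ?h2 ?h3 ?h4 // eq_sym.
  - by left; apply: sC'; rewrite ?h1 ?h2 ?h3 ?h4.
have main a b c d : q a b c d -> uniq [:: a; b; c; d] /\ exists A B, [/\ vrel A B,
    side vrel A B (leaf_vertex a) != side vrel A B (leaf_vertex c),
    side vrel A B (leaf_vertex b) != side vrel A B (leaf_vertex d)
   & side vrel A B (leaf_vertex b) != side vrel A B (leaf_vertex c)].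
  move=> h; split; first exact: quart_uniq h.
  have [C [rC sC] sep] := cluster_separates Hq r h.
  have vC : is_vertex C.
    apply/orP; right; rewrite rC; apply/andP; split; last exact/asboolP.
    by apply/set0Pn; case: sep => -[*]; [exists a | exists c].
  pose A : vertex := Sub C vC.
  have AT : A != vertexT.
    by apply/eqP=> /(congr1 val)/setP/(_ r); rewrite /= inE (negbTE rC).
  exists A, (vpar A); rewrite !vside // !leaf_subset //=; split.
  - exact: par_edge.
  - by case: sep => -[h1 h2 h3 h4]; rewrite ?h1 ?h2 ?(negbTE h3) ?(negbTE h4).
  - by case: sep => -[h1 h2 h3 h4]; rewrite ?h1 ?h2 ?(negbTE h3) ?(negbTE h4).
  - by case: sep => -[h1 h2 h3 h4]; rewrite ?h1 ?h2 ?(negbTE h3) ?(negbTE h4).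
case/orP=> /main[u [A [B [eAB h1 h2 h3]]]].
  split; last by exists A, B.
  move: u; rewrite /= !inE !negb_or.
  by move=> /and4P[/and3P[-> -> ->] /andP[n1 ->] -> _]; rewrite eq_sym n1.
split; last by exists A, B; split=> //; rewrite eq_sym.
move: u; rewrite /= !inE !negb_or.
move=> /and4P[/and3P[-> -> ->] /andP[n1 n2] n3 _].
by rewrite n3 [x2 == y2]eq_sym n1 [y1 == y2]eq_sym n2.
Qed.

End QuartetTree.

(** Without any leaf to serve as the root, the empty tree is used. *)
Lemma quartets_tree_structure (X : finType) (q : X -> X -> X -> X -> bool) :
  quartets q -> is_tree_structure (fun x1 x2 y1 y2 => q x1 y1 x2 y2 || q x1 y2 x2 y1).
Proof.
move=> Hq; have [r _|X0] := pickP (@predT X).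
  exists (vertex q r), (@vrel X q r); split; first exact: vertex_tree.
  pose f (x : X) : leaf (@vrel X q r) := Sub (@leaf_vertex X q r x) (leaf_vertex_leaf r Hq x).
  exists f; split; last by move=> x1 x2 y1 y2; rewrite /leaf_rel /= leaf_vertex_rel.
  have surj l : exists x, f x == l.
    have [x E] := leaf_vertexP Hq (valP l).
    by exists x; apply/eqP/val_inj; rewrite /= -E.
  exists (fun l => xchoose (surj l)) => [x|l]; last exact/eqP/(xchooseP (surj l)).
  apply: (@leaf_vertex_inj X q r).
  by have /eqP/(congr1 val) := xchooseP (surj (f x)).
exists void, (fun _ _ => false); split.
  by split=> // -[].
have F (x : X) : False by have := X0 x.
exists (fun x => match F x with end); split; last by move=> x; case: (F x).
by exists (fun l : leaf (fun _ _ : void => false) => match (val l : void) return X with end) => [x|[[]]]; case: (F x).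
Qed.

Lemma quartets_inj (T T' : eqType) (q : T -> T -> T -> T -> bool) (f : T' -> T) :
  injective f -> quartets q -> quartets (fun a b c d => q (f a) (f b) (f c) (f d)).
Proof.
move=> fI Hq; have E := inj_eq fI; split=> *.
- exact: quartC Hq _ _ _ _.
- exact: quartS Hq _ _ _ _.
- by rewrite -!E; apply: (quart_neq Hq); eassumption.
- exact: (quart_excl Hq).
- by apply: (quart_trans Hq); rewrite ?E; eassumption.
- by apply: (quart_sub Hq); rewrite ?E.
Qed.

Lemma eq_quartets (T : eqType) (q q' : T -> T -> T -> T -> bool) :
  (forall a b c d, q a b c d = q' a b c d) -> quartets q -> quartets q'.
Proof.
move=> E Hq; suff -> : q' = q by [].
by do 4![apply: funext => ?]; rewrite E.
Qed.

(** * Tree structures as quartet systems *)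

Lemma ts_fin_subproof (X : treeStr) :
  exists (F : finType) (f : X -> F) (g : F -> X), cancel f g.
Proof.
case: (ts_proof X) => V [e [_ [f [[g fg _] _]]]].
by exists (leaf e : finType), f, g.
Qed.

Definition ts_fin (X : treeStr) : finType := projT1 (cid (ts_fin_subproof X)).
Definition ts_to (X : treeStr) : X -> ts_fin X :=
  projT1 (cid (projT2 (cid (ts_fin_subproof X)))).
Definition ts_of (X : treeStr) : ts_fin X -> X :=
  projT1 (cid (projT2 (cid (projT2 (cid (ts_fin_subproof X)))))).
Lemma ts_toK (X : treeStr) : cancel (@ts_to X) (@ts_of X).
Proof. exact: projT2 (cid (projT2 (cid (projT2 (cid (ts_fin_subproof X)))))). Qed.

HB.instance Definition _ (X : treeStr) := Finite.copy (ts_carrier X) (can_type (@ts_toK X)).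

(** ab|cd says exactly that both ways of pairing a, b with c, d are separated
    by a common edge; a single one of the two relations would leave open
    whether a is grouped with b or with the other leaf. *)
Definition quart (X : treeStr) (a b c d : X) : bool :=
  `[< ts_rel a c b d /\ ts_rel a d b c >].

Lemma rel_of_quartets (T : eqType) (q : T -> T -> T -> T -> bool) a b c d :
  quartets q ->
  `[< (q a b c d || q a d c b) /\ (q a b d c || q a c d b) >] = q a b c d.
Proof.
move=> Hq; apply/asboolP/idP; last by move=> h; rewrite h; split=> //; apply/orP; left; quart_sym Hq.
case=> /orP[//|h1] /orP[h2|h2]; first by quart_sym Hq.
by exfalso; apply: (quart_excl1 Hq h1); quart_sym Hq.
Qed.

Lemma ts_quart_exists (X : treeStr) : exists2 q : X -> X -> X -> X -> bool,
  quartets q & forall x1 x2 y1 y2,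
    @ts_rel X x1 x2 y1 y2 <-> q x1 y1 x2 y2 || q x1 y2 x2 y1.
Proof.
case: (ts_proof X) => V [e [tV [f [bf fR]]]].
have [q Hq qR] := tree_quartets tV.
exists (fun a b c d => q (f a) (f b) (f c) (f d)).
  exact: (@quartets_inj (leaf e) X q f (bij_inj bf)).
by move=> x1 x2 y1 y2; apply: iff_trans (fR _ _ _ _) (qR _ _ _ _).
Qed.

Lemma quartP (X : treeStr) : exists2 q : X -> X -> X -> X -> bool,
  quartets q /\ (forall x1 x2 y1 y2,
    @ts_rel X x1 x2 y1 y2 <-> q x1 y1 x2 y2 || q x1 y2 x2 y1) &
  forall a b c d, quart a b c d = q a b c d.
Proof.
have [q Hq qR] := ts_quart_exists X; exists q => // a b c d.
rewrite -(rel_of_quartets a b c d Hq); apply: asbool_equiv_eq.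
by split=> -[/qR h1 /qR h2]; split=> //; apply/qR.
Qed.

Lemma quart_quartets (X : treeStr) : quartets (@quart X).
Proof.
have [q [Hq _] E] := quartP X; apply: eq_quartets Hq => a b c d; by rewrite E.
Qed.
#[global] Hint Resolve quart_quartets : core.

Lemma ts_relE (X : treeStr) (x1 x2 y1 y2 : X) :
  ts_rel x1 x2 y1 y2 <-> quart x1 y1 x2 y2 || quart x1 y2 x2 y1.
Proof. by have [q [_ qR] E] := quartP X; rewrite !E; apply: qR. Qed.

Lemma emb_quart (X Y : treeStr) (i : embedding X Y) a b c d :
  quart (i a) (i b) (i c) (i d) = quart a b c d.
Proof.
apply: asbool_equiv_eq; have E := emb_rel i.
by split=> -[h1 h2]; split; apply/E.
Qed.

Section MakeEmbedding.
Variables (X Y : treeStr) (f : X -> Y).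
Hypothesis fI : injective f.
Hypothesis fq : forall a b c d, quart (f a) (f b) (f c) (f d) = quart a b c d.

Lemma mk_emb_rel : preserves (@ts_rel X) (@ts_rel Y) f.
Proof. by move=> *; rewrite !ts_relE !fq. Qed.

Definition mk_emb : embedding X Y := Embedding fI mk_emb_rel.
End MakeEmbedding.

Section MakeStructure.
Variables (T : Type) (finT : Finite.axioms_ T) (q : T -> T -> T -> T -> bool).
Hypothesis Hq : @quartets (Finite.Pack finT) q.

Definition mk_ts : treeStr :=
  @TreeStr T (fun x1 x2 y1 y2 => q x1 y1 x2 y2 || q x1 y2 x2 y1)
    (@quartets_tree_structure (Finite.Pack finT) q Hq).

Lemma mk_quart (a b c d : mk_ts) : quart a b c d = q a b c d.
Proof. exact: rel_of_quartets Hq. Qed.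
End MakeStructure.

(** * Directions at an added point *)

Section Branches.
Variables (T : finType) (q : T -> T -> T -> T -> bool).
Hypothesis Hq : quartets q.
Implicit Types (A : {set T}) (a b c d y w : T).

(** Two leaves of A are in the same direction from the point where y is
    attached to the tree of A: a third leaf w of A sees them joined before
    y. *)
Definition sim A y a b : bool := (a == b) || [exists w in A, q a b y w].

Lemma simP A y a b : reflect (a = b \/ exists2 w, w \in A & q a b y w) (sim A y a b).
Proof.
apply: (iffP orP) => -[h|h].
- by left; apply/eqP.
- by right; have /exists_inP := h.
- by left; apply/eqP.
- by right; apply/exists_inP.
Qed.

Lemma sim_quart A y a b w : w \in A -> q a b y w -> sim A y a b.
Proof. by move=> wA h; apply/simP; right; exists w. Qed.

Lemma sim_neP A y a b : sim A y a b -> a <> b -> exists2 w, w \in A & q a b y w.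
Proof. by move/simP=> []. Qed.

Lemma sim_refl A y a : sim A y a a.
Proof. by rewrite /sim eqxx. Qed.

Lemma sim_sym A y a b : sim A y a b = sim A y b a.
Proof.
rewrite /sim eq_sym; congr (_ || _); apply: eq_existsb => w.
by rewrite (quartC Hq).
Qed.

Lemma sim_trans A y b a c : sim A y a b -> sim A y b c -> sim A y a c.
Proof.
move=> /simP[->//|[w wA h1]] /simP[<-|[w' w'A h2]]; first by apply: sim_quart h1.
have [_ _ _ cy _] := quart_ne Hq h2; have [_ ay _ _ _] := quart_ne Hq h1.
have [<-|/eqP ac] := eqVneq a c; first exact: sim_refl.
have [h3|h3] := quart_subP Hq h1 (not_eq_sym ac) cy; last exact: sim_quart h3.
have h2' : q c b y w' by quart_sym Hq.
have [h4|h4] := quart_subP Hq h2' ac ay; last first.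
  by rewrite sim_sym; apply: sim_quart h4.
have h3' : q b a c y by quart_sym Hq.
by case: (quart_excl1 Hq h3'); quart_sym Hq.
Qed.

Lemma sim_congr A y a b c : sim A y a b -> sim A y a c = sim A y b c.
Proof.
move=> ab; apply/idP/idP; last exact: sim_trans.
by rewrite sim_sym in ab; apply: sim_trans.
Qed.

Lemma sim_split1 A y a b c : y \notin A -> c \in A -> sim A y a b -> a <> b ->
  ~~ sim A y a c -> q a b y c.
Proof.
move=> yA cA ab ne ac; have [w wA h] := sim_neP ab ne.
have ca : c <> a by move=> E; rewrite E sim_refl in ac.
have cy : c <> y by move=> E; rewrite -E cA in yA.
have [//|h'] := quart_subP Hq h ca cy.
by rewrite (sim_quart wA h') in ac.
Qed.

Lemma sim_split2 A y a b c d : y \notin A -> c \in A -> d \in A ->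
  sim A y a b -> a <> b -> ~~ sim A y a c -> ~~ sim A y a d -> c <> d -> q a b c d.
Proof.
move=> yA cA dA ab ne ac ad; apply: (@quart_transP _ q Hq _ _ _ _ y).
  by have h := sim_split1 yA cA ab ne ac; quart_sym Hq.
by have h := sim_split1 yA dA ab ne ad; quart_sym Hq.
Qed.

Lemma sim_star A y a b c d : y \notin A -> a \in A -> c \in A -> q a b c d ->
  sim A y a b || sim A y c d.
Proof.
move=> yA aA cA h.
have ya : y <> a by move=> E; rewrite E aA in yA.
have yc : y <> c by move=> E; rewrite E cA in yA.
have [h'|h'] := quart_subP Hq h ya yc; apply/orP; [left|right].
  by apply: (sim_quart cA); quart_sym Hq.
by apply: (sim_quart aA); quart_sym Hq.
Qed.

(** If all leaves were in one direction from y, then y would not be attached to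
    the tree of the leaves.  For a leaf m at which the set of leaves x without
    am|xy is largest, the leaf w that witnesses the direction of m and a would
    give a strictly larger set. *)
Lemma sim_two A y a b : a \in A -> b \in A -> y \notin A -> a <> b ->
  exists2 c, c \in A & ~~ sim A y a c.
Proof.
move=> aA bA yA ab; apply: contrapT => N.
have {}N c : c \in A -> sim A y a c.
  by move=> cA; apply: contraT => h; case: N; exists c.
pose C b := [set x in A | ~~ q a b x y].
have [m /andP[mA /eqP ma] maxm] :=
  arg_maxnP (P := fun b => (b \in A) && (b != a)) (fun b => #|C b|)
    (introT andP (conj bA (introN eqP (not_eq_sym ab)))).
have [w wA h] := sim_neP (N m mA) (not_eq_sym ma).
have [_ _ aw _ _] := quart_ne Hq h.
have /maxm : (w \in A) && (w != a) by rewrite wA; apply/eqP => /esym.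
rewrite /= leqNgt => /negP; apply; apply: proper_card; apply/properP; split.
  apply/subsetP => x; rewrite !inE => /andP[xA Nx]; rewrite xA /=.
  apply: contra Nx => h2; have [xw xy xa] : [/\ x <> w, x <> y & x <> a].
    by have [? /nesym ? ? /nesym ? [? ?]] := quart_ne Hq h2.
  have h' : q a m w y by quart_sym Hq.
  have [h3|h3] := quart_subP Hq h xa xy; first by quart_sym Hq.
  by case: (quart_excl2 Hq h3); quart_sym Hq.
exists w; rewrite !inE wA /= ?negbK; last by quart_sym Hq.
by apply/negP=> /(quart_ne Hq)[? ? ? ? []].
Qed.

(** The quartets through y are determined by the directions at y and the
    quartets of A, so that a one-point extension is determined by its
    directions. *)
Lemma quart_sim A y a b c : y \notin A -> a \in A -> b \in A -> c \in A ->
  q y a b c = [&& b != c, sim A y b c &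
    ~~ sim A y a b || [exists w in A, ~~ sim A y a w && q w a b c]].
Proof.
move=> yA aA bA cA; apply/idP/and3P.
  move=> h; have bc : b <> c by have [_ _ _ _ []] := quart_ne Hq h.
  have sbc : sim A y b c by apply: (sim_quart aA); quart_sym Hq.
  split=> //; first exact/eqP.
  have [sab|//] := boolP (sim A y a b); apply/exists_inP.
  have [w wA bw] := sim_two bA cA yA bc.
  exists w => //; rewrite (sim_congr w sab) bw /=.
  have h1 := sim_split1 yA wA sbc bc bw.
  have wa : w <> a by move=> E; rewrite E sim_sym sab in bw.
  rewrite (quartS Hq); apply: (@quart_transP _ q Hq _ _ _ _ y) => //; quart_sym Hq.
case=> /eqP bc sbc /orP[ab|/exists_inP[w wA /andP[aw h]]].
  by have h := sim_split1 yA aA sbc bc; rewrite sim_sym ab in h; have := h isT => {}h; quart_sym Hq.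
have ya : y <> a by move=> E; rewrite E aA in yA.
have [sab|ab] := boolP (sim A y a b); last first.
  by have h' := sim_split1 yA aA sbc bc; rewrite sim_sym ab in h'; have := h' isT => {}h'; quart_sym Hq.
have h1 : q b c y w by apply: (sim_split1 yA wA sbc bc); rewrite -(sim_congr w sab).
rewrite (quartS Hq); apply: (@quart_transP _ q Hq _ _ _ _ w) => //; quart_sym Hq.
Qed.

End Branches.

(** * Adding a point to a quartet system *)

(** The equivalence relations that are the partition into directions at a point
    of the tree of [q]: two leaves of one block form a quartet with any two
    leaves outside, every quartet has a pair inside a block, and there are two
    blocks as soon as there are two leaves. *)
Record place (T : finType) (q : T -> T -> T -> T -> bool) (e : rel T) : Prop := Place {
  place_refl : reflexive e;
  place_sym : symmetric e;
  place_trans : transitive e;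
  place_split : forall a b c d, e a b -> a <> b -> ~~ e a c -> ~~ e a d -> c <> d ->
    q a b c d;
  place_star : forall a b c d, q a b c d -> e a b || e c d;
  place_two : forall a b, a <> b -> exists c, ~~ e a c
}.

Section Extension.
Variables (T : finType) (q : T -> T -> T -> T -> bool) (e : rel T).
Hypotheses (Hq : quartets q) (He : place q e).

Let eC := place_sym He.

Lemma place_congr a b c : e a b -> e a c = e b c.
Proof.
move=> ab; apply/idP/idP; apply: (place_trans He) => //; by rewrite eC.
Qed.

(** The splits of the extended tree, given by the side that avoids the new
    leaf: the sides of splits of the old tree contained in one block. *)
Definition ext_index : Type :=
  {S : {set T} | `[< split_set q S /\ {in S &, forall a b, e a b} >]}.

Definition Ext_index (C : {set T})
  (HC : `[< split_set q C /\ {in C &, forall a b, e a b} >]) : ext_index :=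
  @exist _ _ C HC.

Definition ext_side (S : ext_index) : pred (option T) :=
  fun o => if o is Some a then a \in val S else false.

(** The new leaf is [None]. *)
Definition ext_q := separated ext_side.

Lemma ext_quartets : quartets ext_q.
Proof.
apply: separated_quartets => -[S /= HS] [S' /= HS'].
have /asboolP[sS eS] := HS; have /asboolP[sS' eS'] := HS'.
have [/existsP[x /andP[xS xS']]|/existsPn N] := boolP [exists x, (x \in S) && (x \in S')]; last first.
  by exists true, true => -[x|//] /=; apply: contra (N x) => /andP[/eqP-> /eqP->].
have [SS|/subsetPn[y yS yS']] := boolP (S \subset S').
  exists true, false => -[x'|//] /=; apply/negP=> /andP[/eqP h].
  by rewrite (subsetP SS).
have xy : x <> y by move=> E; rewrite -E xS' in yS'.
have [w xw] := place_two He xy.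
have wS : w \notin S by apply: contra xw; apply: eS.
have wS' : w \notin S' by apply: contra xw; apply: eS'.
have [/subsetP/(_ y yS)|SS] := split_laminar Hq sS sS' wS wS' xS xS'.
  by rewrite (negbTE yS').
exists false, true => -[x'|//] /=; apply/negP=> /andP[/eqP + /eqP h].
by rewrite (subsetP SS).
Qed.

(** A quartet xy|zt has a pair, say x, y, in one block.  The cluster of x, y that
    avoids a leaf outside of the block lies in the block.  If z or t is outside,
    this cluster gives the quartet.  Otherwise take any w outside: xy|zw or
    xw|zt, and the cluster of x, y or of z, t that avoids w does. *)
Lemma ext_q_some a b c d : ext_q (Some a) (Some b) (Some c) (Some d) = q a b c d.
Proof.
apply/separatedP/idP.
  case=> ab cd [[S /= HS] [s []]]; rewrite /ext_side /=.
  have /asboolP[sS _] := HS.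
  have {}ab : a <> b by move/eqP: ab => ab E; case: ab; rewrite E.
  have {}cd : c <> d by move/eqP: cd => cd E; case: cd; rewrite E.
  case: s => /= h1 h2 h3 h4; first by apply: sS; rewrite ?h1 ?h2 ?h3 ?h4.
  by rewrite (quartS Hq); apply: sS; rewrite ?h1 ?h2 ?h3 ?h4.
move=> h; have [ab ac ad bc [bd cd]] := quart_ne Hq h.
split; [by apply/eqP=> -[] | by apply/eqP=> -[] | ].
have main x y z t : q x y z t -> e x y -> exists (S : ext_index) (s : bool),
    [/\ (x \in val S) = s, (y \in val S) = s, (z \in val S) = ~~ s & (t \in val S) = ~~ s].
  move=> {a b c d h ab ac ad bc bd cd} h exy.
  have [xy xz xt yz [yt zt]] := quart_ne Hq h.
  have block p r w : p <> r -> e p r -> ~~ e p w ->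
      `[< split_set q (cluster q w p r) /\ {in cluster q w p r &, forall a b, e a b} >].
    move=> pr epr pw; apply/asboolP; split; first exact: cluster_split.
    suff H u : u \in cluster q w p r -> e p u.
      by move=> u v /H eu /H ev; rewrite -(place_congr _ eu).
    rewrite inE => /andP[/eqP uw]; apply: contraR => pu.
    exact: (place_split He).
  have blk w : ~~ e x w -> (z = w \/ q x y z w) -> exists (S : ext_index) (s : bool),
    [/\ (x \in val S) = s, (y \in val S) = s, (z \in val S) = ~~ s & (t \in val S) = ~~ s].
    move=> xw zw; pose S : ext_index := Ext_index (block x y w xy exy xw).
    have xnw : x <> w by move=> E; move: (xw); rewrite -E (place_refl He).
    have ynw : y <> w by move=> E; move: (xw); rewrite -E exy.
    have [xS yS _] := cluster_mem Hq xnw ynw.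
    exists S, true; split=> //; apply/negbTE; rewrite /= !inE !negb_and !negbK.
      by case: zw => [->|->]; rewrite ?eqxx ?orbT.
    have [//|/eqP tw] := eqVneq t w; rewrite /=.
    case: zw => [<-|zw]; first by quart_sym Hq.
    by apply: (@quart_transP _ q Hq _ _ _ _ z); quart_sym Hq.
  have [w xw] := place_two He xy.
  have split_xy u v : ~~ e x u -> ~~ e x v -> u <> v -> q x y u v by exact: (place_split He).
  have [xz'|xz'] := boolP (e x z); last by apply: (blk z) => //; left.
  have [xt'|xt'] := boolP (e x t).
  - have zw : ~~ e z w by rewrite -(place_congr w xz').
    have wx : w <> x by move=> E; rewrite E (place_refl He) in xw.
    have wz : w <> z by move=> E; rewrite E (place_refl He) in zw.
    have [h1|h1] := quart_subP Hq h wx wz; first by apply: (blk w) => //; right.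
    have ezt : e z t by rewrite -(place_congr _ xz').
    pose S : ext_index := Ext_index (block z t w zt ezt zw).
    have znw : z <> w by move/esym.
    have tnw : t <> w by move=> E; move: (zw); rewrite -E ezt.
    have [zS tS _] := cluster_mem Hq znw tnw.
    have xw2 : q z t x w by quart_sym Hq.
    have yw2 : q z t y w.
      apply: (@quart_transP _ q Hq _ _ _ _ x); try by quart_sym Hq.
      by move=> E; move: (xw); rewrite -E exy.
    by exists S, false; split=> //; apply/negbTE; rewrite /= !inE ?xw2 ?yw2 andbF.
  - by apply: (blk t) => //; right.
case/orP: (place_star He h) => /main.
  by move/(_ _ _ h) => -[S [s [*]]]; exists S, s.
have h' : q c d a b by quart_sym Hq.
by move=> /(_ _ _ h') [S [s [*]]]; exists S, (~~ s); rewrite negbK.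
Qed.

Lemma ext_q_sim a b :
  sim ext_q [set Some x | x in T] None (Some a) (Some b) = e a b.
Proof.
apply/simP/idP.
  case=> [[->]|[_ /imsetP[w _ ->] /separatedP[_ _ [[S HS] [s]]]]].
    exact: (place_refl He).
  have /asboolP[_ eS] := HS; rewrite /ext_side /=.
  by case: s => -[] // *; apply: eS.
move=> ab; have [->|/eqP nab] := eqVneq a b; [by left | right].
have [c ac] := place_two He nab.
exists (Some c); first by rewrite imset_f.
have HS : `[< split_set q [set x | e a x] /\ {in [set x | e a x] &, forall a b, e a b} >].
  apply/asboolP; split.
    move=> x y z t; rewrite !inE => ax ay az at_ xy zt.
    by apply: (place_split He) => //; rewrite -(place_congr _ ax).
  by move=> x y; rewrite !inE => ax ay; rewrite -(place_congr _ ax).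
apply/separatedP; split=> //; first by apply/eqP=> -[].
exists (Ext_index HS), true; rewrite /ext_side /= !inE; split=> //.
- exact: (place_refl He).
- exact/negbTE.
Qed.

End Extension.

Lemma sim_place (T : finType) (q : T -> T -> T -> T -> bool) (X : finType)
    (i : X -> T) (y : T) : quartets q -> injective i -> y \notin i @: [set: X] ->
  place (fun a b c d => q (i a) (i b) (i c) (i d))
    (fun a b => sim q (i @: [set: X]) y (i a) (i b)).
Proof.
move=> Hq iI yA; have iA x : i x \in i @: [set: X] by rewrite imset_f.
split.
- by move=> a; apply: sim_refl.
- by move=> a b; apply: sim_sym.
- by move=> b a c; apply: sim_trans.
- by move=> a b c d ab ne ac ad cd; apply: (sim_split2 Hq yA) => // /iI.
- by move=> a b c d; apply: sim_star.
- move=> a b ab; have [|c /imsetP[x _ ->] h] := sim_two Hq (iA a) (iA b) yA _; last by exists x.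
  by move/iI.
Qed.

(** * One-point extensions *)

Definition im (X Y : treeStr) (i : embedding X Y) : {set Y} := i @: [set: X].

Lemma im_mem (X Y : treeStr) (i : embedding X Y) x : i x \in im i.
Proof. by rewrite imset_f. Qed.

Lemma emb_eq (X Y : treeStr) (i : embedding X Y) a b : (i a == i b) = (a == b).
Proof. by apply/eqP/eqP => [/(@emb_inj _ _ i)|->]. Qed.

Lemma imP (X Y : treeStr) (i : embedding X Y) y : reflect (exists x, y = i x) (y \in im i).
Proof.
by apply: (iffP imsetP) => [[x _ ->]|[x ->]]; exists x.
Qed.

Definition branch (X Y : treeStr) (i : embedding X Y) (y : Y) : rel X :=
  fun a b => sim (@quart Y) (im i) y (i a) (i b).

Definition one_point (X Y : treeStr) (i : embedding X Y) (y : Y) : Prop :=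
  y \notin im i /\ forall t, t \in im i \/ t = y.

Lemma branch_place (X Y : treeStr) (i : embedding X Y) y : y \notin im i ->
  place (@quart X) (branch i y).
Proof.
move=> yi; have := sim_place (quart_quartets Y) (@emb_inj _ _ i) yi.
suff -> : (fun a b c d => quart (i a) (i b) (i c) (i d)) = @quart X by [].
by do 4![apply: funext => ?]; rewrite emb_quart.
Qed.

Lemma quart_branch (X Y : treeStr) (i : embedding X Y) y a b c : y \notin im i ->
  quart y (i a) (i b) (i c) = [&& b != c, branch i y b c &
    ~~ branch i y a b || [exists w, ~~ branch i y a w && quart w a b c]].
Proof.
move=> yi; rewrite (quart_sim (quart_quartets Y) yi) ?im_mem // emb_eq.
congr [&& _, _ & _ || _]; apply/exists_inP/existsP.
  by case=> _ /imP[w ->]; rewrite emb_quart; exists w.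
by case=> w h; exists (i w); rewrite ?emb_quart ?im_mem.
Qed.

Section OnePointMap.
Variables (X Y Z : treeStr) (i : embedding X Y) (y : Y) (g : embedding X Z) (z : Z).
Hypotheses (iy : one_point i y) (gz : z \notin im g).
Hypothesis (E : forall a b, branch i y a b = branch g z a b).

Definition one_point_fun (t : Y) : Z := if [pick x | i x == t] is Some x then g x else z.

Lemma one_point_funE x : one_point_fun (i x) = g x.
Proof.
rewrite /one_point_fun; case: pickP => [x' /eqP/(@emb_inj _ _ i)->//|/(_ x)].
by rewrite eqxx.
Qed.

Lemma one_point_funy : one_point_fun y = z.
Proof.
rewrite /one_point_fun; case: pickP => // x /eqP E'.
by case: iy => /imP[]; exists x.
Qed.

Lemma one_point_fun_inj : injective one_point_fun.
Proof.
move=> s t; case: iy => _ H.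
case: (H s) => [/imP[a ->]|->]; case: (H t) => [/imP[b ->]|->];
  rewrite ?one_point_funE ?one_point_funy //.
- by move/(@emb_inj _ _ g)->.
- by move=> E'; case/imP: gz; exists a.
- by move=> E'; case/imP: gz; exists b.
Qed.

(** By [quart_branch], both sides are the same expression in the directions and
    the quartets of X. *)
Lemma one_point_fun_quart a b c d : quart (one_point_fun a) (one_point_fun b)
  (one_point_fun c) (one_point_fun d) = quart a b c d.
Proof.
case: iy => yi H.
have key p r s : quart z (g p) (g r) (g s) = quart y (i p) (i r) (i s).
  rewrite (quart_branch _ _ _ gz) (quart_branch _ _ _ yi) E.
  by congr [&& _, _ & _ || _]; [rewrite E | apply: eq_existsb => w; rewrite E].
have HY := quart_quartets Y; have HZ := quart_quartets Z.
have key2 p r s : quart (g p) z (g r) (g s) = quart (i p) y (i r) (i s).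
  by rewrite (quartC HZ) (quartC HY).
have key3 p r s : quart (g p) (g r) z (g s) = quart (i p) (i r) y (i s).
  by rewrite (quartS HZ) (quartS HY).
have key4 p r s : quart (g p) (g r) (g s) z = quart (i p) (i r) (i s) y.
  by rewrite (quartS HZ) (quartS HY) key2.
have no (U : treeStr) (p r s t : U) : ~~ uniq [:: p; r; s; t] -> quart p r s t = false.
  by move=> h; apply/negbTE; apply: contra h; apply: quart_uniq.
case: (H a) => [/imP[a' ->]|->]; case: (H b) => [/imP[b' ->]|->];
case: (H c) => [/imP[c' ->]|->]; case: (H d) => [/imP[d' ->]|->];
rewrite ?one_point_funE ?one_point_funy ?emb_quart ?key ?key2 ?key3 ?key4 //;
by rewrite !no //= !inE !eqxx ?orbT ?andbF.
Qed.

(** Two one-point extensions of X at the same place are isomorphic over X. *)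
Definition one_point_map : embedding Y Z :=
  mk_emb one_point_fun_inj one_point_fun_quart.

End OnePointMap.

Section ExtStructure.
Variables (X : treeStr) (e : rel X).
Hypothesis He : place (@quart X) e.

Definition ext_ts : treeStr :=
  @mk_ts (option X) (Finite.class (option X : finType)) _ (ext_quartets (quart_quartets X) He).

Lemma ext_quart (a b c d : ext_ts) : quart a b c d = ext_q (@quart X) e a b c d.
Proof. exact: mk_quart. Qed.

Definition ext_emb : embedding X ext_ts.
Proof.
apply: (@mk_emb X ext_ts (@Some X)) => [|a b c d]; first by move=> a b [].
by rewrite ext_quart; apply: ext_q_some (quart_quartets X) He _ _ _ _.
Defined.

Definition ext_pt : ext_ts := None.

Lemma ext_one_point : one_point ext_emb ext_pt.
Proof.
split=> [|[x|]]; [by apply/imP=> -[] | left | by right].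
by apply/imP; exists x.
Qed.

Lemma ext_branch a b : branch ext_emb ext_pt a b = e a b.
Proof.
rewrite -(ext_q_sim He); apply/simP/simP.
  case=> [|[_ /imP[w ->] h]]; [by left | right; exists (Some w)]; first by rewrite imset_f.
  by rewrite ext_quart in h.
case=> [|[_ /imsetP[w _ ->] h]]; [by left | right; exists (ext_emb w)] ; first exact: im_mem.
by rewrite ext_quart.
Qed.
End ExtStructure.

(** * Adding two points *)

Section TwoPoints.
Variables (T : finType) (q : T -> T -> T -> T -> bool).
Hypothesis Hq : quartets q.
Implicit Types (A B C D : {set T}) (a b c d y z w : T).

Definition block A y a : {set T} := [set b in A | sim q A y a b].
Definition blocks A y : {set {set T}} := [set block A y a | a in A].
Definition nblocks A y : nat := #|blocks A y|.
Definition nsingle A y : nat := #|[set B in blocks A y | #|B| == 1]|.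

(** When y and z are added to the tree of A, they may form a cherry; or they
    may be attached at different points, in which case an edge separates
    some a and z from some w and y; or they are attached separately at the same
    point.  The second case is called inner, after the path from the point of y
    to that of z. *)
Definition cherry A y z : bool :=
  [forall a in A, forall b in A, (a != b) ==> q a b y z].
Definition inner A y z : bool := [exists a in A, exists w in A, q z a y w].

Lemma cherryP A y z :
  reflect (forall a b, a \in A -> b \in A -> a <> b -> q a b y z) (cherry A y z).
Proof.
apply: (iffP forall_inP) => [H a b aA bA /eqP ab|H a aA].
  by have /forall_inP/(_ b bA)/implyP/(_ ab) := H a aA.
by apply/forall_inP=> b bA; apply/implyP=> /eqP ab; apply: H.
Qed.

Lemma innerP A y z :
  reflect (exists a w, [/\ a \in A, w \in A & q z a y w]) (inner A y z).
Proof.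
apply: (iffP exists_inP) => [[a aA /exists_inP[w wA h]]|[a [w [aA wA h]]]].
  by exists a, w.
by exists a => //; apply/exists_inP; exists w.
Qed.

Lemma inner_sym A y z : inner A y z = inner A z y.
Proof.
by apply/innerP/innerP => -[a [w [aA wA h]]]; exists w, a; split=> //; quart_sym Hq.
Qed.

Lemma cherry_sym A y z : cherry A y z = cherry A z y.
Proof.
by apply/cherryP/cherryP => H a b aA bA ab; have h := H a b aA bA ab; quart_sym Hq.
Qed.

Lemma cherry_inner A y z : cherry A y z -> ~~ inner A y z.
Proof.
move=> /cherryP H; apply/innerP => -[a [w [aA wA h]]].
have [_ _ _ _ [aw _]] := quart_ne Hq h.
have h1 := H a w aA wA aw.
have h2 : q a z w y by quart_sym Hq.
by apply: (quart_excl1 Hq h2); quart_sym Hq.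
Qed.

Lemma cherry_small A y z : #|A| <= 1 -> cherry A y z.
Proof.
move=> A1; apply/cherryP=> a b aA bA ab; case: ab.
exact: (card_le1_eqP A1).
Qed.

Lemma mem_block A y a b : (b \in block A y a) = (b \in A) && sim q A y a b.
Proof. by rewrite inE. Qed.

Lemma blockP A y a b : a \in A -> b \in A ->
  reflect (block A y a = block A y b) (sim q A y a b).
Proof.
move=> aA bA; apply: (iffP idP) => [ab|/setP/(_ b)].
  by apply/setP=> c; rewrite !mem_block (sim_congr Hq c ab).
by rewrite !mem_block bA sim_refl.
Qed.

Lemma block_memP A y B : reflect (exists2 a, a \in A & B = block A y a) (B \in blocks A y).
Proof. exact: imsetP. Qed.

Lemma block_in A y a : a \in A -> block A y a \in blocks A y.
Proof. by move=> aA; apply: imset_f. Qed.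

Lemma block_eq A y B a : B \in blocks A y -> a \in B -> B = block A y a.
Proof.
move=> /block_memP[b bA ->]; rewrite mem_block => /andP[aA ba].
exact/blockP.
Qed.

Lemma block_sub A y B : B \in blocks A y -> B \subset A.
Proof. by move=> /block_memP[b bA ->]; apply/subsetP=> a; rewrite mem_block => /andP[]. Qed.

Lemma block_neq0 A y B : B \in blocks A y -> exists2 a, a \in A & a \in B.
Proof. by move=> /block_memP[b bA ->]; exists b => //; rewrite mem_block bA sim_refl. Qed.

Lemma sim_add A y z a b :
  sim q (z |: A) y a b = sim q A y a b || q a b y z.
Proof.
apply/simP/orP.
  case=> [->|[w]]; first by left; apply: sim_refl.
  rewrite !inE => /orP[/eqP-> h|wA h]; [by right | left].
  exact: sim_quart h.
case=> [/simP[->|[w wA h]]|h]; [by left | right; exists w | right; exists z] => //.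
  by rewrite !inE wA orbT.
by rewrite !inE eqxx.
Qed.

Lemma sim_addz A y z a : z != a ->
  sim q (z |: A) y z a = [exists w in A, q z a y w].
Proof.
move=> /negbTE za; rewrite sim_add /sim za /=.
case h: (q z a y z); last by rewrite orbF.
by have [_ _ + _ _] := quart_ne Hq h.
Qed.

(** If z is the only leaf that sees a and b joined before y, then a point of the
    path from a to b separates y, z from all of A, and y, z form a cherry. *)
Lemma not_cherry_sim A y z a b : y != z -> y \notin A -> z \notin A ->
  ~~ cherry A y z -> a \in A -> b \in A ->
  sim q (z |: A) y a b = sim q A y a b.
Proof.
move=> yz yA zA N aA bA; rewrite sim_add; case E : (sim q A y a b) => //=.
apply: contraNF N => h; have [nab _ _ _ _] := quart_ne Hq h.
have ac c : c \in A -> a <> c -> q a c y z.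
  move=> cA nac; have [<-//|/eqP nbc] := eqVneq b c.
  have h' : q y z a b by quart_sym Hq.
  have cy : c <> y by move=> E'; rewrite E' (negbTE yA) in cA.
  have [h1|h1] := quart_subP Hq h' cy (not_eq_sym nac); first by quart_sym Hq.
  have h2 : q a b y c by quart_sym Hq.
  by rewrite (sim_quart cA h2) in E.
apply/cherryP=> c d cA dA ncd.
have [E1|/eqP nac] := eqVneq a c; first by rewrite -E1; apply: ac; congruence.
have [E1|/eqP nad] := eqVneq a d; first by rewrite (quartC Hq) -E1; apply: ac; congruence.
rewrite (quartS Hq); apply: (@quart_transP _ q Hq _ _ _ _ a) => //.
  by have h1 := ac c cA nac; quart_sym Hq.
by have h1 := ac d dA nad; quart_sym Hq.
Qed.

(** Unless y and z are attached at different points, the directions at y and at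
    z are the same. *)
Lemma sim_transfer A y z a b : y != z -> y \notin A -> z \notin A ->
  cherry A y z \/ ~~ inner A y z -> a \in A -> b \in A ->
  sim q A y a b -> sim q A z a b.
Proof.
move=> /eqP yz yA zA H aA bA /simP[->|[w wA h]]; first exact: sim_refl.
have h' : q a b w y by quart_sym Hq.
have za : z <> a by move=> E; rewrite E aA in zA.
have zw : z <> w by move=> E; rewrite E wA in zA.
have [_ _ aw _ _] := quart_ne Hq h.
have [h1|h1] := quart_subP Hq h' za zw.
  by apply: (sim_quart wA); quart_sym Hq.
case: H => [/cherryP H|/innerP[]].
  have h2 := H a w aA wA aw.
  by case: (quart_excl1 Hq h1); quart_sym Hq.
by exists a, w; split=> //; quart_sym Hq.
Qed.

Lemma sim_transfer_eq A y z a b : y != z -> y \notin A -> z \notin A ->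
  cherry A y z \/ ~~ inner A y z -> a \in A -> b \in A ->
  sim q A y a b = sim q A z a b.
Proof.
move=> yz yA zA H aA bA; apply/idP/idP; first exact: sim_transfer.
by apply: sim_transfer => //; rewrite 1?eq_sym // cherry_sym inner_sym.
Qed.

(** Here z is attached in the direction of a0 from y, and y in the direction of
    w0 from z. *)
Section Inner.
Variables (A : {set T}) (y z a0 w0 : T).
Hypotheses (yz : y != z) (yA : y \notin A) (zA : z \notin A).
Hypotheses (a0A : a0 \in A) (w0A : w0 \in A) (h0 : q z a0 y w0).

Let innerA : inner A y z. Proof. by apply/innerP; exists a0, w0. Qed.
Let NcherryA : ~~ cherry A y z.
Proof. by apply/negP=> /cherry_inner; rewrite innerA. Qed.

Lemma inner_block b : b \in A ->
  sim q (z |: A) y z b = (b \in block A y a0).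
Proof.
have za0 : sim q (z |: A) y z a0.
  by apply: (sim_quart (w := w0)) h0; rewrite !inE w0A orbT.
by move=> bA; rewrite (sim_congr Hq b za0) mem_block bA /= not_cherry_sim.
Qed.

(** Beyond the point of z, away from y, there are only leaves of the block of
    a0. *)
Lemma inner_cover : A :\: block A y a0 \subset block A z w0.
Proof.
apply/subsetP=> c; rewrite inE => /andP[NcB cA]; rewrite mem_block cA /=.
have [->|/eqP w0c] := eqVneq w0 c; first exact: sim_refl.
have y' : y \notin z |: A by rewrite !inE negb_or yz.
have zz : sim q (z |: A) y z a0 by rewrite inner_block // mem_block a0A sim_refl.
have [nza0 _ _ _ _] := quart_ne Hq h0.
have h1 : q z a0 y c.
  by apply: (sim_split1 Hq y' _ zz) => //; rewrite ?inner_block // !inE cA orbT.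
apply: (sim_quart a0A); rewrite (quartS Hq).
by apply: (@quart_transP _ q Hq _ _ _ _ y) => //; quart_sym Hq.
Qed.

Lemma inner_blocks : blocks (z |: A) y =
  (z |: block A y a0) |: (blocks A y :\ block A y a0).
Proof.
have zb : block (z |: A) y z = z |: block A y a0.
  apply/setP=> b; rewrite mem_block !inE; have [->|bz] := eqVneq b z.
    by rewrite sim_refl.
  by case bA: (b \in A) => //=; rewrite inner_block // mem_block bA.
have ab a : a \in A -> ~~ sim q A y a0 a -> block (z |: A) y a = block A y a.
  move=> aA na; apply/setP=> b; rewrite !mem_block !inE.
  have [->|bz] := eqVneq b z.
    rewrite (negbTE zA) /= (sim_sym Hq) inner_block // mem_block aA /=.
    exact: negbTE.
  by case bA: (b \in A) => //=; rewrite not_cherry_sim.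
apply/setP=> B; rewrite !inE; apply/block_memP/idP.
  case=> a; rewrite !inE => /orP[/eqP->|aA] ->; first by rewrite zb eqxx.
  have [sa|sa] := boolP (sim q A y a0 a).
    suff -> : block (z |: A) y a = block (z |: A) y z by rewrite zb eqxx.
    apply/esym/blockP; rewrite ?inE ?eqxx ?aA ?orbT //.
    by rewrite inner_block // mem_block aA.
  rewrite ab // block_in // andbT; apply/orP; right; apply/eqP=> E.
  by move: sa; have /blockP-> := esym E.
case/orP=> [/eqP->|/andP[ne /block_memP[a aA E]]].
  by exists z; rewrite ?zb // !inE eqxx.
exists a; first by rewrite !inE aA orbT.
rewrite ab //; apply: contra ne => sa; rewrite E; apply/eqP/esym.
exact/blockP.
Qed.

Lemma inner_nblocks : nblocks (z |: A) y = nblocks A y.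
Proof.
rewrite /nblocks inner_blocks cardsU1 (cardsD1 (block A y a0) (blocks A y)).
rewrite block_in //; congr (_ + _); rewrite !inE.
case E: (_ \in blocks A y); last by rewrite andbF.
have /subsetP/(_ z) := block_sub E; rewrite !inE eqxx (negbTE zA).
by move=> /(_ isT).
Qed.

(** The block of a0 receives z, and is no longer a singleton if it was one. *)
Lemma inner_nsingle :
  nsingle (z |: A) y + (#|block A y a0| == 1) = nsingle A y.
Proof.
rewrite /nsingle inner_blocks.
have zB : z \notin block A y a0 by rewrite mem_block (negbTE zA).
have B0 : 0 < #|block A y a0|.
  by rewrite card_gt0; apply/set0Pn; exists a0; rewrite mem_block a0A sim_refl.
have -> : [set B in (z |: block A y a0) |: (blocks A y :\ block A y a0) | #|B| == 1] =
   [set B in blocks A y | #|B| == 1] :\ block A y a0.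
  apply/setP=> B; rewrite !inE; have [->|ne] := eqVneq B (z |: block A y a0).
    rewrite cardsU1 zB /= gtn_eqF ?ltnS //; case: (_ \in _); rewrite ?andbF //.
  by rewrite /= andbA.
rewrite [RHS](cardsD1 (block A y a0)) addnC; congr (_ + _).
by rewrite inE block_in.
Qed.

End Inner.

Section Outer.
Variables (A : {set T}) (y z : T).
Hypotheses (yz : y != z) (yA : y \notin A) (zA : z \notin A).
Hypothesis NinnerA : ~~ inner A y z.

Lemma outer_sim a : a \in A -> sim q (z |: A) y z a = false.
Proof.
move=> aA; rewrite sim_addz; last by apply: contraNneq zA => ->.
apply/negbTE; apply: contra NinnerA => /exists_inP[w wA h].
by apply/innerP; exists a, w.
Qed.

Lemma outer_blocks : ~~ cherry A y z \/ #|A| <= 1 ->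
  blocks (z |: A) y = [set z] |: blocks A y.
Proof.
move=> H.
have sE a b : a \in A -> b \in A -> sim q (z |: A) y a b = sim q A y a b.
  move=> aA bA; case: H => [N|A1]; first exact: not_cherry_sim.
  by rewrite (card_le1_eqP A1 a b aA bA) !sim_refl.
have zb : block (z |: A) y z = [set z].
  apply/setP=> b; rewrite mem_block !inE; have [->|bz] := eqVneq b z.
    by rewrite sim_refl.
  by case bA: (b \in A) => //=; rewrite outer_sim.
have ab a : a \in A -> block (z |: A) y a = block A y a.
  move=> aA; apply/setP=> b; rewrite !mem_block !inE.
  have [->|bz] := eqVneq b z.
    by rewrite (negbTE zA) /= (sim_sym Hq) outer_sim.
  by case bA: (b \in A) => //=; rewrite sE.
apply/setP=> B; rewrite !inE; apply/block_memP/idP.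
  case=> a; rewrite !inE => /orP[/eqP->|aA] ->; first by rewrite zb eqxx.
  by rewrite ab // block_in // orbT.
case/orP=> [/eqP->|/block_memP[a aA E]].
  by exists z; rewrite ?zb // !inE eqxx.
by exists a; rewrite ?ab // !inE aA orbT.
Qed.

Lemma single_notin : [set z] \notin blocks A y.
Proof.
apply/negP=> /block_sub/subsetP/(_ z).
by rewrite inE eqxx (negbTE zA) => /(_ isT).
Qed.

Lemma outer_nblocks : ~~ cherry A y z \/ #|A| <= 1 ->
  nblocks (z |: A) y = (nblocks A y).+1.
Proof. by move=> H; rewrite /nblocks outer_blocks // cardsU1 single_notin. Qed.

Lemma outer_nsingle : ~~ cherry A y z \/ #|A| <= 1 ->
  nsingle (z |: A) y = (nsingle A y).+1.
Proof.
move=> H; rewrite /nsingle outer_blocks //.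
have -> : [set B in [set z] |: blocks A y | #|B| == 1] =
   [set z] |: [set B in blocks A y | #|B| == 1].
  apply/setP=> B; rewrite !inE; have [->|//] := eqVneq B [set z].
  by rewrite cards1 eqxx.
by rewrite cardsU1 !inE (negbTE single_notin).
Qed.

Lemma cherry_blocks : cherry A y z -> 0 < #|A| ->
  blocks (z |: A) y = [set A; [set z]].
Proof.
move=> /cherryP ch; rewrite card_gt0 => /set0Pn[a0 a0A].
have zb : block (z |: A) y z = [set z].
  apply/setP=> b; rewrite mem_block !inE; have [->|bz] := eqVneq b z.
    by rewrite sim_refl.
  by case bA: (b \in A) => //=; rewrite outer_sim.
have ab a : a \in A -> block (z |: A) y a = A.
  move=> aA; apply/setP=> b; rewrite !mem_block !inE.
  have [->|bz] := eqVneq b z.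
    by rewrite (negbTE zA) /= (sim_sym Hq) outer_sim.
  case bA: (b \in A) => //=; rewrite sim_add.
  by have [->|/eqP nab] := eqVneq a b; rewrite ?sim_refl // ch ?orbT.
apply/setP=> B; rewrite !inE; apply/block_memP/idP.
  case=> a; rewrite !inE => /orP[/eqP->|aA] ->; first by rewrite zb eqxx orbT.
  by rewrite ab // eqxx.
case/orP=> /eqP->.
  by exists a0; rewrite ?ab // !inE a0A orbT.
by exists z; rewrite ?zb // !inE eqxx.
Qed.

Lemma cherry_nblocks : cherry A y z -> 1 < #|A| ->
  nblocks (z |: A) y = 2 /\ nsingle (z |: A) y = 1.
Proof.
move=> ch A2; rewrite /nblocks /nsingle cherry_blocks //; last exact: ltnW.
have ne : A != [set z] by apply: contraTneq A2 => ->; rewrite cards1.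
split; first by rewrite cards2 ne.
apply/eqP/cards1P; exists [set z]; apply/setP=> B; rewrite !inE.
have [->|/=] := eqVneq B A; first by rewrite (negbTE ne) /= gtn_eqF.
by have [->|//] := eqVneq B [set z]; rewrite cards1.
Qed.

End Outer.

Lemma blocks0 A y : #|A| = 0 -> nblocks A y = 0.
Proof. by move/cards0_eq->; rewrite /nblocks /blocks imset0 cards0. Qed.

Lemma blocks1 A y : #|A| = 1 -> nblocks A y = 1 /\ nsingle A y = 1.
Proof.
move/eqP/cards1P=> [a ->]; rewrite /nblocks /nsingle.
have -> : blocks [set a] y = [set [set a]].
  rewrite /blocks imset_set1; congr [set _]; apply/setP=> b.
  rewrite mem_block inE; have [->|//] := eqVneq b a; exact: sim_refl.
rewrite cards1; split=> //.
apply/eqP/cards1P; exists [set a]; apply/setP=> B; rewrite !inE.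
by have [->|//] := eqVneq B [set a]; rewrite cards1.
Qed.

Lemma blocks2 A y : y \notin A -> 1 < #|A| -> 1 < nblocks A y.
Proof.
move=> yA /card_gt1P[a [b [aA bA /eqP ab]]].
have [c cA nac] := sim_two Hq aA bA yA ab.
apply/card_gt1P; exists (block A y a), (block A y c); split; try exact: block_in.
by apply: contra nac => /eqP/blockP; apply.
Qed.

Lemma nblocks2P A y B : B \in blocks A y -> nblocks A y = 2 ->
  blocks A y = [set B; A :\: B] /\ B != A :\: B.
Proof.
move=> BA k2; have /block_memP[a aA EB] := BA.
have aB : a \in B by rewrite EB mem_block aA sim_refl.
have [C CA CB] : exists2 C, C \in blocks A y & C != B.
  have /card_gt1P[C [D [CA DA CD]]] : 1 < #|blocks A y| by rewrite -/(nblocks A y) k2.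
  by have [E|] := eqVneq C B; [exists D; rewrite -?E 1?eq_sym | exists C].
have E : blocks A y = [set B; C].
  apply/eqP; rewrite eq_sym eqEcard subUset !sub1set BA CA /=.
  by rewrite -/(nblocks A y) k2 cards2 eq_sym CB.
have EC : C = A :\: B.
  apply/setP=> c; rewrite !inE; apply/idP/andP.
    move=> cC; split; last exact: (subsetP (block_sub CA)).
    by apply: contra CB => cB; rewrite (block_eq CA cC) (block_eq BA cB).
  case=> cB cA; have := block_in y cA; rewrite E !inE => /orP[]/eqP E1.
    by rewrite -E1 mem_block cA sim_refl in cB.
  by rewrite -E1 mem_block cA sim_refl.
by rewrite -EC eq_sym.
Qed.

Lemma nsingle2 A y B : B \in blocks A y -> nblocks A y = 2 ->
  nsingle A y = (#|B| == 1) + (#|A :\: B| == 1).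
Proof.
move=> BA /(nblocks2P BA)[E ne]; rewrite /nsingle E.
case h1 : (#|B| == 1); case h2: (#|A :\: B| == 1).
- have -> : [set C in [set B; A :\: B] | #|C| == 1] = [set B; A :\: B].
    by apply/setP=> C; rewrite !inE; case: eqP => [->|_]; rewrite ?h1 //;
       case: eqP => [->|_]; rewrite ?h2.
  by rewrite cards2 ne.
- have -> : [set C in [set B; A :\: B] | #|C| == 1] = [set B].
    apply/setP=> C; rewrite !inE; case: eqP => [->|_]; rewrite ?h1 //=.
    by case: eqP => [->|_]; rewrite ?h2.
  by rewrite cards1.
- have -> : [set C in [set B; A :\: B] | #|C| == 1] = [set A :\: B].
    apply/setP=> C; rewrite !inE; case: eqP => [->|_] /=; rewrite ?h1.
      by rewrite (negbTE ne).
    by case: eqP => [->|_]; rewrite ?h2.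
  by rewrite cards1.
- apply/eqP; rewrite cards_eq0; apply/eqP/setP=> C; rewrite !inE.
  case: eqP => [->|_]; rewrite ?h1 //=.
  by case: eqP => [->|_]; rewrite ?h2.
Qed.

End TwoPoints.

(** The exceptional case, in which a weight changes: z is attached to the edge at
    the leaf w0, with y between z and that leaf.  Then y is attached to the same
    edge and the two partitions of A are equal, although y and z are
    not at the same point. *)
Lemma inner_single (T : finType) (q : T -> T -> T -> T -> bool) (A : {set T}) y z a0 w0 :
  quartets q -> y != z -> y \notin A -> z \notin A -> a0 \in A -> w0 \in A ->
  q z a0 y w0 -> nblocks q A z = 2 -> #|block q A z w0| = 1%N ->
  [/\ nblocks q A y = 2, nsingle q A z = (#|block q A y a0| == 1%N).+1
    & nsingle q A y = (#|block q A y a0| == 1%N).+1].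
Proof.
move=> Hq yz yA zA a0A w0A h0; set B := block q A y a0; set D := block q A z w0.
move=> kz D1; have h0' : q y w0 z a0 by quart_sym Hq.
have cov1 : A :\: B \subset D := inner_cover Hq yz yA zA a0A w0A h0.
have cov2 : A :\: D \subset B by apply: inner_cover => //; rewrite eq_sym.
have BA : B \in blocks q A y by apply: block_in.
have DA : D \in blocks q A z by apply: block_in.
have [_ _ _ _ [aw _]] := quart_ne Hq h0.
have A2 : (1 < #|A|)%N by apply/card_gt1P; exists a0, w0; split=> //; apply/eqP.
have k2 := blocks2 Hq yA A2.
have [d dP] : exists d, d \in A :\: B.
  apply/set0Pn; rewrite setD_eq0; apply: contraTN k2 => AB.
  rewrite -leqNgt -(cards1 B); apply/subset_leq_card/subsetP => C CA.
  have [c cA cC] := block_neq0 CA; rewrite inE; apply/eqP.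
  by rewrite (block_eq Hq CA cC) -(block_eq Hq BA (subsetP AB c cA)).
have ED : A :\: B = D.
  by apply/eqP; rewrite eqEcard cov1 D1 card_gt0; apply/set0Pn; exists d.
have EB : A :\: D = B.
  apply/eqP; rewrite eqEsubset cov2; apply/subsetP=> b bB; rewrite -ED !in_setD bB.
  exact: (subsetP (block_sub BA)).
have ky : nblocks q A y = 2.
  apply/eqP; rewrite eqn_leq k2 andbT -[2]/(1.+1)%N.
  apply: leq_trans (_ : #|[set B; D]| <= 2)%N; last by rewrite cards2; case: (_ != _).
  apply/subset_leq_card/subsetP => C CA; rewrite !inE.
  have [c cA cC] := block_neq0 CA; have [cB|cB] := boolP (c \in B).
    by rewrite (block_eq Hq CA cC) -(block_eq Hq BA cB) eqxx.
  apply/orP; right; rewrite eqEcard D1 card_gt0 andbC; apply/andP; split.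
    by apply/set0Pn; exists c.
  apply/subsetP=> x xC; rewrite -ED in_setD (subsetP (block_sub CA)) // andbT.
  by apply: contra cB => xB; rewrite (block_eq Hq BA xB) -(block_eq Hq CA xC).
split=> //.
  by rewrite (nsingle2 Hq DA kz) EB D1 eqxx.
by rewrite (nsingle2 Hq BA ky) ED D1 eqxx addn1.
Qed.

Import GRing.Theory.
Local Open Scope ring_scope.

(** * The weight of a one-point extension *)

Section Weight.
Variables (R : comPzRingType) (u v : R).

(** For k >= 3 the values are forced by additivity over two points at the same
    place, w(k) = 1 + u + w(k+1): y may be z, form a cherry with z, or see z
    as a further direction.  With at most one leaf the last two cases coincide,
    so that w(0) = 1 + w(1) and w(1) = 1 + w(2), the latter with two singleton
    blocks. *)
Definition wt (k s : nat) : R :=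
  if k == 2%N then u + v *+ s - v
  else if k == 1%N then 1 + u + v
  else v + 2%:R + u - (1 + u) *+ k.

Definition weight (T : finType) (q : T -> T -> T -> T -> bool) (A : {set T}) (y : T) : R :=
  wt (nblocks q A y) (nsingle q A y).

Lemma wt_eq k s s' : k <> 2%N \/ s = s' -> wt k s = wt k s'.
Proof. by rewrite /wt; case: (k =P 2%N) => // k2 [/(_ k2)|->]. Qed.

Hypothesis uv0 : u * v = 0.

(** If y and z are not separated, the situation is symmetric in them.  If they
    are, the weights over A and over A with the other point agree, except when
    y and z are attached to the edge at one leaf: then the products to
    compare may be u(u - v) and u^2, whence the condition uv = 0. *)
Lemma weight_comm (T : finType) (q : T -> T -> T -> T -> bool) (A : {set T}) y z :
  quartets q -> y != z -> y \notin A -> z \notin A ->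
  weight q A y * weight q (y |: A) z = weight q A z * weight q (z |: A) y.
Proof.
move=> Hq yz yA zA; have zy : z != y by rewrite eq_sym.
have [inn|out] := boolP (inner q A y z); last first.
  have out' : ~~ inner q A z y by rewrite inner_sym.
  have E : cherry q A y z \/ ~~ inner q A y z -> weight q A y = weight q A z.
    move=> H; rewrite /weight; suff E : blocks q A y = blocks q A z.
      by congr (wt _ _); rewrite /nblocks /nsingle E.
    apply: eq_in_imset => a aA; apply/setP=> b; rewrite !mem_block.
    by case bA: (b \in A) => //=; rewrite (sim_transfer_eq Hq yz).
  have {}E : weight q A y = weight q A z by apply: E; right.
  have [/andP[ch A2]|NH] := boolP (cherry q A y z && (1 < #|A|)%N).
    rewrite E /weight; congr (_ * wt _ _).
      have ch' : cherry q A z y by rewrite cherry_sym.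
      have [-> _] := cherry_nblocks Hq yA out' ch' A2.
      by have [-> _] := cherry_nblocks Hq zA out ch A2.
    have ch' : cherry q A z y by rewrite cherry_sym.
    have [_ ->] := cherry_nblocks Hq yA out' ch' A2.
    by have [_ ->] := cherry_nblocks Hq zA out ch A2.
  have H : ~~ cherry q A y z \/ (#|A| <= 1)%N.
    by move: NH; rewrite negb_and -leqNgt => /orP.
  have H' : ~~ cherry q A z y \/ (#|A| <= 1)%N by rewrite cherry_sym.
  have EE : blocks q A y = blocks q A z.
    apply: eq_in_imset => a aA; apply/setP=> b; rewrite !mem_block.
    by case bA: (b \in A) => //=; rewrite (sim_transfer_eq Hq yz) //; right.
  rewrite E /weight; rewrite !outer_nblocks ?outer_nsingle //.
  by rewrite /nblocks /nsingle EE.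
have /innerP[a0 [w0 [a0A w0A h0]]] := inn.
have h0' : q y w0 z a0 by quart_sym Hq.
rewrite /weight.
have k1 := inner_nblocks Hq yz yA zA a0A w0A h0.
have s1 := inner_nsingle Hq yz yA zA a0A w0A h0.
have k2 := inner_nblocks Hq zy zA yA w0A a0A h0'.
have s2 := inner_nsingle Hq zy zA yA w0A a0A h0'.
rewrite k1 k2.
(* This is where uv = 0 enters: u(u - v) = u^2. *)
have wtC : wt 2 1 * wt 2 0 = wt 2 1 * wt 2 1.
  by rewrite /wt /= mulr1n mulr0n addr0 addrK mulrBr uv0 subr0.
(* y between z and the leaf w0, then z between y and the leaf a0. *)
have [/andP[/eqP kz /eqP D1]|Nz] :=
    boolP ((nblocks q A z == 2%N) && (#|block q A z w0| == 1%N)).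
  have [ky sz sy] := inner_single Hq yz yA zA a0A w0A h0 kz D1.
  move: s1 s2; rewrite D1 sz sy eqxx ky kz.
  case: (_ == 1%N); first by rewrite !addn1 => -[->] [->].
  by rewrite addn0 addn1 => -> [->].
have [/andP[/eqP ky /eqP B1]|Ny] :=
    boolP ((nblocks q A y == 2%N) && (#|block q A y a0| == 1%N)).
  have [kz sy sz] := inner_single Hq zy zA yA w0A a0A h0' ky B1.
  move: s1 s2; rewrite B1 sz sy eqxx ky kz.
  case: (_ == 1%N); first by rewrite !addn1 => -[->] [->].
  by rewrite addn0 addn1 => -[->] ->.
rewrite mulrC; congr (_ * _); apply: wt_eq.
  move: Nz; rewrite negb_and => /orP[/eqP|/negbTE E]; [by left | right].
  by rewrite -s2 E addn0.
move: Ny; rewrite negb_and => /orP[/eqP|/negbTE E]; [by left | right].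
by rewrite -s1 E addn0.
Qed.

(** * The measure *)

Section Total.
Variables (T : finType) (q : T -> T -> T -> T -> bool).
Hypothesis Hq : quartets q.

(** The product of the weights when the points outside of A are added in the
    order in which they are picked; [total_step] shows that any other first
    choice gives the same product, by exchanging two neighbours. *)
Fixpoint total_rec (n : nat) (A : {set T}) : R :=
  if n is n'.+1 then
    if [pick y in ~: A] is Some y then weight q A y * total_rec n' (y |: A) else 1
  else 1.

Definition total (A : {set T}) : R := total_rec #|~: A| A.

Lemma card_setC_add (A : {set T}) y : y \notin A -> #|~: A| = #|~: (y |: A)|.+1.
Proof.
move=> yA; rewrite (cardsD1 y) inE yA add1n; congr (#|pred_of_set _|.+1).
by apply/setP=> x; rewrite !inE negb_or.
Qed.

Lemma total_step (A : {set T}) y : y \notin A ->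
  total A = weight q A y * total (y |: A).
Proof.
have [n] := ubnP #|~: A|; elim: n A y => // n IH A y le yA.
rewrite {1}/total; case E : #|~: A| => [|m] /=.
  by move/eqP: E; rewrite cards_eq0 => /eqP/setP/(_ y); rewrite !inE yA.
case: pickP => [z|/(_ y)]; last by rewrite inE yA.
rewrite inE => zA.
have Ez := card_setC_add zA; have Ey := card_setC_add yA.
have -> : total_rec m (z |: A) = total (z |: A).
  by rewrite /total; congr total_rec; move: Ez; rewrite E => -[].
have [->//|yz] := eqVneq y z.
have zy : z != y by rewrite eq_sym.
rewrite (IH (z |: A) y); last by rewrite !inE negb_or yz.
  rewrite (IH (y |: A) z); last by rewrite !inE negb_or zy.
    by rewrite !mulrA weight_comm // setUCA.
  by rewrite -Ey -ltnS.
by rewrite -Ez -ltnS.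
Qed.

Lemma totalT : total [set: T] = 1.
Proof. by rewrite /total setCT cards0. Qed.
End Total.

Section Transport.
Variables (T T' : finType) (q : T -> T -> T -> T -> bool).
Variables (q' : T' -> T' -> T' -> T' -> bool) (f : T' -> T).
Hypotheses (Hq : quartets q) (Hq' : quartets q') (fI : injective f).
Hypothesis fq : forall a b c d, q (f a) (f b) (f c) (f d) = q' a b c d.

Lemma sim_imset (A : {set T'}) y a b :
  sim q (f @: A) (f y) (f a) (f b) = sim q' A y a b.
Proof.
apply/simP/simP.
  case=> [/fI->|[_ /imsetP[w wA ->]]]; [by left | rewrite fq; right; by exists w].
case=> [->|[w wA h]]; [by left | right; exists (f w); rewrite ?imset_f ?fq //].
Qed.

Lemma block_imset (A : {set T'}) y a : block q (f @: A) (f y) (f a) = f @: block q' A y a.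
Proof.
apply/setP=> b; rewrite mem_block; apply/andP/imsetP.
  by case=> /imsetP[c cA ->]; rewrite sim_imset => h; exists c => //; rewrite mem_block cA.
by case=> c + ->; rewrite mem_block => /andP[cA h]; rewrite imset_f // sim_imset.
Qed.

Lemma blocks_imset (A : {set T'}) y :
  blocks q (f @: A) (f y) = [set f @: B | B : {set T'} in blocks q' A y].
Proof.
rewrite /blocks -!imset_comp; apply: eq_imset => a /=; exact: block_imset.
Qed.

Lemma nblocks_imset (A : {set T'}) y : nblocks q (f @: A) (f y) = nblocks q' A y.
Proof. by rewrite /nblocks blocks_imset card_imset //; apply: imset_inj. Qed.

Lemma nsingle_imset (A : {set T'}) y : nsingle q (f @: A) (f y) = nsingle q' A y.
Proof.
rewrite /nsingle blocks_imset -(card_imset _ (imset_inj fI)).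
congr #|pred_of_set _|; apply/setP=> C; rewrite !inE; apply/andP/imsetP.
  by case=> /imsetP[B BA ->]; rewrite card_imset // => h; exists B; rewrite ?inE ?BA.
case=> B + ->; rewrite inE => /andP[BA h].
by rewrite card_imset // h imset_f.
Qed.

Lemma weight_imset (A : {set T'}) y : weight q (f @: A) (f y) = weight q' A y.
Proof. by rewrite /weight nblocks_imset nsingle_imset. Qed.

Lemma total_imset (A : {set T'}) :
  total q (f @: A) = total q' A * total q (f @: [set: T']).
Proof.
have [n] := ubnP #|~: A|; elim: n A => // n IH A le.
have [A0|/set0Pn[y]] := boolP (~: A == set0).
  have -> : A = [set: T'] by rewrite -[A]setCK (eqP A0) setC0.
  by rewrite totalT mul1r.
rewrite inE => yA; rewrite (total_step Hq' yA).
rewrite (total_step Hq (y := f y)) ?(mem_imset _ _ fI) //.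
have -> : f y |: f @: A = f @: (y |: A) by rewrite imsetU1.
by rewrite weight_imset IH ?mulrA // -ltnS -(card_setC_add yA).
Qed.
End Transport.

Definition mu (X Y : treeStr) (i : embedding X Y) : R := total (@quart Y) (im i).

Lemma mu_iso (X Y : treeStr) (i : embedding X Y) : bijective i -> mu i = 1.
Proof.
move=> [g _ gK]; rewrite /mu; have -> : im i = [set: Y]; last exact: totalT.
by apply/setP=> y; rewrite inE; apply/imP; exists (g y); rewrite gK.
Qed.

Lemma im_comp (X Y Z : treeStr) (j : embedding Y Z) (i : embedding X Y) :
  im (emb_comp j i) = j @: im i.
Proof. by rewrite /im -imset_comp. Qed.

Lemma mu_comp (X Y Z : treeStr) (j : embedding Y Z) (i : embedding X Y) :
  mu (emb_comp j i) = mu j * mu i.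
Proof.
rewrite /mu im_comp mulrC.
exact: (total_imset (quart_quartets Z) (quart_quartets Y) (@emb_inj _ _ j) (emb_quart j)).
Qed.

Lemma mu_one_point (X Y : treeStr) (i : embedding X Y) y : one_point i y ->
  mu i = weight (@quart Y) (im i) y.
Proof.
case=> yi H; rewrite /mu (total_step (quart_quartets Y) yi).
have -> : y |: im i = [set: Y]; last by rewrite totalT mulr1.
by apply/setP=> t; rewrite !inE; case: (H t) => [->|->]; rewrite ?eqxx ?orbT.
Qed.

End Weight.

(** * Embeddings and amalgamations *)

Lemma emb_ext (X Y : treeStr) (i j : embedding X Y) : (forall x, i x = j x) -> i = j.
Proof.
case: i j => [f fI fR] [g gI gR] /= /funext E; move: gI gR; rewrite -E => gI gR.
by congr Embedding; apply: Prop_irrelevance.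
Qed.

Section SubStructure.
Variables (Y : treeStr) (A : {set Y}).

Definition sub_q (a b c d : {y : Y | y \in A}) : bool :=
  quart (val a) (val b) (val c) (val d).

Lemma sub_quartets : quartets sub_q.
Proof. exact: (quartets_inj val_inj (quart_quartets Y)). Qed.

Definition sub_ts : treeStr :=
  @mk_ts {y : Y | y \in A} (Finite.class ({y : Y | y \in A} : finType)) _ sub_quartets.

Lemma sub_quart (a b c d : sub_ts) : quart a b c d = sub_q a b c d.
Proof. exact: mk_quart. Qed.

Definition sub_inc : embedding sub_ts Y :=
  @mk_emb sub_ts Y (fun y => sval y) (fun a b => @val_inj _ _ _ a b)
    (fun a b c d => esym (sub_quart a b c d)).

Lemma sub_incP y : y \in A -> exists a, sub_inc a = y.
Proof. by move=> yA; exists (Sub y yA). Qed.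

Section Corestriction.
Variables (X : treeStr) (i : embedding X Y).
Hypothesis iA : forall x, i x \in A.

Definition cores_fun (x : X) : sub_ts := @exist _ _ (i x) (iA x).

Lemma cores_fun_inj : injective cores_fun.
Proof. by move=> a b /(congr1 val)/(@emb_inj _ _ i). Qed.

Lemma cores_fun_quart a b c d :
  quart (cores_fun a) (cores_fun b) (cores_fun c) (cores_fun d) = quart a b c d.
Proof. by rewrite sub_quart /sub_q /= emb_quart. Qed.

Definition cores : embedding X sub_ts := mk_emb cores_fun_inj cores_fun_quart.

Lemma sub_cores x : sub_inc (cores x) = i x. Proof. by []. Qed.
End Corestriction.
End SubStructure.

Definition id_emb (X : treeStr) : embedding X X :=
  @mk_emb X X id (fun _ _ => id) (fun _ _ _ _ => erefl).

Lemma emb_inverse (X Y : treeStr) (i : embedding X Y) : bijective i ->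
  exists2 j : embedding Y X, cancel i j & cancel j i.
Proof.
move=> [g iK gK].
have gI : injective g by apply: can_inj gK.
have gq a b c d : quart (g a) (g b) (g c) (g d) = quart a b c d.
  by rewrite -(emb_quart i) !gK.
by exists (mk_emb gI gq).
Qed.

Lemma factor_emb (X Y Z : treeStr) (i : embedding X Z) (j : embedding Y Z) :
  (forall x, exists y, j y = i x) -> exists h : embedding X Y, forall x, j (h x) = i x.
Proof.
move=> /choice[h hE].
have hI : injective h by move=> a b E; apply: (@emb_inj _ _ i); rewrite -!hE E.
have hq a b c d : quart (h a) (h b) (h c) (h d) = quart a b c d.
  by rewrite -(emb_quart j) !hE emb_quart.
by exists (mk_emb hI hq).
Qed.

(** Embeddings are injective. *)
Lemma emb_surj_bij (X Y : treeStr) (i : embedding X Y) : (forall y, exists x, i x = y) ->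
  bijective i.
Proof.
move=> /choice[g gK]; exists g => // x; apply: (@emb_inj _ _ i); exact: gK.
Qed.

Section AmIso.
Variables (X Y1 Y2 : treeStr) (i : embedding X Y1) (k : embedding X Y2).
Implicit Types A B C : amalgamation i k.

Lemma am_iso_sym A B : am_iso A B -> am_iso B A.
Proof.
case=> f [fb fl fr]; have [g fK gK] := emb_inverse fb.
by exists g; split=> [|y|y]; [exists f | rewrite -fl fK | rewrite -fr fK].
Qed.

Lemma am_iso_trans B A C : am_iso A B -> am_iso B C -> am_iso A C.
Proof.
case=> f [fb fl fr] [g [gb gl gr]]; exists (emb_comp g f); split=> /= [|y|y].
- exact: bij_comp.
- by rewrite fl gl.
- by rewrite fr gr.
Qed.

(** The map is onto because both images of the target are reached. *)
Lemma am_isoI A B (f : embedding (am_str A) (am_str B)) :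
  (forall y, f (am_inl A y) = am_inl B y) ->
  (forall y, f (am_inr A y) = am_inr B y) -> am_iso A B.
Proof.
move=> fl fr; exists f; split=> //; apply: emb_surj_bij => z.
by case: (am_cover z) => -[y <-]; [exists (am_inl A y) | exists (am_inr A y)].
Qed.

Definition enumerates (I : finType) (A : I -> amalgamation i k) : Prop :=
  (forall B, exists a, am_iso (A a) B) /\ (forall a b, am_iso (A a) (A b) -> a = b).

Lemma enumerates_sum (R : nmodType) (F : amalgamation i k -> R) (I J : finType)
    (A : I -> amalgamation i k) (B : J -> amalgamation i k) :
  (forall C D, am_iso C D -> F C = F D) -> enumerates A -> enumerates B ->
  \sum_a F (A a) = \sum_b F (B b).
Proof.
move=> Finv [Ac Ai] [Bc Bi].
have [h hE] := choice (fun a => Bc (A a)).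
have [g gE] := choice (fun b => Ac (B b)).
have hK : cancel h g.
  by move=> a; apply: Ai; apply: am_iso_trans (gE _) (hE _).
have gK : cancel g h.
  by move=> b; apply: Bi; apply: am_iso_trans (hE _) (gE _).
rewrite [RHS](reindex h) /=; last by exists g => x _; [apply: hK | apply: gK].
by apply: eq_bigr => a _; apply/Finv/am_iso_sym.
Qed.

End AmIso.

Section Flip.
Variables (X Y1 Y2 : treeStr) (i : embedding X Y1) (k : embedding X Y2).

Lemma flip_cover (A : amalgamation i k) z :
  (exists y, am_inr A y = z) \/ (exists y, am_inl A y = z).
Proof. by have [h|h] := am_cover z; [right | left]. Qed.

Definition flip (A : amalgamation i k) : amalgamation k i :=
  @Amalgamation X Y2 Y1 k i (am_str A) (am_inr A) (am_inl A)
    (fun x => esym (am_comm A x)) (flip_cover (A := A)).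

Lemma flip_iso (A B : amalgamation i k) : am_iso A B -> am_iso (flip A) (flip B).
Proof. by case=> f [fb fl fr]; exists f. Qed.
End Flip.

Lemma flipK (X Y1 Y2 : treeStr) (i : embedding X Y1) (k : embedding X Y2)
  (A : amalgamation i k) : am_iso (flip (flip A)) A.
Proof. by exists (id_emb (am_str A)); split=> //; exists id. Qed.

Lemma enumerates_flip (X Y1 Y2 : treeStr) (i : embedding X Y1) (k : embedding X Y2)
    (I : finType) (A : I -> amalgamation i k) :
  enumerates A -> enumerates (fun a => flip (A a)).
Proof.
move=> [Ac Ai]; split=> [B|a b].
  have [a h] := Ac (flip B); exists a.
  exact: am_iso_trans (flip_iso h) (flipK _).
move/flip_iso => h; apply: Ai.
exact: am_iso_trans (am_iso_sym (flipK _)) (am_iso_trans h (flipK _)).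
Qed.

(** Amalgamating a composite is the same as amalgamating the first factor and
    then the second one with the result. *)
Section Paste.
Variables (X Y1 Y X' : treeStr) (i : embedding X Y1) (j : embedding Y1 Y)
  (k : embedding X X').

Section PasteDef.
Variables (A : amalgamation i k) (B : amalgamation j (am_inl A)).

Lemma paste_comm x : am_inl B (emb_comp j i x) = emb_comp (am_inr B) (am_inr A) (k x).
Proof. by rewrite /= am_comm am_comm. Qed.

Lemma paste_cover z : (exists y, am_inl B y = z) \/
  (exists y, emb_comp (am_inr B) (am_inr A) y = z).
Proof.
have [h|[t <-]] := am_cover z; first by left.
have [[y <-]|[y <-]] := am_cover t; last by right; exists y.
by left; exists (j y); rewrite am_comm.
Qed.

Definition paste : amalgamation (emb_comp j i) k :=
  Amalgamation paste_comm paste_cover.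
End PasteDef.

(** The first amalgamation is the substructure of C covered by Y1 and X'.  The
    quantification over isomorphic copies lets it be replaced by a member of
    an enumeration. *)
Lemma paste_complete (C : amalgamation (emb_comp j i) k) :
  exists (A : amalgamation i k), forall A', am_iso A' A ->
    exists B : amalgamation j (am_inl A'), forall B', am_iso B' B ->
    am_iso (paste B') C.
Proof.
pose S := im (emb_comp (am_inl C) j) :|: im (am_inr C).
have lS y : emb_comp (am_inl C) j y \in S by rewrite inE im_mem.
have rS y : am_inr C y \in S by rewrite inE im_mem orbT.
have cA x : cores lS (i x) = cores rS (k x).
  by apply: (@emb_inj _ _ (sub_inc S)); rewrite !sub_cores -(am_comm C).
have cov z : (exists y, cores lS y = z) \/ (exists y, cores rS y = z).
  have := valP z; rewrite inE => /orP[]/imP[y E]; [left|right]; exists y;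
    by apply: (@emb_inj _ _ (sub_inc S)); rewrite sub_cores -E.
exists (Amalgamation cA cov) => A' [f [fb fl fr]].
pose g := emb_comp (sub_inc S) f.
have cB x : am_inl C (j x) = g (am_inl A' x) by rewrite /g /= fl.
have covB z : (exists y, am_inl C y = z) \/ (exists y, g y = z).
  have [h|[y <-]] := am_cover z; [by left | right].
  by exists (am_inr A' y); rewrite /g /= fr.
exists (Amalgamation cB covB) => B' [h [hb hl hr]].
exists h; split=> // y; rewrite /= hr /g /= fr //.
Qed.

Lemma paste_faithful (A A' : amalgamation i k) (B : amalgamation j (am_inl A))
    (B' : amalgamation j (am_inl A')) :
  am_iso (paste B) (paste B') -> am_iso A A'.
Proof.
case=> h [hb hl hr].
have hl' y : h (am_inr B (am_inl A y)) = am_inr B' (am_inl A' y).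
  by have := hl (j y); rewrite /= !am_comm.
have [f fE] : exists f : embedding (am_str A) (am_str A'),
    forall z, am_inr B' (f z) = emb_comp h (am_inr B) z.
  apply: factor_emb => z; have [[y <-]|[y <-]] := am_cover z.
    by exists (am_inl A' y); rewrite /= hl'.
  by exists (am_inr A' y); have := hr y.
apply: (@am_isoI _ _ _ _ _ _ _ f) => y; apply: (@emb_inj _ _ (am_inr B')); rewrite fE /=.
  exact: hl'.
exact: hr.
Qed.

Lemma paste_faithful2 (A : amalgamation i k) (B B' : amalgamation j (am_inl A)) :
  am_iso (paste B) (paste B') -> am_iso B B'.
Proof.
case=> h [hb hl hr]; exists h; split=> // z.
have [[y <-]|[y <-]] := am_cover z; last exact: hr.
by have := hl (j y); rewrite /= !am_comm.
Qed.

Lemma enumerates_paste (I : finType) (J : I -> finType) (A : I -> amalgamation i k)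
    (B : forall a, J a -> amalgamation j (am_inl (A a))) :
  enumerates A -> (forall a, enumerates (B a)) ->
  enumerates (fun p : {a : I & J a} => paste (B (tag p) (tagged p))).
Proof.
move=> [Ac Ai] eB; split=> [C|[a b] [a' b'] /= h].
  have [A0 H] := paste_complete C; have [a /H[B0 HB]] := Ac A0.
  have [b /HB h] := (eB a).1 B0.
  by exists (Tagged J b).
have E := Ai _ _ (paste_faithful h); move: b' h; rewrite -E => b' h.
by rewrite ((eB a).2 _ _ (paste_faithful2 h)).
Qed.

End Paste.

(** * Additivity reduces to one-point extensions *)

Section Additive.
Variables (R : comPzRingType) (psi : forall X Y, embedding X Y -> R).
Arguments psi {X Y}.
Hypothesis psi_iso : forall X Y (i : embedding X Y), bijective i -> psi i = 1.
Hypothesis psi_comp : forall X Y Z (j : embedding Y Z) (i : embedding X Y),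
  psi (emb_comp j i) = psi j * psi i.

Definition additive_at (X Y X' : treeStr) (i : embedding X Y) (k : embedding X X') :=
  exists (I : finType) (A : I -> amalgamation i k),
    enumerates A /\ psi i = \sum_a psi (am_inr (A a)).

Lemma psi_am_iso (X Y X' : treeStr) (i : embedding X Y) (k : embedding X X')
    (A B : amalgamation i k) : am_iso A B -> psi (am_inr A) = psi (am_inr B).
Proof.
case=> f [fb fl fr]; have -> : am_inr B = emb_comp f (am_inr A).
  by apply: emb_ext => x; rewrite /= fr.
by rewrite psi_comp (psi_iso fb) mul1r.
Qed.

Lemma additive_atP (X Y X' : treeStr) (i : embedding X Y) (k : embedding X X') :
  additive_at i k -> forall (I : finType) (A : I -> amalgamation i k), enumerates A ->
  psi i = \sum_a psi (am_inr (A a)).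
Proof.
case=> J [B [eB ->]] I A eA.
apply: (enumerates_sum (F := fun C => psi (am_inr C))) eB eA.
exact: psi_am_iso.
Qed.

(** Over an isomorphism there is only one amalgamation, the other structure
    itself. *)
Lemma additive_iso_l (X Y X' : treeStr) (i : embedding X Y) (k : embedding X X') :
  bijective i -> additive_at i k.
Proof.
move=> bi; have [g iK gK] := emb_inverse bi.
have c x : emb_comp k g (i x) = id_emb X' (k x) by rewrite /= iK.
have cov z : (exists y, emb_comp k g y = z) \/ (exists y, id_emb X' y = z).
  by right; exists z.
exists unit, (fun=> Amalgamation c cov); split; last first.
  by rewrite big_const card_unit /= addr0 psi_iso // psi_iso //=; exists id.
split=> [B|[] []//]; exists tt.
have [f fE] : exists f : embedding X' (am_str B), f =1 am_inr B by exists (am_inr B).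
apply: (@am_isoI _ _ _ _ _ (Amalgamation c cov) B f) => y; last exact: fE.
by rewrite /= fE -am_comm gK.
Qed.

Lemma additive_iso_r (X Y X' : treeStr) (i : embedding X Y) (k : embedding X X') :
  bijective k -> additive_at i k.
Proof.
move=> bk; have [g kK gK] := emb_inverse bk.
have c x : id_emb Y (i x) = emb_comp i g (k x) by rewrite /= kK.
have cov z : (exists y, id_emb Y y = z) \/ (exists y, emb_comp i g y = z).
  by left; exists z.
exists unit, (fun=> Amalgamation c cov); split; last first.
  rewrite big_const card_unit /= addr0 psi_comp (@psi_iso _ _ g) ?mulr1 //.
  by exists k.
split=> [B|[] []//]; exists tt.
apply: (@am_isoI _ _ _ _ _ (Amalgamation c cov) B (am_inl B)) => y //.
by rewrite /= am_comm gK.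
Qed.

(** The amalgamations with a composite X -> X1 -> X' are those with X1, followed
    by those with X'; so the sum is a sum of sums. *)
Lemma additive_comp_r (X Y X1 X' : treeStr) (i : embedding X Y) (k1 : embedding X X1)
    (k2 : embedding X1 X') :
  additive_at i k1 ->
  (forall A : amalgamation i k1, additive_at (am_inr A) k2) ->
  additive_at i (emb_comp k2 k1).
Proof.
case=> I [A [eA sA]] H.
pose J a := projT1 (cid (H (A a))).
pose B a : J a -> amalgamation (am_inr (A a)) k2 := projT1 (cid (projT2 (cid (H (A a))))).
have eB a : enumerates (B a).
  exact: (proj1 (projT2 (cid (projT2 (cid (H (A a))))))).
have sB a : psi (am_inr (A a)) = \sum_b psi (am_inr (B a b)).
  exact: (proj2 (projT2 (cid (projT2 (cid (H (A a))))))).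
exists {a : I & J a}.
exists (fun p => flip (@paste _ _ _ _ k1 k2 i (flip (A (tag p))) (flip (B (tag p) (tagged p))))).
split.
  apply: enumerates_flip => //.
  apply: (@enumerates_paste _ _ _ _ k1 k2 i I J (fun a => flip (A a))
           (fun a b => flip (B a b))).
    exact: (enumerates_flip eA).
  by move=> a; apply: (enumerates_flip (eB a)).
rewrite sA (eq_bigr _ (fun a _ => sB a)).
by rewrite (sig_big_dep _ _ (fun a b => psi (am_inr (B a b)))).
Qed.

(** Multiplicativity turns the sum over the pasted amalgamations into a sum over
    A of psi of the first step times a sum that does not depend on A. *)
Lemma additive_comp_l (X Y1 Y X' : treeStr) (i : embedding X Y1) (j : embedding Y1 Y)
    (k : embedding X X') :
  additive_at i k ->
  (forall A : amalgamation i k, additive_at j (am_inl A)) ->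
  additive_at (emb_comp j i) k.
Proof.
case=> I [A [eA sA]] H.
pose J a := projT1 (cid (H (A a))).
pose B a : J a -> amalgamation j (am_inl (A a)) := projT1 (cid (projT2 (cid (H (A a))))).
have eB a : enumerates (B a).
  exact: (proj1 (projT2 (cid (projT2 (cid (H (A a))))))).
have sB a : psi j = \sum_b psi (am_inr (B a b)).
  exact: (proj2 (projT2 (cid (projT2 (cid (H (A a))))))).
exists {a : I & J a}, (fun p => paste (B (tag p) (tagged p))).
split; first exact: enumerates_paste.
rewrite psi_comp sA big_distrr /=.
transitivity (\sum_a \sum_(b : J a) psi (am_inr (B a b)) * psi (am_inr (A a))).
  by apply: eq_bigr => a _; rewrite (sB a) big_distrl.
rewrite (sig_big_dep _ _ (fun a b => psi (am_inr (B a b)) * psi (am_inr (A a)))).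
by apply: eq_bigr => p _; rewrite psi_comp.
Qed.

Lemma factor_one_point (X Y : treeStr) (i : embedding X Y) : ~ bijective i ->
  exists (X1 : treeStr) (i1 : embedding X X1) (j : embedding X1 Y) y,
    [/\ one_point i1 y, i = emb_comp j i1 & (#|{: Y}| - #|{: X1}| < #|{: Y}| - #|{: X}|)%N].
Proof.
move=> nb; have [y yi] : exists y, y \notin im i.
  apply: contrapT => N; apply: nb; apply: emb_surj_bij => y.
  have [/imP[x ->]|h] := boolP (y \in im i); first by exists x.
  by case: N; exists y.
pose S := y |: im i.
have iS x : i x \in S by rewrite !inE im_mem orbT.
have yS : y \in S by rewrite !inE eqxx.
have [y1 y1E] := sub_incP yS.
exists (sub_ts S), (cores iS), (sub_inc S), y1; split.
- split.
    by apply/imP=> -[x E]; case/imP: yi; exists x; rewrite -y1E E.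
  move=> t; have := valP t; rewrite !inE => /orP[/eqP E|/imP[x E]]; [right|left].
    by apply: (@emb_inj _ _ (sub_inc S)); rewrite y1E -E.
  by apply/imP; exists x; apply: (@emb_inj _ _ (sub_inc S)); rewrite sub_cores -E.
- by apply: emb_ext.
have c1 : (#|{: X}| < #|S|)%N.
  by rewrite cardsU1 yi add1n /im card_imset ?cardsT //; apply: emb_inj.
have c2 : #|S| = #|{: sub_ts S}|.
  rewrite -(card_imset _ (@emb_inj _ _ (sub_inc S))); apply: eq_card => t.
  apply/idP/imsetP => [/sub_incP[a <-]|[a _ ->]]; [by exists a | exact: valP].
by rewrite -c2; apply: ltn_sub2l => //; apply: leq_trans c1 (max_card _).
Qed.

Hypothesis psi_base : forall (X Y X' : treeStr) (i : embedding X Y) (k : embedding X X') y z,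
  one_point i y -> one_point k z -> additive_at i k.

(** Induction along X': after the first point of X' is added, y either has
    become equal to it, and the extension is an isomorphism, or is still one
    point. *)
Lemma additive_one_point (X Y X' : treeStr) (i : embedding X Y) (k : embedding X X') y :
  one_point i y -> additive_at i k.
Proof.
have [n] := ubnP (#|{: X'}| - #|{: X}|); elim: n X Y i k y => // n IH X Y i k y le iy.
have [bk|/factor_one_point[X1 [k1 [k2 [z [kz Ek lt]]]]]] := pselect (bijective k).
  exact: additive_iso_r.
rewrite Ek; apply: additive_comp_r; first exact: psi_base iy kz.
move=> A; have [/imP[t E]|N] := boolP (am_inl A y \in im (am_inr A)).
  apply: additive_iso_l; apply: emb_surj_bij => w.
  have [[s <-]|//] := am_cover w; case: iy => _ /(_ s)[/imP[x ->]|->].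
    by exists (k1 x); rewrite am_comm.
  by exists t.
apply: (IH _ _ _ _ (am_inl A y)); first exact: leq_trans lt le.
split=> // w; have [[s <-]|[s <-]] := am_cover w; last by left; apply: im_mem.
case: iy => _ /(_ s)[/imP[x ->]|->]; [left | by right].
by apply/imP; exists (k1 x); rewrite am_comm.
Qed.

Lemma additive_all (X Y X' : treeStr) (i : embedding X Y) (k : embedding X X') :
  additive_at i k.
Proof.
have [n] := ubnP (#|{: Y}| - #|{: X}|); elim: n X Y X' i k => // n IH X Y X' i k le.
have [bi|/factor_one_point[X1 [i1 [j [y [iy Ei lt]]]]]] := pselect (bijective i).
  exact: additive_iso_l.
rewrite Ei; apply: additive_comp_l; first exact: additive_one_point iy.
by move=> A; apply: IH; apply: leq_trans lt le.
Qed.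

End Additive.

(** * Amalgamating two one-point extensions *)

Lemma branch_comp (X Y Z : treeStr) (j : embedding Y Z) (i : embedding X Y) y a b :
  branch (emb_comp j i) (j y) a b = branch i y a b.
Proof.
rewrite /branch im_comp.
exact: (sim_imset (@emb_inj _ _ j) (emb_quart j) (im i) y (i a) (i b)).
Qed.

Section Base.
Variables (X Y X' : treeStr) (i : embedding X Y) (k : embedding X X') (y : Y) (z : X').
Hypotheses (iy : one_point i y) (kz : one_point k z).

Let yi : y \notin im i. Proof. by case: iy. Qed.
Let zk : z \notin im k. Proof. by case: kz. Qed.
Let py := branch_place yi.
Let pz := branch_place zk.

Lemma one_pointE t : (exists x, t = k x) \/ t = z.
Proof. by case: kz => _ /(_ t)[/imP h|->]; [left|right]. Qed.

(** [None] when y and z are identified; otherwise, whether y and z form a cherry,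
    and the leaves of X that are in the direction of z from y, which form a block
    of the place of y or the empty set.  This is a complete invariant
    ([am_code_iso]), so that amalgamations are enumerated by the codes that
    occur. *)
Definition am_code (C : amalgamation i k) : option (bool * {set X}) :=
  if am_inl C y == am_inr C z then None else
  Some (cherry (@quart (am_str C)) (im (emb_comp (am_inr C) k)) (am_inl C y) (am_inr C z),
        [set a : X | [exists w : X,
           quart (am_inr C z) (am_inr C (k a)) (am_inl C y) (am_inr C (k w))]]).

Section Facts.
Variable C : amalgamation i k.
Hypothesis yz : am_inl C y != am_inr C z.
Let A := im (emb_comp (am_inr C) k).
Let q := @quart (am_str C).
Let Hq : quartets q := quart_quartets _.

Lemma am_embE : emb_comp (am_inl C) i = emb_comp (am_inr C) k.
Proof. by apply: emb_ext => x; exact: am_comm. Qed.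

Lemma am_y_notin : am_inl C y \notin A.
Proof.
rewrite /A -am_embE; apply/imP=> -[x /(@emb_inj _ _ (am_inl C)) E].
by case/imP: yi; exists x.
Qed.

Lemma am_z_notin : am_inr C z \notin A.
Proof.
apply/imP=> -[x /(@emb_inj _ _ (am_inr C)) E]; by case/imP: zk; exists x.
Qed.

Lemma am_im_inr : im (am_inr C) = am_inr C z |: A.
Proof.
apply/setP=> t; rewrite !inE; apply/imP/orP.
  case=> s ->; have [[x ->]|->] := one_pointE s; last by left.
  by right; apply: (im_mem (emb_comp (am_inr C) k)).
by case=> [/eqP->|/imP[x ->]]; [exists z | exists (k x)].
Qed.

Lemma am_sim_y a b : sim q A (am_inl C y) (am_inr C (k a)) (am_inr C (k b)) = branch i y a b.
Proof.
rewrite -(branch_comp (am_inl C)) /branch /A -am_embE.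
by rewrite -!(am_comm C).
Qed.

Lemma am_sim_z a b : sim q A (am_inr C z) (am_inr C (k a)) (am_inr C (k b)) = branch k z a b.
Proof. by rewrite -(branch_comp (am_inr C)) /branch. Qed.

Lemma am_mem x : am_inr C (k x) \in A.
Proof. exact: (im_mem (emb_comp (am_inr C) k)). Qed.

Lemma am_y_out : am_inl C y \notin im (am_inr C).
Proof. by rewrite am_im_inr !inE negb_or yz am_y_notin. Qed.

Lemma am_one_point : one_point (am_inr C) (am_inl C y).
Proof.
split=> [|t]; first exact: am_y_out.
have [[s <-]|[s <-]] := am_cover t; last by left; apply: im_mem.
case: iy => _ /(_ s)[/imP[x ->]|->]; [left | by right].
by apply/imP; exists (k x); rewrite am_comm.
Qed.

Definition am_inner : {set X} := [set a : X | [exists w : X,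
   quart (am_inr C z) (am_inr C (k a)) (am_inl C y) (am_inr C (k w))]].

Lemma mem_am_inner a : (a \in am_inner) = [exists w : X,
   quart (am_inr C z) (am_inr C (k a)) (am_inl C y) (am_inr C (k w))].
Proof. by rewrite [LHS]inE. Qed.

Lemma am_branch_z a : branch (am_inr C) (am_inl C y) z (k a) = (a \in am_inner).
Proof.
rewrite /branch am_im_inr (sim_addz Hq); last first.
  by apply: contraNneq am_z_notin => ->; apply: am_mem.
rewrite mem_am_inner; apply/exists_inP/existsP.
  by case=> _ /imP[w ->] h; exists w.
by case=> w h; exists (am_inr C (k w)); rewrite ?am_mem.
Qed.

Lemma am_branch_k a b : branch (am_inr C) (am_inl C y) (k a) (k b) =
  cherry q A (am_inl C y) (am_inr C z) || branch i y a b.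
Proof.
rewrite -am_sim_y /branch am_im_inr.
have [ch|ch] := boolP (cherry _ _ _ _) => /=.
  rewrite sim_add; have [->|/eqP ab] := eqVneq a b; first by rewrite sim_refl.
  suff -> : quart (am_inr C (k a)) (am_inr C (k b)) (am_inl C y) (am_inr C z) by rewrite orbT.
  apply: (cherryP _ _ _ _ ch); rewrite ?am_mem // => /(@emb_inj _ _ (am_inr C)).
  by move/(@emb_inj _ _ k).
by rewrite (not_cherry_sim Hq yz) ?am_mem ?am_y_notin ?am_z_notin.
Qed.

Lemma am_innerP a : a \in am_inner ->
  (forall b, (b \in am_inner) = branch i y a b) /\
  (forall c d, ~~ branch i y a c -> ~~ branch i y a d -> branch k z c d).
Proof.
rewrite mem_am_inner => /existsP[w h].
have bE b : (b \in am_inner) = branch i y a b.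
  rewrite -am_branch_z /branch am_im_inr.
  rewrite (inner_block Hq yz am_y_notin am_z_notin (am_mem a) (am_mem w) h) ?am_mem //.
  by rewrite mem_block am_mem am_sim_y.
split=> // c d Nc Nd; rewrite -am_sim_z.
have cov := subsetP (inner_cover Hq yz am_y_notin am_z_notin (am_mem a) (am_mem w) h).
have H x : ~~ branch i y a x -> sim q A (am_inr C z) (am_inr C (k w)) (am_inr C (k x)).
  move=> Nx; have := cov (am_inr C (k x)).
  rewrite inE !mem_block am_mem am_sim_y Nx /= => -> //.
by rewrite -(sim_congr Hq _ (H c Nc)) H.
Qed.

Lemma am_inner_cherry a : a \in am_inner -> ~~ cherry q A (am_inl C y) (am_inr C z).
Proof.
rewrite mem_am_inner => /existsP[w h]; apply/negP=> /(cherry_inner Hq)/innerP[].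
by exists (am_inr C (k a)), (am_inr C (k w)); rewrite !am_mem.
Qed.

Lemma am_outer : am_inner = set0 -> ~~ inner q A (am_inl C y) (am_inr C z).
Proof.
move=> E; apply/innerP=> -[_ [_ [/imP[a ->] /imP[w ->] h]]].
have : a \in am_inner by rewrite mem_am_inner; apply/existsP; exists w.
by rewrite E inE.
Qed.

Lemma am_outer_eq : am_inner = set0 -> forall a b, branch i y a b = branch k z a b.
Proof.
move=> E a b; rewrite -am_sim_y -am_sim_z.
apply: sim_transfer_eq => //; rewrite ?am_y_notin ?am_z_notin ?am_mem //.
by right; apply: am_outer.
Qed.

Lemma am_cherry_small : (#|{: X}| <= 1)%N -> cherry q A (am_inl C y) (am_inr C z).
Proof.
move=> X1; apply: cherry_small; rewrite /A /im card_imset ?cardsT //.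
exact: emb_inj.
Qed.

End Facts.

(** The place of y in X' is the place of y in X with z put into one block or
    apart, or the place with the blocks X and z for a cherry; the code says
    which. *)
Lemma am_code_iso (C C' : amalgamation i k) : am_code C = am_code C' -> am_iso C C'.
Proof.
rewrite /am_code; case: eqP => [E|/eqP N]; case: eqP => [E'|/eqP N'] //.
  move=> _.
  have bi : bijective (am_inr C).
    apply: emb_surj_bij => t; have [[s <-]|//] := am_cover t.
    case: iy => _ /(_ s)[/imP[x ->]|->]; last by exists z.
    by exists (k x); rewrite am_comm.
  have [g gK _] := emb_inverse bi.
  apply: (@am_isoI _ _ _ _ _ C C' (emb_comp (am_inr C') g)) => t /=; last by rewrite gK.
  case: iy => _ /(_ t)[/imP[x ->]|->]; first by rewrite !am_comm gK.
  by rewrite E gK E'.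
case=> Ech EB.
have Eb s t : branch (am_inr C) (am_inl C y) s t = branch (am_inr C') (am_inl C' y) s t.
  have key a : branch (am_inr C) (am_inl C y) z (k a) = branch (am_inr C') (am_inl C' y) z (k a).
    by rewrite !am_branch_z // /am_inner EB.
  have bC := branch_place (am_y_out N); have bC' := branch_place (am_y_out N').
  have [[a ->]|->] := one_pointE s; have [[b ->]|->] := one_pointE t.
  - by rewrite !am_branch_k // Ech.
  - by rewrite (place_sym bC) (place_sym bC').
  - exact: key.
  - by rewrite (place_refl bC) (place_refl bC').
pose f := one_point_map (am_one_point N) (am_y_out N') Eb.
have fE s : f (am_inr C s) = am_inr C' s.
  exact: one_point_funE.
apply: (@am_isoI _ _ _ _ _ C C' f) => t; last exact: fE.
case: iy => _ /(_ t)[/imP[x ->]|->]; first by rewrite !am_comm.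
exact: (one_point_funy _ _ (am_one_point N)).
Qed.

Lemma am_iso_code (C C' : amalgamation i k) : am_iso C C' -> am_code C = am_code C'.
Proof.
case=> f [_ fl fr].
have E1 : (am_inl C y == am_inr C z) = (am_inl C' y == am_inr C' z).
  by rewrite -fl -fr emb_eq.
rewrite /am_code E1; case: ifP => // _; congr (Some (_, _)).
  apply/cherryP/cherryP => H _ _ /imP[a ->] /imP[b ->] ab.
    rewrite /= -!fr -fl emb_quart; apply: H => //; try by apply: (im_mem (emb_comp (am_inr C) k)).
    by move=> E; apply: ab; rewrite /= -!fr E.
  rewrite -(emb_quart f) /= !fr fl; apply: H => //; try by apply: (im_mem (emb_comp (am_inr C') k)).
  by move=> /(@emb_inj _ _ (am_inr C')) E; apply: ab; rewrite /= E.
apply/setP=> a; rewrite !inE; apply: eq_existsb => w.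
by rewrite -!fr -fl emb_quart.
Qed.

Definition realized (c : option (bool * {set X})) : bool := `[< exists C, am_code C = c >].

Definition code_am (c : {c in realized}) : amalgamation i k :=
  projT1 (cid (asboolW (valP c))).

Lemma code_amK c : am_code (code_am c) = val c.
Proof. exact: (projT2 (cid (asboolW (valP c)))). Qed.

Lemma enumerates_code : enumerates code_am.
Proof.
split=> [B|a b /am_iso_code].
  have h : realized (am_code B) by apply/asboolP; exists B.
  by exists (Sub (am_code B) h); apply: am_code_iso; rewrite code_amK.
by rewrite !code_amK => /val_inj.
Qed.

(** Every code is obtained from a place of X' that induces the place of y on
    X. *)
Section Realize.
Variable e : rel X'.
Hypothesis He : place (@quart X') e.
Hypothesis Ee : forall a b, branch i y a b = branch (emb_comp (ext_emb He) k) (ext_pt He) a b.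

Lemma ext_pt_notin : ext_pt He \notin im (emb_comp (ext_emb He) k).
Proof. by apply/imP=> -[]. Qed.

Definition place_inl : embedding Y (ext_ts He) := one_point_map iy ext_pt_notin Ee.

Lemma place_comm x : place_inl (i x) = ext_emb He (k x).
Proof. exact: one_point_funE. Qed.

Lemma place_inly : place_inl y = ext_pt He.
Proof. exact: one_point_funy. Qed.

Lemma place_cover t : (exists s, place_inl s = t) \/ (exists s, ext_emb He s = t).
Proof.
case: (ext_one_point He) => _ /(_ t)[/imP[x ->]|->]; first by right; exists x.
by left; exists y; rewrite place_inly.
Qed.

Definition place_am : amalgamation i k := Amalgamation place_comm place_cover.

Lemma place_am_ne : am_inl place_am y != am_inr place_am z.
Proof. by rewrite -[am_inl _ y]/(place_inl y) place_inly; apply/eqP. Qed.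

Lemma place_am_branch s t : branch (am_inr place_am) (am_inl place_am y) s t = e s t.
Proof. by rewrite -[am_inl _ y]/(place_inl y) place_inly; apply: ext_branch. Qed.

Lemma place_am_code : am_code place_am =
  Some ((#|{: X}| <= 1)%N || [forall a, forall b, e (k a) (k b)], [set a | e z (k a)]).
Proof.
rewrite /am_code (negbTE place_am_ne); congr (Some (_, _)); last first.
  have := am_branch_z place_am; rewrite /am_inner => H.
  by apply/setP=> a; rewrite -H place_am_branch inE.
have H := am_branch_k place_am_ne.
have [X1|X2] := leqP #|{: X}| 1; first exact: am_cherry_small.
rewrite orFb; apply/idP/forallP => [ch a|all].
  by apply/forallP=> b; rewrite -place_am_branch H ch.
have /card_gt1P[a [b [_ _ /eqP ab]]] := X2.
have [c Nac] := place_two py ab.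
by have /forallP/(_ c) := all a; rewrite -place_am_branch H (negbTE Nac) orbF.
Qed.

End Realize.

Lemma realize (e : rel X') (He : place (@quart X') e) :
  (forall a b, branch i y a b = branch (emb_comp (ext_emb He) k) (ext_pt He) a b) ->
  realized (Some ((#|{: X}| <= 1)%N || [forall a, forall b, e (k a) (k b)],
                  [set a | e z (k a)])).
Proof. by move=> Ee; apply/asboolP; exists (place_am Ee); apply: place_am_code. Qed.

End Base.

(** * Which amalgamations occur *)

Section Places.
Variables (X Y X' : treeStr) (i : embedding X Y) (k : embedding X X') (y : Y) (z : X').
Hypotheses (iy : one_point i y) (kz : one_point k z).

Let yi : y \notin im i. Proof. by case: iy. Qed.
Let zk : z \notin im k. Proof. by case: kz. Qed.
Let py := branch_place yi.
Let pz := branch_place zk.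

Definition same_place : Prop := forall a b, branch i y a b = branch k z a b.

(** The block of a may contain z only if, from z, everything outside of that
    block is in one direction. *)
Definition covering (a : X) : Prop :=
  forall c d, ~~ branch i y a c -> ~~ branch i y a d -> branch k z c d.

Definition preim_k (t : X') : option X := [pick x | k x == t].

Lemma preim_kE x : preim_k (k x) = Some x.
Proof.
rewrite /preim_k; case: pickP => [x' /eqP/(@emb_inj _ _ k)->//|/(_ x)].
by rewrite eqxx.
Qed.

Lemma preim_kz : preim_k z = None.
Proof.
by rewrite /preim_k; case: pickP => // x /eqP E; case/imP: zk; exists x.
Qed.

Lemma realize_compat (e : rel X') (He : place (@quart X') e) :
  (forall a b, e (k a) (k b) = branch i y a b) ->
  forall a b, branch i y a b = branch (emb_comp (ext_emb He) k) (ext_pt He) a b.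
Proof.
move=> E a b; have [gz _] := ext_one_point He.
apply/idP/simP.
  move=> ab; have [->|/eqP nab] := eqVneq a b; [by left | right].
  have [c Nac] := place_two py nab.
  exists (ext_emb He (k c)); first exact: (im_mem (emb_comp (ext_emb He) k)).
  apply: (sim_split1 (quart_quartets _) gz).
  - exact: im_mem.
  - by have := ext_branch He (k a) (k b); rewrite E ab.
  - by move=> /(@emb_inj _ _ (ext_emb He))/(@emb_inj _ _ k).
  - by have := ext_branch He (k a) (k c); rewrite /branch E => ->.
case=> [|[_ /imP[w ->] h]].
  by move/(@emb_inj _ _ (emb_comp (ext_emb He) k))->; apply: (place_refl py).
rewrite -E -(ext_branch He); apply: sim_quart h; exact: im_mem.
Qed.

Lemma quart_branch_z a b w : quart (k a) (k b) z (k w) -> branch k z a b.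
Proof. by move=> h; apply: sim_quart h; apply: im_mem. Qed.

Lemma branch_split_z a b c : branch k z a b -> a <> b -> ~~ branch k z a c ->
  quart (k a) (k b) z (k c).
Proof.
move=> ab nab ac; apply: (sim_split1 (quart_quartets _) zk) => //; first exact: im_mem.
by move/(@emb_inj _ _ k).
Qed.

Ltac cases_k t := case: (one_pointE kz t) => [[? ->]|->].

(** The three places for y in X': on the edge at z; at the point where z is
    attached, when this is the place of y on X; and with z in the block of a0. *)
Definition cherry_place : rel X' := fun s t => isSome (preim_k s) == isSome (preim_k t).

Lemma cherry_placeP : place (@quart X') cherry_place.
Proof.
split; rewrite /cherry_place.
- by move=> s.
- by move=> s t; rewrite eq_sym.
- by move=> s t r /eqP-> /eqP->.
- move=> a b c d; cases_k a; cases_k b; cases_k c; cases_k d;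
  by rewrite ?preim_kE ?preim_kz.
- move=> a b c d h; have [ab _ _ _ [_ cd]] := quart_ne (quart_quartets X') h.
  move: h ab cd; cases_k a; cases_k b; cases_k c; cases_k d;
  rewrite ?preim_kE ?preim_kz //=; move=> h *;
  by have := quart_uniq (quart_quartets X') h; rewrite /= !inE !eqxx ?orbT ?andbF.
- move=> a b; have [[a' ->]|->] := one_pointE kz a; have [[b' ->]|->] := one_pointE kz b => // _.
  + by exists z; rewrite preim_kE preim_kz.
  + by exists z; rewrite preim_kE preim_kz.
  + by exists (k b'); rewrite preim_kz preim_kE.
Qed.

Definition star_place : rel X' := fun s t =>
  match preim_k s, preim_k t with
  | Some a, Some b => branch i y a b
  | None, None => true
  | _, _ => false
  end.

Lemma star_placeP : same_place -> place (@quart X') star_place.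
Proof.
move=> E; have Hq := quart_quartets X'.
split; rewrite /star_place.
- by move=> s; case: preim_k => // a; apply: (place_refl py).
- by move=> s t; case: (preim_k s) => [a|]; case: (preim_k t) => // b; apply: (place_sym py).
- move=> t s r; case: (preim_k s) => [a|]; case: (preim_k t) => [b|] //; case: (preim_k r) => // c.
  exact: (place_trans py).
- have key a b c d : branch i y a b -> k a <> k b -> ~~ branch i y a c -> d = z ->
      quart (k a) (k b) (k c) d.
    move=> ab nab ac ->; have : quart (k a) (k b) z (k c).
      by apply: branch_split_z; rewrite -?E // => E'; apply: nab; rewrite E'.
    by move=> h; quart_sym Hq.
  move=> a b c d; cases_k a; cases_k b; cases_k c; cases_k d;
  rewrite ?preim_kE ?preim_kz // => ab nab ac ad cd.
  + rewrite emb_quart; apply: (place_split py) => // E'; [apply: nab | apply: cd]; by rewrite E'.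
  + exact: key.
  + by have h := key _ _ _ z ab nab ad erefl; quart_sym Hq.
- have keyD b c d : quart z (k b) (k c) (k d) -> branch i y c d.
    by move=> h; rewrite E; apply: (quart_branch_z (w := b)); quart_sym Hq.
  have keyC b c d : quart (k b) z (k c) (k d) -> branch i y c d.
    by rewrite (quartC Hq); apply: keyD.
  have keyB b c d : quart (k c) (k d) z (k b) -> branch i y c d.
    by rewrite (quartS Hq); apply: keyD.
  have keyA b c d : quart (k c) (k d) (k b) z -> branch i y c d.
    by rewrite (quartS Hq); apply: keyC.
  move=> a b c d h; have [ab _ _ _ [_ cd]] := quart_ne Hq h.
  move: h ab cd; cases_k a; cases_k b; cases_k c; cases_k d;
  rewrite ?preim_kE ?preim_kz //= => h ab cd.
  + by apply: (place_star py); rewrite emb_quart in h.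
  + by rewrite orbF; apply: keyA h.
  + by rewrite orbF; apply: keyB h.
  + by apply: keyC h.
  + by have := quart_uniq Hq h; rewrite /= !inE !eqxx ?orbT ?andbF.
  + by have := quart_uniq Hq h; rewrite /= !inE !eqxx ?orbT ?andbF.
  + by apply: keyD h.
  + by have := quart_uniq Hq h; rewrite /= !inE !eqxx ?orbT ?andbF.
  + by have := quart_uniq Hq h; rewrite /= !inE !eqxx ?orbT ?andbF.
- move=> a b; have [[a' ->]|->] := one_pointE kz a; have [[b' ->]|->] := one_pointE kz b => // _.
  + by exists z; rewrite preim_kE preim_kz.
  + by exists z; rewrite preim_kE preim_kz.
  + by exists (k b'); rewrite preim_kz preim_kE.
Qed.

(** z is treated as a0. *)
Definition join_place (a0 : X) : rel X' := fun s t =>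
  branch i y (odflt a0 (preim_k s)) (odflt a0 (preim_k t)).

Section Join.
Variable a0 : X.
Hypotheses (cov : covering a0) (X2 : (1 < #|{: X}|)%N).
Let Hq := quart_quartets X'.
Let inB b := branch i y a0 b.

(** From z, the outside of the block of a0 lies in one direction, hence a leaf in
    another direction has to belong to the block. *)
Let outer c : ~~ inB c -> exists2 w, inB w & ~~ branch k z c w.
Proof.
move=> Nc; have ca : c <> a0 by move=> E; rewrite E /inB (place_refl py) in Nc.
have [w Ncw] := place_two pz ca; exists w => //.
by apply: contraNT Ncw => Nw; apply: cov.
Qed.

Let simB b w : inB b -> inB w -> branch i y b w.
Proof.
by move=> hb; rewrite /inB => hw; apply: (place_trans py) hw; rewrite (place_sym py).
Qed.

Let Ninl b c : inB b -> ~~ inB c -> ~~ branch i y b c.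
Proof. by move=> hb; apply: contra => bc; apply: (place_trans py) bc. Qed.

Lemma join_split1 b c d : inB b -> ~~ inB c -> ~~ inB d -> c <> d ->
  quart z (k b) (k c) (k d).
Proof.
move=> hb hc hd cd; have zcd := cov hc hd.
have [w hw Ncw] := outer hc.
have h1 := branch_split_z zcd cd Ncw.
have [bw|/eqP bw] := eqVneq b w; first by rewrite bw; quart_sym Hq.
have h2 : quart (k b) (k w) (k c) (k d).
  by rewrite emb_quart; apply: (place_split py) => //; [exact: simB | exact: Ninl | exact: Ninl].
rewrite (quartS Hq); apply: (@quart_transP _ _ Hq _ _ _ _ (k w)) => //.
- by quart_sym Hq.
- by move=> E; case/imP: zk; exists b.
Qed.

Lemma join_split2 a b d : ~~ inB a -> branch i y a b -> a <> b -> ~~ branch i y a d ->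
  quart (k a) (k b) z (k d).
Proof.
move=> ha ab nab ad; have hb : ~~ inB b.
  by apply: contra ha => hb; apply: (place_trans py) hb _; rewrite (place_sym py).
have zab := cov ha hb.
have [zad|zad] := boolP (branch k z a d); last exact: branch_split_z.
have [w hw Naw] := outer ha.
have h1 := branch_split_z zab nab Naw.
have wd : w <> d by move=> E; rewrite -E (negbTE Naw) in zad.
have aw : ~~ branch i y a w by rewrite (place_sym py); apply: Ninl.
have h2 : quart (k a) (k b) (k w) (k d) by rewrite emb_quart; apply: (place_split py).
apply: (@quart_transP _ _ Hq _ _ _ _ (k w)) => //; first by quart_sym Hq.
by move=> E; case/imP: zk; exists d.
Qed.

Lemma join_star b c d : quart z (k b) (k c) (k d) -> inB b || branch i y c d.
Proof.
move=> h; have [//|hb /=] := boolP (inB b); apply: contraT => ncd.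
have zcd : branch k z c d by apply: (quart_branch_z (w := b)); quart_sym Hq.
have [ncd' zc] : c <> d /\ True.
  by have [_ _ _ _ [_ cd]] := quart_ne Hq h; split=> // E; apply: cd; rewrite E.
have [x hx xcd] : exists2 x, ~~ inB x & branch k z x c.
  have [hc|hc] := boolP (inB c); last by exists c => //; apply: (place_refl pz).
  have hd : ~~ inB d by apply: contra ncd => hd; apply: simB.
  by exists d => //; rewrite (place_sym pz).
have zcb : branch k z c b.
  by rewrite -(place_congr pz _ xcd); apply: cov.
have [w hw Nbw] := outer hb.
have Ncw : ~~ branch k z c w by rewrite (place_congr pz _ zcb).
have h1 := branch_split_z zcd ncd' Ncw.
have wb : w <> b by move=> E; rewrite -E hw in hb.
have h2 : quart (k c) (k d) (k w) (k b).
  apply: (@quart_transP _ _ Hq _ _ _ _ z); try by quart_sym Hq.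
  by move/(@emb_inj _ _ k).
rewrite emb_quart in h2; have := place_star py h2; rewrite (negbTE ncd) /= => bw.
by move: hb; rewrite /inB (place_trans py hw bw).
Qed.

Lemma join_placeP : place (@quart X') (join_place a0).
Proof.
split; rewrite /join_place.
- by move=> s; apply: (place_refl py).
- by move=> s t; apply: (place_sym py).
- by move=> s t r; apply: (place_trans py).
- have sz a : branch i y a a0 = inB a by rewrite (place_sym py).
  have nk (a b : X) : k a <> k b -> a <> b by move=> N E; apply: N; rewrite E.
  have K1 a b c : branch i y a b -> k a <> k b -> ~~ branch i y a a0 -> ~~ branch i y a c ->
      quart (k a) (k b) z (k c).
    by rewrite sz => ab nab ha ac; apply: join_split2 => //; apply: nk.
  have K2 a b c : branch i y a b -> k a <> k b -> ~~ branch i y a c -> ~~ branch i y a a0 ->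
      quart (k a) (k b) (k c) z.
    by move=> ab nab ac ha; have h := K1 a b c ab nab ha ac; quart_sym Hq.
  have K3 b c d : inB b -> ~~ inB c -> ~~ inB d -> k c <> k d ->
      quart z (k b) (k c) (k d).
    by move=> hb hc hd cd; apply: join_split1 => //; apply: nk.
  have K4 a c d : branch i y a a0 -> ~~ branch i y a c -> ~~ branch i y a d -> k c <> k d ->
      quart (k a) z (k c) (k d).
    rewrite sz => ha ac ad cd; rewrite (quartC Hq); apply: K3 => //.
      by apply: contra ac; apply: simB.
    by apply: contra ad; apply: simB.
  move=> a b c d; cases_k a; cases_k b; cases_k c; cases_k d;
  rewrite ?preim_kE ?preim_kz /= ?(place_refl py) // => ab nab ac ad cd.
  + rewrite emb_quart; apply: (place_split py) => // E'; [apply: nab | apply: cd]; by rewrite E'.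
  + exact: K2.
  + exact: K1.
  + exact: K4.
  + by rewrite ab in ad.
  + by rewrite ab in ac.
  + exact: K3.
- move=> a b c d h; have [ab _ _ _ [_ cd]] := quart_ne Hq h.
  move: h ab cd; cases_k a; cases_k b; cases_k c; cases_k d;
  rewrite ?preim_kE ?preim_kz //= ?(place_refl py) ?orbT // => h ab cd;
  try by have := quart_uniq Hq h; rewrite /= !inE !eqxx ?orbT ?andbF.
  + by apply: (place_star py); rewrite emb_quart in h.
  + by rewrite orbC (place_sym py _ a0); apply: join_star; rewrite -(quartC Hq) -(quartS Hq).
  + by rewrite orbC; apply: join_star; rewrite -(quartS Hq).
  + by rewrite (place_sym py _ a0); apply: join_star; rewrite -(quartC Hq).
  + by apply: join_star h.
- move=> s t _; have /card_gt1P[a [b [_ _ ab]]] := X2.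
  set x := odflt a0 (preim_k s).
  have [c] : exists c, ~~ branch i y x c.
    have [E|/eqP N] := eqVneq x a; last by have [c Hc] := place_two py N; exists c.
    by have [c Hc] := place_two py (elimN eqP ab); exists c; rewrite E.
  by exists (k c); rewrite preim_kE.
Qed.
End Join.

Lemma realized_none : realized i k y z None <-> same_place.
Proof.
split=> [/asboolP[C]|E].
  rewrite /am_code; case: eqP => // yz _ a b.
  by rewrite -(am_sim_y y C) -(am_sim_z z C) yz.
have comm x : one_point_map iy zk E (i x) = id_emb X' (k x).
  exact: one_point_funE.
have cov t : (exists s, one_point_map iy zk E s = t) \/ (exists s, id_emb X' s = t).
  by right; exists t.
apply/asboolP; exists (Amalgamation comm cov); rewrite /am_code.
have -> // : am_inl (Amalgamation comm cov) y == am_inr (Amalgamation comm cov) z.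
by apply/eqP; apply: one_point_funy.
Qed.

Lemma realized_cherry : same_place -> realized i k y z (Some (true, set0)).
Proof.
move=> E.
have H : forall a b, branch i y a b =
    branch (emb_comp (ext_emb cherry_placeP) k) (ext_pt cherry_placeP) a b.
  move=> a b; have [gz _] := ext_one_point cherry_placeP.
  set g := ext_emb _ in gz *; set p := ext_pt _ in gz *.
  have Hq := quart_quartets (ext_ts cherry_placeP).
  have pA : p \notin im (emb_comp g k) by apply/imP=> -[].
  have zA : g z \notin im (emb_comp g k).
    by apply/imP=> -[x /(@emb_inj _ _ g) E']; case/imP: zk; exists x.
  have pz' : p != g z by apply/eqP.
  have ch : cherry (@quart _) (im (emb_comp g k)) p (g z).
    apply/cherryP=> _ _ /imP[c ->] /imP[d ->] cd.
    apply: (sim_split1 Hq gz) => //; first exact: im_mem.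
      by have := ext_branch cherry_placeP (k c) (k d); rewrite /branch => ->;
        rewrite /cherry_place !preim_kE.
    by have := ext_branch cherry_placeP (k c) z; rewrite /branch => ->;
        rewrite /cherry_place preim_kE preim_kz.
  have := sim_transfer_eq Hq pz' pA zA (or_introl ch) (im_mem (emb_comp g k) a)
    (im_mem (emb_comp g k) b).
  by rewrite E -(branch_comp g) /branch /= => ->.
have := realize iy kz H.
rewrite (_ : [forall a, _] = true) ?orbT; last first.
  by apply/forallP=> a; apply/forallP=> b; rewrite /cherry_place !preim_kE.
rewrite (_ : [set a | _] = set0) //.
by apply/setP=> a; rewrite !inE /cherry_place preim_kE preim_kz.
Qed.

Lemma not_all_branch : (1 < #|{: X}|)%N -> [forall a, forall b, branch i y a b] = false.
Proof.
move=> /card_gt1P[a [b [_ _ /eqP ab]]]; apply/forallP=> /(_ a)/forallP H.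
by have [c] := place_two py ab; rewrite H.
Qed.

Lemma realized_star : same_place -> (1 < #|{: X}|)%N ->
  realized i k y z (Some (false, set0)).
Proof.
move=> E X2.
have H : forall a b, star_place (k a) (k b) = branch i y a b.
  by move=> a b; rewrite /star_place !preim_kE.
have := realize iy kz (realize_compat (star_placeP E) H).
rewrite leqNgt X2 /= (_ : [forall a, _] = false).
  rewrite (_ : [set a | _] = set0) //.
  by apply/setP=> a; rewrite !inE /star_place preim_kE preim_kz.
by rewrite -(not_all_branch X2); apply: eq_forallb => a; apply: eq_forallb.
Qed.

Lemma realized_join a0 : covering a0 -> (1 < #|{: X}|)%N ->
  realized i k y z (Some (false, [set b | branch i y a0 b])).
Proof.
move=> cov X2.
have H : forall a b, join_place a0 (k a) (k b) = branch i y a b.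
  by move=> a b; rewrite /join_place !preim_kE.
have := realize iy kz (realize_compat (join_placeP cov X2) H).
rewrite leqNgt X2 /= (_ : [forall a, _] = false).
  rewrite (_ : [set a | _] = [set b | branch i y a0 b]) //.
  by apply/setP=> a; rewrite !inE /join_place preim_kE preim_kz.
by rewrite -(not_all_branch X2); apply: eq_forallb => a; apply: eq_forallb.
Qed.

(** With no leaf of X in the direction of z, the two points have the same place
    by [sim_transfer_eq]; otherwise the block in that direction covers by
    [inner_cover]. *)
Lemma realized_some ch B : realized i k y z (Some (ch, B)) ->
  [/\ B = set0, same_place & ch = false -> (1 < #|{: X}|)%N] \/
  [/\ ch = false, (1 < #|{: X}|)%N &
      exists2 a, B = [set b | branch i y a b] & covering a].
Proof.
move=> /asboolP[C]; rewrite /am_code; case: eqP => // /eqP yz [Ech EB].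
have N1 : ch = false -> (1 < #|{: X}|)%N.
  move=> ch0; rewrite ltnNge; apply/negP=> X1.
  by have := am_cherry_small y z C X1; rewrite Ech ch0.
have [B0|/set0Pn[a aB]] := eqVneq B set0; [left | right].
  split=> // a b; apply: (am_outer_eq iy kz yz); by rewrite /am_inner EB.
have aB' : a \in am_inner y z C by rewrite /am_inner EB.
have c0 : ch = false.
  by rewrite -Ech; apply: negbTE; apply: am_inner_cherry aB'.
split=> //; first exact: N1.
have [H1 H2] := am_innerP iy kz yz aB'; exists a => //.
by apply/setP=> b; rewrite inE -H1 /am_inner EB.
Qed.

End Places.

(** * The measure is additive *)

Section BaseSum.
Variables (R : comPzRingType) (u v : R).
Variables (X Y X' : treeStr) (i : embedding X Y) (k : embedding X X') (y : Y) (z : X').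
Hypotheses (iy : one_point i y) (kz : one_point k z).

Let yi : y \notin im i. Proof. by case: iy. Qed.
Let zk : z \notin im k. Proof. by case: kz. Qed.
Let py := branch_place yi.
Let pz := branch_place zk.
Let K := nblocks (@quart Y) (im i) y.
Let S := nsingle (@quart Y) (im i) y.

Definition am_weight (C : amalgamation i k) : R :=
  if am_inl C y \in im (am_inr C) then 1
  else weight u v (@quart (am_str C)) (im (am_inr C)) (am_inl C y).

(** The number of blocks and of singleton blocks of the place of y in X'.  A
    cherry gives the blocks X and z, with only z a singleton; if X has at most
    one element this is the same as adding z as a block of its own. *)
Definition code_type (c : bool * {set X}) : nat * nat :=
  if c.1 && (1 < #|{: X}|)%N then (2, 1)%N
  else if c.2 == set0 then (K.+1, S.+1)
  else (K, S - (#|c.2| == 1))%N.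

Definition code_weight (c : option (bool * {set X})) : R :=
  if c is Some d then wt u v (code_type d).1 (code_type d).2 else 1.

Lemma card_im (Z : treeStr) (f : embedding X Z) : #|im f| = #|{: X}|.
Proof. by rewrite /im card_imset ?cardsT //; apply: emb_inj. Qed.

Lemma am_type (C : amalgamation i k) : am_inl C y != am_inr C z ->
  exists2 c, am_code y z C = Some c &
    (nblocks (@quart (am_str C)) (im (am_inr C)) (am_inl C y),
     nsingle (@quart (am_str C)) (im (am_inr C)) (am_inl C y)) = code_type c.
Proof.
move=> yz; rewrite /am_code (negbTE yz); eexists; first reflexivity.
set A := im (emb_comp (am_inr C) k).
set q := @quart (am_str C); have Hq : quartets q := quart_quartets _.
have Ea : im (am_inr C) = am_inr C z |: A := am_im_inr kz C.
have yA : am_inl C y \notin A := am_y_notin iy C.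
have zA : am_inr C z \notin A := am_z_notin kz C.
have cA : #|A| = #|{: X}| := card_im _.
have EA : A = am_inl C @: im i by rewrite -im_comp am_embE.
have KE : nblocks q A (am_inl C y) = K.
  by rewrite EA; apply: (nblocks_imset (@emb_inj _ _ (am_inl C)) (emb_quart _)).
have SE : nsingle q A (am_inl C y) = S.
  by rewrite EA; apply: (nsingle_imset (@emb_inj _ _ (am_inl C)) (emb_quart _)).
rewrite /code_type Ea -/q.
have [ch|ch] := boolP (cherry q A (am_inl C y) (am_inr C z)).
  have B0 : am_inner y z C = set0.
    apply/setP=> a; rewrite [RHS]inE; apply: contraTF ch.
    exact: am_inner_cherry.
  rewrite -/(am_inner y z C) B0 eqxx /=.
  have out := cherry_inner Hq ch.
  have [X1|X2] := leqP #|{: X}| 1.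
    by rewrite outer_nblocks ?outer_nsingle ?KE ?SE //; right; rewrite cA.
  have A2 : (1 < #|A|)%N by rewrite cA.
  by have [-> ->] := cherry_nblocks Hq zA out ch A2.
rewrite -/(am_inner y z C) /=.
have [B0|/set0Pn[a aB]] := eqVneq (am_inner y z C) set0.
  have out := am_outer B0.
  by rewrite outer_nblocks ?outer_nsingle ?KE ?SE //; left.
have := aB; rewrite mem_am_inner => /existsP[w h].
have aA : am_inr C (k a) \in A by apply: am_mem.
have wA : am_inr C (k w) \in A by apply: am_mem.
have := inner_nsingle Hq yz yA zA aA wA h.
rewrite (inner_nblocks Hq yz yA zA aA wA h) KE SE.
have -> : block q A (am_inl C y) (am_inr C (k a)) =
    emb_comp (am_inr C) k @: am_inner y z C.
  have [H _] := am_innerP iy kz yz aB.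
  apply/setP=> t; rewrite mem_block; apply/andP/imsetP.
    case=> /imP[b ->] /=; rewrite am_sim_y => ab; exists b => //.
    by rewrite H.
  by case=> b; rewrite H => ab ->; rewrite im_mem /= am_sim_y.
rewrite card_imset; last exact: emb_inj.
by move=> <-; rewrite addnK.
Qed.

Lemma am_weight_code (C : amalgamation i k) : am_weight C = code_weight (am_code y z C).
Proof.
rewrite /am_weight; have [E|yz] := eqVneq (am_inl C y) (am_inr C z).
  by rewrite /am_code E im_mem eqxx.
rewrite (negbTE (am_y_out iy kz yz)); have [c -> H] := am_type yz.
by rewrite /code_weight -H.
Qed.

Definition xblock (a : X) : {set X} := [set b | branch i y a b].

Lemma im_xblock a : i @: xblock a = block (@quart Y) (im i) y (i a).
Proof.
apply/setP=> t; rewrite mem_block; apply/imsetP/andP.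
  by case=> b; rewrite inE => ab ->; rewrite im_mem.
by case=> /imP[b ->] ab; exists b; rewrite // inE.
Qed.

Lemma card_xblock a : #|block (@quart Y) (im i) y (i a)| = #|xblock a|.
Proof. by rewrite -im_xblock card_imset //; apply: emb_inj. Qed.

Lemma xblock_eq a b : (xblock a == xblock b) = branch i y a b.
Proof.
apply/eqP/idP => [/setP/(_ b)|ab]; first by rewrite !inE (place_refl py).
by apply/setP=> c; rewrite !inE (place_congr py _ ab).
Qed.

Lemma two_blocksP a : K = 2%N ->
  (forall b c, ~~ branch i y a b -> ~~ branch i y a c -> branch i y b c) /\
  (exists2 d, ~~ branch i y a d & S = (#|xblock a| == 1%N) + (#|xblock d| == 1%N))%N.
Proof.
move=> K2; have Hq := quart_quartets Y.
have aB := block_in (@quart Y) y (im_mem i a).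
have [E ne] := nblocks2P Hq aB K2.
have H b : ~~ branch i y a b ->
    block (@quart Y) (im i) y (i b) = im i :\: block (@quart Y) (im i) y (i a).
  move=> ab; have := block_in (@quart Y) y (im_mem i b).
  rewrite E !inE => /orP[]/eqP // /esym.
  by move/(blockP Hq y (im_mem i a) (im_mem i b)); rewrite -/(branch i y a b) (negbTE ab).
split=> [b c ab ac|].
  by rewrite /branch; apply/(blockP Hq y (im_mem i b) (im_mem i c)); rewrite (H b ab) (H c ac).
have [d Nad] : exists d, ~~ branch i y a d.
  apply: contrapT => N; move: ne; apply/negP; rewrite negbK.
  have {}N d : branch i y a d by apply: contraT => h; case: N; exists d.
  have : im i :\: block (@quart Y) (im i) y (i a) \in blocks (@quart Y) (im i) y.
    by rewrite E !inE eqxx orbT.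
  case/block_memP=> _ /imP[d ->] ->; apply/eqP.
  by apply/(blockP Hq y (im_mem i a) (im_mem i d)); apply: N.
exists d => //; rewrite /S (nsingle2 Hq aB K2) -(H d Nad).
by rewrite !card_xblock.
Qed.

Lemma nblocks_gt1 : (1 < #|{: X}|)%N -> (1 < K)%N.
Proof. by move=> X2; apply: (blocks2 (quart_quartets Y) yi); rewrite card_im. Qed.

Lemma sum_realized (L : seq (option (bool * {set X}))) : uniq L ->
  (forall c, realized i k y z c = (c \in L)) ->
  \sum_(c : {c in realized i k y z}) code_weight (val c) = \sum_(c <- L) code_weight c.
Proof.
move=> uL EL; rewrite [RHS]big_uniq //.
transitivity (\sum_(c in realized i k y z) code_weight c).
  exact: (esym (big_sub (realized i k y z) code_weight)).
by apply: eq_bigl => c; rewrite -EL.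
Qed.

Lemma other_all_place (a b : X) : a <> b ->
  ~ (forall c d, branch k z c d).
Proof. by move=> ab H; have [c] := place_two pz ab; rewrite H. Qed.

(** Points at different places are separated by a unique path, hence z lies in
    the direction of exactly one block.  When this block is the singleton of a
    leaf and the place of y is on an edge, z would be on the same edge, at the same place. *)
Lemma different_covering : ~ same_place i k y z -> exists a,
  [/\ covering i k y z a, (1 < #|{: X}|)%N,
      forall b, covering i k y z b -> branch i y a b & K <> 2%N \/ #|xblock a| <> 1%N].
Proof.
move=> N.
have [a [b Nab]] : exists a b, branch i y a b != branch k z a b.
  apply: contrapT => H; apply: N => a b; apply/eqP; apply: contraT => h.
  by case: H; exists a, b.
have ab : a <> b.
  by move=> E; move: Nab; rewrite E (place_refl py) (place_refl pz).
have X2 : (1 < #|{: X}|)%N by apply/card_gt1P; exists a, b; split=> //; apply/eqP.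
have [a0 cov] : exists a0, covering i k y z a0.
  have [yab|yab] := boolP (branch i y a b).
    have zab : ~~ branch k z a b by move: Nab; rewrite yab; case: (branch k z a b).
    exists a => c d Nc Nd; have [->|/eqP cd] := eqVneq c d; first exact: (place_refl pz).
    have h := place_split py yab ab Nc Nd cd.
    by have := place_star pz h; rewrite (negbTE zab).
  have zab : branch k z a b by move: Nab; rewrite (negbTE yab); case: (branch k z a b).
  have [c0 Nc0] := place_two pz ab.
  have H c d : ~~ branch k z a c -> ~~ branch k z a d -> branch i y c d.
    move=> Nc Nd; have [->|/eqP cd] := eqVneq c d; first exact: (place_refl py).
    have h := place_split pz zab ab Nc Nd cd.
    by have := place_star py h; rewrite (negbTE yab).
  exists c0; have H' c : ~~ branch i y c0 c -> branch k z a c.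
    by apply: contraNT; apply: H.
  move=> c d /H' ac /H' ad; apply: (place_trans pz) ad.
  by rewrite (place_sym pz).
exists a0; split=> // [b0 cov0|].
  apply: contraT => Nab0; case: N.
  (* If the blocks of a0 and of b0 both cover, then they are all the blocks, and
     z has the same ones. *)
  have two : (forall p r, branch k z p r) -> False.
    move=> H; exact: (@other_all_place a b ab H).
  have third c : ~~ branch i y a0 c -> branch i y b0 c.
    move=> h; apply: contraT => h'; exfalso; apply: two.
    suff H p : branch k z p c.
      by move=> p r; apply: (place_trans pz) (H p) _; rewrite (place_sym pz).
    have [hp|hp] := boolP (branch i y a0 p); last exact: cov.
    apply: cov0 => //; apply: contra Nab0 => hb.
    by apply: (place_trans py) hp _; rewrite (place_sym py).
  have in1 c d : branch i y a0 c -> branch i y a0 d -> branch k z c d.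
    move=> hc hd; apply: cov0; apply: contra Nab0 => hb.
      by apply: (place_trans py) hc _; rewrite (place_sym py).
    by apply: (place_trans py) hd _; rewrite (place_sym py).
  have cross c d : branch i y a0 c -> ~~ branch i y a0 d -> ~~ branch k z c d.
    move=> hc hd; apply/negP => zcd; apply: two.
    suff H p : branch k z p c.
      by move=> p r; apply: (place_trans pz) (H p) _; rewrite (place_sym pz).
    have [hp|hp] := boolP (branch i y a0 p); first exact: in1.
    by apply: (place_trans pz) (cov p d hp hd) _; rewrite (place_sym pz).
  move=> c d; have [hc|hc] := boolP (branch i y a0 c).
    rewrite -(place_congr py _ hc); have [hd|hd] := boolP (branch i y a0 d).
      by rewrite in1.
    by apply/esym/negbTE/cross.
  have [hd|hd] := boolP (branch i y a0 d).
    rewrite (place_sym py) -(place_congr py _ hd) (negbTE hc) (place_sym pz).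
    by apply/esym/negbTE/cross.
  rewrite cov // (place_congr py d (b := b0)) ?third //.
  by rewrite (place_sym py) third.
have [K2|] := eqVneq K 2%N; last by move/eqP; left.
(* Two blocks, one of them the singleton of a0: z separates a0 from the other
   block, which is in one direction from z. *)
right=> B1; case: N; have [H2 _] := two_blocksP a0 K2.
have a0B c : branch i y a0 c -> c = a0.
  move=> hc; have /cards1P[x Ex] : #|xblock a0| == 1%N by rewrite B1.
  have : c \in xblock a0 by rewrite inE.
  have : a0 \in xblock a0 by rewrite inE (place_refl py).
  by rewrite Ex !inE => /eqP-> /eqP->.
have cross d : ~~ branch i y a0 d -> ~~ branch k z a0 d.
  move=> hd; apply/negP=> zad; apply: (@other_all_place a b ab).
  suff H p : branch k z p a0.
    by move=> p r; apply: (place_trans pz) (H p) _; rewrite (place_sym pz).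
  have [/a0B->|hp] := boolP (branch i y a0 p); first exact: (place_refl pz).
  by apply: (place_trans pz) (cov p d hp hd) _; rewrite (place_sym pz).
move=> c d; have [hc|hc] := boolP (branch i y a0 c).
  rewrite (a0B c hc); have [hd|hd] := boolP (branch i y a0 d).
    by rewrite (a0B d hd) (place_refl pz).
  by apply/esym/negbTE/cross.
have [hd|hd] := boolP (branch i y a0 d).
  rewrite (a0B d hd) (place_sym py) (negbTE hc) (place_sym pz).
  by apply/esym/negbTE/cross.
by rewrite cov // H2.
Qed.

(** For equal places, covering says that all leaves outside of the block of a are
    in one block: the common point lies on an edge, which z may subdivide on
    either side of y. *)
Lemma covering_same a : same_place i k y z -> (1 < #|{: X}|)%N -> covering i k y z a ->
  K = 2%N.
Proof.
move=> E X2 cov; have Hq := quart_quartets Y.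
have K1 := nblocks_gt1 X2; apply/eqP; rewrite eqn_leq K1 andbT.
have [d Nad] : exists d, ~~ branch i y a d.
  have /card_gt1P[p [r [_ _ /eqP pr]]] := X2.
  have [c Npc] := place_two py pr.
  have [ap|ap] := boolP (branch i y a p); last by exists p.
  by exists c; rewrite (place_congr py _ ap).
pose b x := block (@quart Y) (im i) y (i x).
apply: leq_trans (_ : #|[set b a; b d]| <= 2)%N; last by rewrite cards2; case: (_ != _).
apply/subset_leq_card/subsetP => _ /block_memP[_ /imP[c ->] ->]; rewrite !inE.
have [ac|ac] := boolP (branch i y a c); apply/orP; [left | right]; apply/eqP/esym.
  exact/(blockP Hq y (im_mem i a) (im_mem i c)).
by apply/(blockP Hq y (im_mem i d) (im_mem i c)); rewrite -/(branch i y d c) E cov.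
Qed.

Lemma xblock_neq0 a : xblock a != set0.
Proof. by apply/set0Pn; exists a; rewrite inE (place_refl py). Qed.

(** Different places: one amalgamation, of the same weight.  Equal places: z = y,
    the cherry and the star, contributing 1, u and w(k+1); on an edge, in
    addition, z between y and either end, contributing two weights with k = 2.
    The cherry and the star coincide when X has at most one leaf. *)
Lemma realized_list : exists L : seq (option (bool * {set X})),
  [/\ uniq L, (forall c, realized i k y z c = (c \in L)) &
      \sum_(c <- L) code_weight c = wt u v K S].
Proof.
have Rj := realized_join iy kz; have Rs := realized_some iy kz.
have [E|N] := pselect (same_place i k y z); last first.
  have [a [cov X2 uni H]] := different_covering N.
  exists [:: Some (false, xblock a)]; split=> //; last first.
    rewrite big_seq1 /code_weight /code_type /= (negbTE (xblock_neq0 a)); apply: wt_eq.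
    by case: H => [|/eqP/negbTE->]; [left | right; rewrite subn0].
  move=> c; rewrite inE; apply/idP/eqP => [|->]; last exact: Rj.
  case: c => [[ch B]|/(realized_none iy kz)//] /Rs[[]//|[-> _ [b -> covb]]].
  by congr (Some (_, _)); apply/esym/eqP; rewrite xblock_eq; apply: uni.
have RN : realized i k y z None by apply/realized_none.
have RC := realized_cherry iy kz E.
have [X1|X2] := leqP #|{: X}| 1.
  exists [:: None; Some (true, set0)]; split=> //.
    move=> c; rewrite !inE; apply/idP/orP => [|[]/eqP-> //].
    case: c => [[ch B]|_]; last by left.
    move/Rs=> [[-> _]|[_]]; last by rewrite ltnNge X1.
    case: ch => [_|]; first by right.
    by move/(_ erefl); rewrite ltnNge X1.
  rewrite big_cons big_seq1 /code_weight /code_type /= ltnNge X1 eqxx /=.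
  move: X1; rewrite leq_eqVlt ltnS leqn0 => /orP[]/eqP X1.
    have [KE SE] : K = 1%N /\ S = 1%N.
      by apply: blocks1; rewrite card_im.
    by rewrite KE SE /wt /=; ring.
  have KE : K = 0%N by apply: blocks0; rewrite card_im.
  by rewrite KE /wt /=; ring.
have RS := realized_star iy kz E X2.
have [K2|/eqP K2] := eqVneq K 2%N; last first.
  exists [:: None; Some (true, set0); Some (false, set0)]; split=> //.
    move=> c; rewrite !inE; apply/idP/or3P => [|[]/eqP-> //].
    case: c => [[ch B]|_]; last by apply: Or31.
    case/Rs=> [[-> _]|[_ _ [a _ cov]]].
      by case: ch => _; [apply: Or32 | apply: Or33].
    by case: K2; apply: covering_same cov.
  rewrite !big_cons big_nil /code_weight /code_type /= X2 eqxx /=.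
  have K1 := nblocks_gt1 X2.
  move: K1 K2; rewrite /wt; case: K => [|[|[|K']]] //= _ _; ring.
have /card_gt1P[a [_ _]] := X2.
have [H [d Nad SE]] := two_blocksP a K2.
have cov p : covering i k y z p.
  by move=> b c hb hc; rewrite -E; apply: (two_blocksP p K2).1.
exists [:: None; Some (true, set0); Some (false, set0); Some (false, xblock a);
  Some (false, xblock d)]; split.
- have n0 x : (Some (false, set0) == Some (false, xblock x)) = false.
    by apply/eqP=> -[] E'; have := xblock_neq0 x; rewrite -E' eqxx.
  rewrite /= !inE !n0 /= andbT; apply/eqP=> -[/eqP]; rewrite xblock_eq.
  by rewrite (negbTE Nad).
- move=> c; rewrite !inE; apply/idP/idP.
    case: c => [[ch B]|_] //; case/Rs=> [[-> _]|[-> _ [p -> covp]]].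
      by case: ch => _; rewrite !eqxx ?orbT.
    have [ap|ap] := boolP (branch i y a p).
      by move: (ap); rewrite -xblock_eq => /eqP->; rewrite eqxx ?orbT.
    have dp : branch i y d p by apply: H.
    by move: (dp); rewrite -xblock_eq => /eqP->; rewrite eqxx ?orbT.
  by do 4![case/orP => [/eqP->|] //]; [apply: Rj | move/eqP->; apply: Rj].
rewrite !big_cons big_nil /code_weight /code_type /= X2 eqxx !(negbTE (xblock_neq0 _)) K2 SE /wt /=.
by case: (_ == 1%N); case: (_ == 1%N); rewrite /= ?addn0 ?add0n ?subn0 ?subnn ?addnK //=; ring.
Qed.

Lemma weight_additive :
  \sum_c am_weight (code_am (i := i) (k := k) (y := y) (z := z) c) = weight u v (@quart Y) (im i) y.
Proof.
have [L [uL EL sL]] := realized_list.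
rewrite /weight -/K -/S -sL -(sum_realized uL EL).
by apply: eq_bigr => c _; rewrite am_weight_code code_amK.
Qed.

End BaseSum.

Section MuAdditive.
Variables (R : comPzRingType) (u v : R).
Hypothesis uv0 : u * v = 0.

Lemma mu_base (X Y X' : treeStr) (i : embedding X Y) (k : embedding X X') y z :
  one_point i y -> one_point k z -> additive_at (@mu R u v) i k.
Proof.
move=> iy kz; exists {c in realized i k y z}, (@code_am _ _ _ i k y z).
split; first exact: enumerates_code.
rewrite (mu_one_point uv0 iy) -(weight_additive u v iy kz).
apply: eq_bigr => c _; rewrite /am_weight; set C := code_am c.
case: ifP => [/imP[t E]|/negbT N].
  rewrite mu_iso //; apply: emb_surj_bij => w.
  have [[s <-]|//] := am_cover w; case: iy => _ /(_ s)[/imP[x ->]|->].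
    by exists (k x); rewrite am_comm.
  by exists t.
apply: esym; apply: mu_one_point => //; apply: (am_one_point iy kz).
by apply: contraNneq N => ->; apply: im_mem.
Qed.

Lemma mu_additive (X Y X' : treeStr) (i : embedding X Y) (k : embedding X X') :
  additive_at (@mu R u v) i k.
Proof.
apply: (additive_all (psi := @mu R u v)) k.
- by move=> *; apply: mu_iso.
- by move=> *; apply: mu_comp.
- by move=> ? ? ? ? ? y z iy kz; apply: mu_base iy kz.
Qed.

End MuAdditive.

(** * Ring homomorphisms out of the presentations *)

Section QuotientLift.
Variables (R : comNzRingType) (P : R -> Prop) (S : comPzRingType) (F : {rmorphism R -> S}).
Hypothesis F0 : forall x, P x -> F x = 0.

Lemma lift_ideal x : x \in ideal P -> F x = 0.
Proof.
move=> /idealP[n [a [s [Ps ->]]]]; rewrite rmorph_sum big1 // => k _.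
by rewrite rmorphM (F0 (Ps k)) mulr0.
Qed.

Definition lift_fun (x : quo P) : S := F (repr x).

Lemma lift_funE x : lift_fun (quo_pi P x) = F x.
Proof.
apply/eqP; rewrite -subr_eq0 -rmorphB; apply/eqP/lift_ideal/quo_piP.
by rewrite quo_reprK.
Qed.

Lemma lift_zmod_morphism : zmod_morphism lift_fun.
Proof.
move=> x y; rewrite -[x]quo_reprK -[y]quo_reprK -raddfB !lift_funE.
exact: rmorphB.
Qed.

Lemma lift_monoid_morphism : monoid_morphism lift_fun.
Proof.
split; first by rewrite -[1]/(quo_pi P 1) lift_funE rmorph1.
move=> x y; rewrite -[x]quo_reprK -[y]quo_reprK -[_ * _]quo_piM !lift_funE.
exact: rmorphM.
Qed.

Lemma quo_lift : exists f : {rmorphism quo P -> S}, forall x, f (quo_pi P x) = F x.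
Proof.
pose m1 := GRing.isZmodMorphism.Build (quo P) S lift_fun lift_zmod_morphism.
pose m2 := GRing.isMonoidMorphism.Build (quo P) S lift_fun lift_monoid_morphism.
pose f : {rmorphism quo P -> S} := HB.pack lift_fun m1 m2.
by exists f; apply: lift_funE.
Qed.
End QuotientLift.

(** A [comPzRingType] in which 1 is nonzero, as a [comNzRingType]: the latter
    is the target of the evaluation morphisms of polynomials. *)
Section NonZero.
Variables (S : comPzRingType) (S1 : (1 : S) != 0).
Definition nonzero_ring : Type := (fun _ : (1 : S) != 0 => GRing.ComPzRing.sort S) S1.
HB.instance Definition _ := GRing.ComPzRing.on nonzero_ring.
HB.instance Definition _ := GRing.PzSemiRing_isNonZero.Build nonzero_ring S1.
End NonZero.

Section MalgHom.
Variables (I : choiceType) (S : comNzRingType) (phi : I -> S).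

Definition cmonom_eval (m : cmonom I) : S := \prod_(j <- finsupp m) phi j ^+ m j.

Lemma cmonom_evalEw (m : cmonom I) (d : {fset I}) : (finsupp m `<=` d)%fset ->
  cmonom_eval m = \prod_(j <- d) phi j ^+ m j.
Proof.
move=> le; rewrite /cmonom_eval (big_fset_incl _ le) //.
by move=> j _; rewrite -cmE_eq0 => /eqP->; rewrite expr0.
Qed.

Lemma cmonom_eval_mmorphism : mmorphism cmonom_eval.
Proof.
split=> [m1 m2|]; last by rewrite /cmonom_eval mdom1 big_seq_fset0.
rewrite (cmonom_evalEw (fsubsetUl (finsupp m1) (finsupp m2))).
rewrite (cmonom_evalEw (fsubsetUr (finsupp m1) (finsupp m2))) -big_split /=.
rewrite /cmonom_eval mdomD; apply: eq_bigr => j _.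
by rewrite cmM exprD.
Qed.

HB.instance Definition _ := monalg.isMultiplicative.Build (cmonom I) S cmonom_eval
  cmonom_eval_mmorphism.

(** The polynomial ring on any set of variables is free. *)
Lemma malg_lift : exists F : {rmorphism malg (cmonom I) int -> S},
  forall j, F (mkmalgU (ucm j) 1) = phi j.
Proof.
exists (monalg.mmap intr cmonom_eval : {rmorphism _ -> _}) => j.
by rewrite [LHS]monalg.mmapU /= mulr1z mul1r /cmonom_eval mdomU big_seq_fset1 cmUU.
Qed.

End MalgHom.

Lemma malg_hom_eq (I : choiceType) (S : comPzRingType)
    (F G : {rmorphism malg (cmonom I) int -> S}) :
  (forall j, F (mkmalgU (ucm j) 1) = G (mkmalgU (ucm j) 1)) -> F =1 G.
Proof.
move=> E x; rewrite (monalgE x) !rmorph_sum; apply: eq_bigr => m _.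
have Ec (c : int) : mkmalgU m c = mkmalgU m 1 *~ c :> malg (cmonom I) int.
  by rewrite -raddfMz /= intz.
rewrite Ec !rmorphMz {Ec}; congr (_ *~ _).
have [n] := ubnP (monalg.mdeg m); elim: n m => // n IH m le.
have [/eqP m1|/fset0Pn[j jm]] := boolP (finsupp m == fset0).
  have -> : m = monalg.one by apply/eqP/cmP=> j; rewrite cm1; apply/eqP; rewrite cmE_eq0 m1 in_fset0.
  by rewrite -[mkmalgU _ _]/(1 : malg (cmonom I) int) !rmorph1.
pose m' := divcm m (ucm j).
have mE : m = monalg.mul (ucm j) m'.
  apply/eqP/cmP => k; rewrite cmM divcmE cmU subnKC //.
  by have [<-|//] := eqVneq j k; rewrite lt0n cmE_neq0.
have le' : (monalg.mdeg m' < n)%N.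
  by move: le; rewrite {1}mE monalg.mdegM monalg.mdegU add1n.
have mM : mkmalgU m 1 = mkmalgU (ucm j) 1 * mkmalgU m' 1 :> malg (cmonom I) int.
  by rewrite mE malgM_def fgmulUU mulr1.
have FG := IH m' le'; rewrite mM.
move: (mkmalgU m' 1) FG => x' FG.
by rewrite (rmorphM F) (rmorphM G) (E j) FG.
Qed.

Lemma mpoly_hom_eq (n : nat) (S : comPzRingType) (F G : {rmorphism {mpoly int[n]} -> S}) :
  (forall j, F 'X_j = G 'X_j) -> F =1 G.
Proof.
move=> E p; rewrite (mpolyE p) !rmorph_sum; apply: eq_bigr => m _.
rewrite -mul_mpolyC !rmorphM.
have -> c : c%:MP_[n] = c%:~R :> {mpoly int[n]} by rewrite -[c in LHS]intz rmorph_int.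
rewrite !rmorph_int; congr (_ * _); rewrite mpolyXE_id !rmorph_prod.
by apply: eq_bigr => j _; rewrite !rmorphXn E.
Qed.

(** * Measures are homomorphisms *)

Lemma Theta_lift (S : comPzRingType) (psi : forall X Y, embedding X Y -> S) :
  (1 : S) != 0 ->
  (forall X Y (i : embedding X Y), bijective i -> psi X Y i = 1) ->
  (forall X Y Z (j : embedding Y Z) (i : embedding X Y),
     psi X Z (emb_comp j i) = psi Y Z j * psi X Y i) ->
  (forall X Y X' (i : embedding X Y) (k : embedding X X'), additive_at psi i k) ->
  exists f : {rmorphism Theta -> S},
    forall X Y (i : embedding X Y), f (quo_pi Theta_relation (sym i)) = psi X Y i.
Proof.
move=> S1 iso comp add.
pose phi (s : {classic symbol}) : nonzero_ring S1 := psi (sym_dom s) (sym_cod s) (sym_emb s).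
have [F FE] := malg_lift phi.
have FE' X Y (i : embedding X Y) : F (sym i) = psi X Y i by rewrite FE.
have sub0 x x' : F x = F x' -> F (x - x') = 0.
  by move=> E; rewrite (rmorphB F) E subrr.
have F0 x : Theta_relation x -> F x = 0.
  case=> {x} [X Y i bi|X Y Z j i|X Y X' i k n A eA]; apply: sub0.
  - exact: etrans (FE' _ _ i) (etrans (iso _ _ i bi) (esym (rmorph1 F))).
  - apply: etrans (FE' _ _ (emb_comp j i)) (etrans (comp _ _ _ j i) _).
    apply: etrans (esym (rmorphM F (sym j) (sym i))).
    by congr (_ * _); apply: esym; apply: FE'.
  - apply: etrans (FE' _ _ i) _.
    apply: etrans (additive_atP iso comp (add _ _ _ i k) eA) _.
    apply: etrans (esym (rmorph_sum F _ _ _)).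
    by apply: eq_bigr => a _; apply: esym; apply: FE'.
have [f fE] := quo_lift (S := S) F0.
by exists f => X Y i; rewrite fE (FE' _ _ i).
Qed.

(** * The ring Z[u,v]/(uv) *)

Definition uvP : {mpoly int[2]} -> Prop := fun p => p = 'X_0 * 'X_1.
Definition uZ : Zuv := quo_pi uvP 'X_0.
Definition vZ : Zuv := quo_pi uvP 'X_1.

Lemma uvZ0 : uZ * vZ = 0.
Proof.
rewrite /uZ /vZ -rmorphM; transitivity (quo_pi uvP 0); last exact: rmorph0.
apply/quo_piP.
by rewrite subr0; apply: ideal_gen.
Qed.

(** Evaluation at u = v = 0 kills the ideal. *)
Lemma Zuv_neq0 : (1 : Zuv) != 0.
Proof.
apply/eqP=> E; have : quo_pi uvP 1 = quo_pi uvP 0 by rewrite rmorph0.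
move=> /quo_piP/idealP[n [a [s [Ps /(congr1 (meval (fun=> 0)))]]]].
rewrite subr0 rmorph1 rmorph_sum big1 => [/eqP|k _]; first by rewrite oner_eq0.
by rewrite rmorphM (Ps k) rmorphM /= mevalXU mul0r mulr0.
Qed.

(** * The star with three leaves *)

Lemma falseq_quartets (T : eqType) : quartets (fun _ _ _ _ : T => false).
Proof. by split. Qed.

(** The carrier of a tree structure lives in a universe that is too small for
    ordinals. *)
Definition three := option (option unit).

Definition tripod : treeStr :=
  @mk_ts three (Finite.class (three : finType)) _ (falseq_quartets three).

Lemma tripod_quart (a b c d : tripod) : quart a b c d = false.
Proof. exact: mk_quart. Qed.

(** The center of the star, and a point on the edge at the leaf [None]. *)
Definition eq_place : rel tripod := fun a b => (a == b :> three).

Lemma eq_placeP : place (@quart tripod) eq_place.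
Proof.
split; rewrite /eq_place.
- by move=> a; rewrite eqxx.
- by move=> a b; rewrite eq_sym.
- by move=> b a c /eqP->.
- by move=> a b c d /eqP.
- by move=> a b c d; rewrite tripod_quart.
- by move=> a b ab; exists b; apply/eqP.
Qed.

Definition end_place : rel tripod :=
  fun a b => (a == None :> three) == (b == None :> three).

Lemma end_placeP : place (@quart tripod) end_place.
Proof.
split; rewrite /end_place.
- by move=> a; rewrite eqxx.
- by move=> a b; rewrite eq_sym.
- by move=> b a c /eqP->.
- by move=> [a|] [b|] [c|] [d|].
- by move=> a b c d; rewrite tripod_quart.
- by move=> [a|] [b|] // _; [exists None | exists None | exists (Some b)].
Qed.

(** Their classes generate: u is the class of [leaf_ext], and v is determined by
    that of [center_ext], whose weight is v - 1 - 2u. *)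
Definition leaf_ext := ext_emb end_placeP.
Definition center_ext := ext_emb eq_placeP.

Lemma small_quart (X : treeStr) (a b c d : X) : (#|{: X}| < 4)%N -> quart a b c d = false.
Proof.
move=> X3; apply/negbTE/negP=> h.
have /card_uniqP E := quart_uniq (quart_quartets X) h.
have := max_card (mem [:: a; b; c; d]); rewrite E /= => h4.
by move: X3; rewrite ltnNge h4.
Qed.

Lemma tripod_map (X : treeStr) (p : X) : #|{: X}| = 3 ->
  exists2 h : embedding X tripod, bijective h & h p = None.
Proof.
move=> X3; have E : #|{: X}| = #|{: three}| by rewrite X3 !card_option card_unit.
pose g (x : X) : three := enum_val (cast_ord E (enum_rank x)).
pose h (x : X) : three := tperm (g p) None (g x).
have hI : injective h.
  by move=> a b /perm_inj/enum_val_inj/cast_ord_inj/enum_rank_inj.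
have hq a b c d : @quart tripod (h a) (h b) (h c) (h d) = quart a b c d.
  by rewrite tripod_quart small_quart // X3.
exists (@mk_emb X tripod h hI hq); last by rewrite /= /h tpermL.
by apply: (@inj_card_bij X three h) => //; rewrite E.
Qed.

(** * Places by their block sizes *)

Section Blocks.
Variables (X Y : treeStr) (i : embedding X Y) (y : Y).
Hypothesis yi : y \notin im i.
Let py := branch_place yi.
Let K := nblocks (@quart Y) (im i) y.
Let S := nsingle (@quart Y) (im i) y.

Lemma nblocks_full : K = #|{: X}| -> forall a b, branch i y a b = (a == b).
Proof.
rewrite -(card_im i) => KE a b; apply/idP/eqP => [|->]; last exact: (place_refl py).
have /imset_injP inj : #|blocks (@quart Y) (im i) y| == #|im i| by apply/eqP.
move=> ab; apply: (@emb_inj _ _ i); apply: inj; rewrite ?im_mem //.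
exact/(blockP (quart_quartets Y) y (im_mem i a) (im_mem i b)).
Qed.

Lemma nblocks_le : (K <= #|{: X}|)%N.
Proof. by rewrite -(card_im i); apply: leq_imset_card. Qed.

Lemma xblock_compl a d : K = 2%N -> ~~ branch i y a d -> xblock i y d = ~: xblock i y a.
Proof.
move=> K2 Nad; have [H _] := two_blocksP a K2; apply/setP=> x; rewrite !inE.
apply/idP/idP => [dx|ax]; last exact: H.
by rewrite (place_sym py) -(place_congr py _ dx) (place_sym py).
Qed.

Lemma xblock_card a : (0 < #|xblock i y a|)%N.
Proof. by rewrite card_gt0; apply/set0Pn; exists a; rewrite inE (place_refl py). Qed.

Lemma two_blocks_card : K = 2%N -> exists a d, [/\ ~~ branch i y a d,
  (#|xblock i y a| + #|xblock i y d| = #|{: X}|)%N &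
  S = ((#|xblock i y a| == 1%N) + (#|xblock i y d| == 1%N))%N].
Proof.
move=> K2; have [a _] : exists a : X, True.
  have /card_gt0P[B /block_memP[_ /imP[a _] _]] : (0 < #|blocks (@quart Y) (im i) y|)%N.
    by rewrite -/(nblocks _ _ _) -/K K2.
  by exists a.
have [_ [d Nad SE]] := two_blocksP a K2; exists a, d; split=> //.
by rewrite (xblock_compl K2 Nad) cardsC.
Qed.

Lemma single_place : K = 2%N -> S = 1%N ->
  exists p, forall a b, branch i y a b = ((a == p) == (b == p)).
Proof.
move=> K2 S1; have [a [d [Nad _ SE]]] := two_blocks_card K2.
have [p Xp] : exists p, #|xblock i y p| = 1%N.
  move: SE; rewrite S1; have [|_] := eqVneq #|xblock i y a| 1%N; first by exists a.
  by have [|//] := eqVneq #|xblock i y d| 1%N; exists d.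
exists p; have pE x : branch i y p x = (x == p).
  have /eqP/cards1P[t Et] := Xp.
  have pt : p \in xblock i y p by rewrite inE (place_refl py).
  rewrite -[LHS](in_set (fun b => branch i y p b)) -/(xblock i y p).
  by move: pt; rewrite Et !inE => /eqP->.
move=> b c; have [->|bp] := eqVneq b p; first by rewrite pE eq_sym.
have [->|cp] := eqVneq c p; first by rewrite (place_sym py) pE; apply: negbTE.
by rewrite eqxx; apply: (two_blocksP p K2).1; rewrite pE.
Qed.

End Blocks.

(** * Deleting a leaf *)

(** Deleting x from X exhibits the extension j by y as an amalgamation of two
    one-point extensions of X without x. *)
Section Remove.
Variables (X Z : treeStr) (j : embedding X Z) (y : Z) (x : X).
Hypothesis jy : one_point j y.

Definition rem_dom : treeStr := sub_ts [set~ x].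
Definition rem_k : embedding rem_dom X := sub_inc [set~ x].
Definition rem_cod : treeStr := sub_ts [set~ j x].

Lemma rem_cores a : emb_comp j rem_k a \in [set~ j x].
Proof.
rewrite !inE /= emb_eq; have := valP a; by rewrite !inE.
Qed.

Definition rem_i : embedding rem_dom rem_cod := cores rem_cores.

Lemma rem_y_in : y \in [set~ j x].
Proof.
rewrite !inE; case: jy => yj _; apply: contraNneq yj => ->; exact: im_mem.
Qed.

Definition rem_y : rem_cod := @exist _ _ y rem_y_in.

Lemma rem_kx : one_point rem_k x.
Proof.
split=> [|t].
  by apply/imP=> -[a E]; have := valP a; rewrite !inE -[val a]E eqxx.
have [->|tx] := eqVneq t x; [by right | left].
have tA : t \in [set~ x] by rewrite !inE.
by have [a <-] := sub_incP tA; apply: im_mem.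
Qed.

Lemma rem_iy : one_point rem_i rem_y.
Proof.
have inj := @emb_inj _ _ (sub_inc [set~ j x]).
case: jy => yj H; split=> [|t].
  apply/imP=> -[a /(congr1 (sub_inc [set~ j x]))]; rewrite sub_cores /= => E.
  by case/imP: yj; exists (rem_k a).
have := valP t; case: (H (val t)) => [/imP[s E]|E] tA; [left | right]; last first.
  by apply: inj.
have sx : s \in [set~ x].
  by move: tA; rewrite !inE E emb_eq.
have [a aE] := sub_incP sx.
have ka : emb_comp j rem_k a = j s by congr (j _); exact: aE.
by apply/imP; exists a; apply: inj; rewrite sub_cores ka -E.
Qed.

Lemma rem_comm a : sub_inc [set~ j x] (rem_i a) = j (rem_k a).
Proof. by []. Qed.

Lemma rem_cover z : (exists t, sub_inc [set~ j x] t = z) \/ (exists t, j t = z).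
Proof.
have [->|zx] := eqVneq z (j x); [by right; exists x | left].
by apply: sub_incP; rewrite !inE.
Qed.

Definition rem_am : amalgamation rem_i rem_k := Amalgamation rem_comm rem_cover.

Lemma rem_ne : am_inl rem_am rem_y != am_inr rem_am x.
Proof. by have := rem_y_in; rewrite !inE. Qed.

Lemma card_rem : #|{: X}| = #|{: rem_dom}|.+1.
Proof.
rewrite -cardsT (cardsD1 x) inE add1n; congr _.+1.
rewrite -(card_im rem_k); apply: eq_card => t.
rewrite !inE andbT; apply/idP/imP => [tx|[a ->]].
  have tA : t \in [set~ x] by rewrite !inE.
  by have [a <-] := sub_incP tA; exists a.
by have := valP a; rewrite !inE.
Qed.

End Remove.

Section Types.
Variables (X Y X' : treeStr) (i : embedding X Y) (k : embedding X X') (y : Y) (z : X').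
Hypotheses (iy : one_point i y) (kz : one_point k z).
Let K := nblocks (@quart Y) (im i) y.
Let S := nsingle (@quart Y) (im i) y.

Variable C : amalgamation i k.
Hypothesis yz : am_inl C y != am_inr C z.
Let K' := nblocks (@quart (am_str C)) (im (am_inr C)) (am_inl C y).
Let S' := nsingle (@quart (am_str C)) (im (am_inr C)) (am_inl C y).

(** The possible amalgamations with the number of blocks and of singleton blocks
    of y over X', in terms of those over X. *)
Variant am_spec : Prop :=
| AmCherry of am_code y z C = Some (true, set0) & same_place i k y z & K' = 2 & S' = 1%N
| AmStar of am_code y z C = Some (false, set0) & same_place i k y z & K' = K.+1 & S' = S.+1
| AmJoin a of am_code y z C = Some (false, xblock i y a) & covering i k y z a &
    K' = K & S' = (S - (#|xblock i y a| == 1))%N.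

Lemma am_specP : (1 < #|{: X}|)%N -> am_spec.
Proof.
move=> X2; have [[ch B] Ec E12] := am_type iy kz yz.
have E1 := congr1 fst E12; have {E12}E2 := congr1 snd E12.
have real : realized i k y z (Some (ch, B)) by apply/asboolP; exists C.
case: (realized_some iy kz real) => [[B0 sp _]|[c0 _ [a Ba cov]]].
  move: Ec E1 E2; rewrite B0 /code_type /= X2 andbT eqxx; case: ch {real} => Ec E1 E2.
    exact: AmCherry.
  exact: AmStar.
move: Ec E1 E2; rewrite c0 Ba /code_type /= -/(xblock i y a).
rewrite (negbTE (xblock_neq0 iy a)) => Ec E1 E2.
exact: AmJoin cov E1 E2.
Qed.

End Types.

Section RemoveBranch.
Variables (X Z : treeStr) (j : embedding X Z) (y : Z) (x : X).
Hypothesis jy : one_point j y.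
Let i := rem_i j x.
Let k := rem_k x.
Let y0 := rem_y x jy.
Let yj : y \notin im j. Proof. by case: jy. Qed.

Lemma rem_quart (a b c d : rem_cod j x) :
  quart a b c d = quart (val a) (val b) (val c) (val d).
Proof. exact: sub_quart. Qed.

Lemma rem_branchP a b : branch i y0 a b -> branch j y (k a) (k b).
Proof.
case/simP=> [/(@emb_inj _ _ i)->|[_ /imP[w ->]]]; first exact: sim_refl.
rewrite rem_quart => h; exact: (sim_quart (im_mem j (k w)) h).
Qed.

(** A leaf d in another direction serves as the witness for a and b, so that the
    deletion of the former witness does no harm. *)
Lemma rem_branch a b d : branch j y (k a) (k b) -> ~~ branch j y (k a) (k d) -> branch i y0 a b.
Proof.
move=> ab ad; have [->|/eqP nab] := eqVneq a b; first exact: sim_refl.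
have h : quart (j (k a)) (j (k b)) y (j (k d)).
  apply: (sim_split1 (quart_quartets Z) yj) => //; first exact: im_mem.
  by move=> /(@emb_inj _ _ j)/(@emb_inj _ _ k).
by apply: (sim_quart (im_mem i d)); rewrite rem_quart.
Qed.

End RemoveBranch.

Lemma rem_domP (X : treeStr) (x a : X) : a <> x -> exists b, rem_k x b = a.
Proof. by move=> ax; apply: sub_incP; rewrite !inE; apply/eqP. Qed.

(** If y and x1 are at the same place after the deletion of x1, then e and x2 are
    separated from x1 and d; if the same happens for x2, the quartets ex2|x1d and
    ex1|x2d contradict each other. *)
Lemma remove_one_of_two (X Z : treeStr) (j : embedding X Z) (y : Z) (jy : one_point j y)
    (e x1 x2 d : X) :
  e <> x1 -> e <> x2 -> x1 <> x2 -> branch j y e x1 -> branch j y e x2 ->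
  ~~ branch j y e d ->
  exists x, ~ same_place (rem_i j x) (rem_k x) (rem_y x jy) x.
Proof.
move=> e1 e2 x12 b1 b2 bd.
have bne t : branch j y e t -> d <> t by move=> bt E; rewrite E bt in bd.
have main s t : e <> s -> e <> t -> s <> t -> branch j y e s -> branch j y e t ->
    same_place (rem_i j s) (rem_k s) (rem_y s jy) s -> quart e t s d.
  move=> es et st bs bt sp.
  have [e' eE] := rem_domP es; have [t' tE] := rem_domP (not_eq_sym st).
  have [d' dE] := rem_domP (bne s bs).
  have h1 : branch (rem_i j s) (rem_y s jy) e' t'.
    by apply: (rem_branch jy (d := d')); rewrite ?eE ?tE ?dE.
  have h2 : ~~ branch (rem_i j s) (rem_y s jy) e' d'.
    by apply: contra bd => /rem_branchP; rewrite eE dE.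
  rewrite sp in h1; rewrite sp in h2.
  have := branch_split_z (rem_kx s) h1 _ h2; rewrite eE tE dE; apply.
  by move=> E; apply: et; rewrite -eE -tE E.
apply: contrapT => N.
have sp x : same_place (rem_i j x) (rem_k x) (rem_y x jy) x.
  by apply: contrapT => h; apply: N; exists x.
have h1 := main x1 x2 e1 e2 x12 b1 b2 (sp x1).
have h2 := main x2 x1 e2 e1 (not_eq_sym x12) b2 b1 (sp x2).
exact: (quart_excl1 (quart_quartets X) h1 h2).
Qed.

(** At a node with at least three directions, the leaf x of a block with another
    leaf e is attached inside the direction of e, and sees the two leaves d, d' of
    two other directions joined. *)
Lemma remove_from_block (X Z : treeStr) (j : embedding X Z) (y : Z) (jy : one_point j y)
    (e x d d' : X) :
  e <> x -> branch j y e x -> ~~ branch j y e d -> ~~ branch j y e d' -> ~~ branch j y d d' ->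
  ~ same_place (rem_i j x) (rem_k x) (rem_y x jy) x.
Proof.
move=> ex bx bd bd' dd' sp.
have [yj _] := jy; have pj := branch_place yj.
have bne t : ~~ branch j y e t -> t <> x by move=> bt E; rewrite E bx in bt.
have nd : d <> d' by move=> E; rewrite E (place_refl pj) in dd'.
have h := place_split pj bx ex bd bd' nd.
have [e' eE] := rem_domP ex; have [d1 dE] := rem_domP (bne d bd).
have [d2 dE'] := rem_domP (bne d' bd').
have : branch (rem_k x) x d1 d2.
  apply: (sim_quart (im_mem (rem_k x) e')); rewrite dE dE' eE.
  by have Hq := quart_quartets X; quart_sym Hq.
by rewrite -sp => /rem_branchP; rewrite dE dE'; apply/negP.
Qed.

Lemma nblocks3 (X Y : treeStr) (i : embedding X Y) (y : Y) : y \notin im i ->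
  (2 < nblocks (@quart Y) (im i) y)%N -> forall e, exists d d',
  [/\ ~~ branch i y e d, ~~ branch i y e d' & ~~ branch i y d d'].
Proof.
move=> yi K3 e; have Hq := quart_quartets Y; have py := branch_place yi.
pose b x := block (@quart Y) (im i) y (i x).
have bE x x' : (b x == b x') = branch i y x x'.
  by apply/eqP/idP => h; apply/(blockP Hq y (im_mem i x) (im_mem i x')).
have out (D : {set {set Y}}) : (#|D| < 3)%N -> exists x, b x \notin D.
  move=> D3; apply: contrapT => N.
  suff : (nblocks (@quart Y) (im i) y <= #|D|)%N by rewrite leqNgt (leq_trans D3).
  apply/subset_leq_card/subsetP => _ /block_memP[_ /imP[x ->] ->].
  by apply: contraT => h; case: N; exists x.
have [d] : exists d, b d \notin [set b e] by apply: out; rewrite cards1.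
rewrite inE bE => ed.
have [d'] : exists d', b d' \notin [set b e; b d].
  by apply: out; rewrite cards2; case: (_ != _).
rewrite !inE !bE negb_or => /andP[ed' dd'].
by exists d, d'; rewrite (place_sym py e) (place_sym py e d') (place_sym py d d').
Qed.

Lemma one_point_card (X Y : treeStr) (i : embedding X Y) y : one_point i y ->
  #|{: Y}| = #|{: X}|.+1.
Proof.
case=> yi H; rewrite -(card_im i) -cardsT.
have -> : [set: Y] = y |: im i.
  by apply/setP=> t; rewrite !inE; case: (H t) => [->|->]; rewrite ?eqxx ?orbT.
by rewrite cardsU1 yi.
Qed.

(** * Additive invariants are determined by two values *)

Lemma sum3_ones m n : (m + n = 3 -> 0 < m -> 0 < n -> (m == 1) + (n == 1) = 1)%N.
Proof. lia. Qed.

Lemma small_ones m n : (3 < m + n -> m <= 2 -> n <= 2 -> (m == 1) + (n == 1) = 0)%N.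
Proof. lia. Qed.

Lemma card_tripod : #|{: tripod}| = 3.
Proof.
have bij : bijective (fun t : tripod => (t : three)) by exists (fun t => t).
by rewrite (bij_eq_card bij) !card_option card_unit.
Qed.

Lemma leaf_ext_nblocks : nblocks (@quart (ext_ts end_placeP)) (im leaf_ext) (ext_pt end_placeP) = 2.
Proof.
have iy := ext_one_point end_placeP; have [yi _] := iy.
have X3 := card_tripod.
apply/eqP; rewrite eqn_leq (nblocks_gt1 iy) ?X3 // andbT -ltnS ltn_neqAle.
have := nblocks_le leaf_ext (ext_pt end_placeP); rewrite X3 => ->; rewrite andbT.
apply/eqP => K3; have := nblocks_full yi (etrans K3 (esym X3)) (Some None) (Some (Some tt)).
by rewrite ext_branch /end_place /= => /esym/eqP.
Qed.

Lemma nsingle3 (X Y : treeStr) (i : embedding X Y) y : one_point i y -> #|{: X}| = 3 ->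
  nblocks (@quart Y) (im i) y = 2 -> nsingle (@quart Y) (im i) y = 1%N.
Proof.
case=> yi _ X3 K2; have [a [d [_ sz ->]]] := two_blocks_card yi K2.
by apply: sum3_ones; rewrite ?sz ?X3 // xblock_card.
Qed.

Section Generate.
Variables (R : comPzRingType) (psi : forall X Y, embedding X Y -> R).
Arguments psi {X Y}.
Hypothesis psi_iso : forall X Y (i : embedding X Y), bijective i -> psi i = 1.
Hypothesis psi_comp : forall X Y Z (j : embedding Y Z) (i : embedding X Y),
  psi (emb_comp j i) = psi j * psi i.
Hypothesis psi_sum : forall X Y X' (i : embedding X Y) (k : embedding X X')
  (I : finType) (A : I -> amalgamation i k), enumerates A ->
  psi i = \sum_a psi (am_inr (A a)).

Let u := psi leaf_ext.
Let v := psi center_ext + 1 + u *+ 2.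

Definition known (X Y : treeStr) (i : embedding X Y) (y : Y) : Prop :=
  psi i = weight u v (@quart Y) (im i) y.

(** Extensions with the same directions, up to renaming the leaves, are
    isomorphic. *)
Lemma psi_transport (X Y X1 Y1 : treeStr) (i : embedding X Y) y (i1 : embedding X1 Y1) y1
    (h : embedding X X1) :
  one_point i y -> one_point i1 y1 -> bijective h ->
  (forall a b, branch i y a b = branch i1 y1 (h a) (h b)) -> psi i = psi i1.
Proof.
move=> iy i1y bh E; case: (i1y) => y1i H1.
have y1h : y1 \notin im (emb_comp i1 h).
  by apply/imP=> -[x Ex]; case/imP: y1i; exists (h x).
have imE : im (emb_comp i1 h) = im i1.
  apply/setP=> t; apply/imP/imP => -[s ->]; first by exists (h s).
  by case: bh => g _ gK; exists (g s); rewrite /= gK.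
have E' a b : branch i y a b = branch (emb_comp i1 h) y1 a b.
  by rewrite E /branch imE.
pose f := one_point_map iy y1h E'.
have fi : emb_comp f i = emb_comp i1 h.
  by apply: emb_ext => x; apply: one_point_funE.
have bf : bijective f.
  apply: emb_surj_bij => t; have [|->] := H1 t.
    rewrite -imE => /imP[x ->]; exists (i x); exact: one_point_funE.
  by exists y; apply: one_point_funy.
have := congr1 psi fi.
by rewrite !psi_comp (psi_iso bf) (psi_iso bh) mul1r mulr1.
Qed.

Section Deduce.
Variables (X Y X' : treeStr) (i : embedding X Y) (k : embedding X X') (y : Y) (z : X').
Hypotheses (iy : one_point i y) (kz : one_point k z).

Lemma psi_sum_code : psi i =
  \sum_c psi (am_inr (code_am (i := i) (k := k) (y := y) (z := z) c)).
Proof. by apply: psi_sum; apply: enumerates_code. Qed.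

Lemma psi_am_weight (C : amalgamation i k) :
  (am_inl C y != am_inr C z -> known (am_inr C) (am_inl C y)) ->
  psi (am_inr C) = am_weight u v y C.
Proof.
move=> H; have [E|N] := eqVneq (am_inl C y) (am_inr C z); last first.
  by rewrite (H N) /am_weight (negbTE (am_y_out iy kz N)).
rewrite /am_weight E im_mem psi_iso //; apply: emb_surj_bij => w.
have [[s <-]|//] := am_cover w; case: iy => _ /(_ s)[/imP[x ->]|->].
  by exists (k x); rewrite am_comm.
by exists z.
Qed.

(** Both [psi] and the weight are additive. *)
Lemma known_source :
  (forall C : amalgamation i k, am_inl C y != am_inr C z -> known (am_inr C) (am_inl C y)) ->
  known i y.
Proof.
move=> H; rewrite /known -(weight_additive u v iy kz) psi_sum_code.
by apply: eq_bigr => c _; apply: psi_am_weight; apply: H.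
Qed.

(** Additivity of [psi] and of the weight are two equations between the same
    terms, all but one of which agree. *)
Lemma known_target (C0 : amalgamation i k) : known i y -> am_inl C0 y != am_inr C0 z ->
  (forall C : amalgamation i k, am_inl C y != am_inr C z ->
     am_code y z C <> am_code y z C0 -> known (am_inr C) (am_inl C y)) ->
  known (am_inr C0) (am_inl C0 y).
Proof.
move=> Ki N0 H; have [c0 h0] := (enumerates_code iy kz).1 C0.
have code0 : am_code y z C0 = val c0.
  by rewrite -(code_amK c0); apply/esym/am_iso_code.
have : psi i = \sum_c am_weight u v y (code_am (i := i) (k := k) (y := y) (z := z) c).
  by rewrite weight_additive.
rewrite psi_sum_code (bigD1 c0) // [RHS](bigD1 c0) //=.
rewrite (eq_bigr (fun c => am_weight u v y (code_am c))); last first.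
  move=> c cc0; apply: psi_am_weight => Nc; apply: H => //.
  by rewrite code_amK code0 => /val_inj E; rewrite E eqxx in cc0.
move/addIr; rewrite (psi_am_iso psi_iso psi_comp h0).
rewrite (am_weight_code u v iy kz) code_amK -code0 -(am_weight_code u v iy kz).
by rewrite /am_weight (negbTE (am_y_out iy kz N0)).
Qed.

(** Then there is no other amalgamation. *)
Lemma known_different (C : amalgamation i k) : ~ same_place i k y z -> known i y ->
  am_inl C y != am_inr C z -> known (am_inr C) (am_inl C y).
Proof.
move=> N Ki NC; have [a [_ X2 uni _]] := different_covering iy kz N.
have [yi _] := iy.
have one (D : amalgamation i k) : am_inl D y != am_inr D z -> am_code y z D = Some (false, xblock i y a).
  move=> ND; have [_ //|_ //|b -> cov _ _] := am_specP iy kz ND X2.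
  by congr (Some (_, _)); apply/esym/eqP; rewrite xblock_eq //; apply: uni.
by apply: known_target => // D ND; rewrite !one.
Qed.

End Deduce.

Definition level (n : nat) : Prop := forall (X Y : treeStr) (i : embedding X Y) (y : Y),
  one_point i y -> #|{: X}| = n -> known i y.

Lemma level_down n : level n.+1 -> level n.
Proof.
move=> L X Y i y iy Xn; apply: (known_source iy iy) => C NC.
apply: L; first exact: (am_one_point iy iy NC).
by rewrite (one_point_card iy) Xn.
Qed.

Lemma leaf_extP (X Y : treeStr) (i : embedding X Y) y : one_point i y -> #|{: X}| = 3 ->
  nblocks (@quart Y) (im i) y = 2 -> nsingle (@quart Y) (im i) y = 1%N ->
  psi i = u.
Proof.
move=> iy X3 K2 S1; have [yi _] := iy.
have [p pE] := single_place yi K2 S1.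
have [h bh hp] := tripod_map p X3.
apply: (psi_transport iy (ext_one_point end_placeP) bh) => a b.
have hE x : (h x == None :> three) = (x == p).
  by rewrite -hp; apply/eqP/eqP => [/(@emb_inj _ _ h)|->].
by rewrite ext_branch pE /end_place !hE.
Qed.

Lemma center_extP (X Y : treeStr) (i : embedding X Y) y : one_point i y -> #|{: X}| = 3 ->
  nblocks (@quart Y) (im i) y = 3 -> psi i = psi center_ext.
Proof.
move=> iy X3 K3; have [yi _] := iy.
have [p _] : exists p : X, True.
  by have /card_gt0P[p _] : (0 < #|{: X}|)%N by [rewrite X3]; exists p.
have [h bh _] := tripod_map p X3.
apply: (psi_transport iy (ext_one_point eq_placeP) bh) => a b.
rewrite ext_branch nblocks_full ?K3 ?X3 // /eq_place.
by apply/eqP/eqP => [->|/(@emb_inj _ _ h)].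
Qed.

(** Up to isomorphism the star with three leaves has two kinds of one-point
    extensions, on an edge and at the center; u and v are defined by them. *)
Lemma level3 : level 3.
Proof.
move=> X Y i y iy X3; have [yi _] := iy.
have K3 := nblocks_le i y; rewrite X3 in K3.
have K1 : (1 < nblocks (@quart Y) (im i) y)%N.
  by apply: (nblocks_gt1 iy); rewrite X3.
rewrite /known /weight.
have [K2|K2] := eqVneq (nblocks (@quart Y) (im i) y) 2; last first.
  have {}K3 : nblocks (@quart Y) (im i) y = 3.
    by apply/eqP; rewrite eqn_leq K3 ltn_neqAle eq_sym K2.
  by rewrite (center_extP iy X3 K3) K3 /wt /= /v; ring.
have S1 := nsingle3 iy X3 K2.
by rewrite (leaf_extP iy X3 K2 S1) K2 S1 /wt /=; ring.
Qed.

(** The step from n to n + 1 leaves: one leaf is deleted, preferably such that y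
    and this leaf have different places afterwards. *)
Section LevelUp.
Variable n : nat.
Hypotheses (n3 : (3 <= n)%N) (Ln : level n).
Variables (X Y : treeStr) (j : embedding X Y) (y : Y).
Hypotheses (jy : one_point j y) (Xn : #|{: X}| = n.+1).
Let yj : y \notin im j. Proof. by case: jy. Qed.
Let pj := branch_place yj.
Let K := nblocks (@quart Y) (im j) y.
Let S := nsingle (@quart Y) (im j) y.

Lemma known_remove x : ~ same_place (rem_i j x) (rem_k x) (rem_y x jy) x -> known j y.
Proof.
move=> N; apply: (known_different (rem_iy x jy) (rem_kx x) (C := rem_am j x) N).
  apply: Ln; first exact: rem_iy.
  by have := card_rem x; rewrite Xn => -[].
exact: rem_ne.
Qed.

(** A direction with three leaves contains two candidates for deletion. *)
Lemma known_block e : (2 < #|xblock j y e|)%N -> known j y.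
Proof.
move=> /card_gt2P[a [b [c [[aB bB cB] [ab bc ca]]]]]; move: aB bB cB; rewrite !inE => ea eb ec.
have X2 : (1 < #|{: X}|)%N by rewrite Xn ltnS; apply: leq_trans n3.
have [d Nad] : exists d, ~~ branch j y a d.
  by have [d Nd] := place_two pj (elimN eqP ab); exists d.
have ab' : branch j y a b by rewrite -(place_congr pj _ ea).
have ac' : branch j y a c by rewrite -(place_congr pj _ ea).
have [x N] := remove_one_of_two jy (elimN eqP ab) (not_eq_sym (elimN eqP ca)) (elimN eqP bc) ab' ac' Nad.
exact: (known_remove N).
Qed.

(** One block has at least three leaves, since the other one is a
    singleton. *)
Lemma known_single : K = 2 -> S = 1%N -> known j y.
Proof.
move=> K2 S1; have [a [d [Nad sz SE]]] := two_blocks_card yj K2.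
have [a2|a3] := leqP #|xblock j y a| 2; last exact: known_block a3.
have [d2|d3] := leqP #|xblock j y d| 2; last exact: known_block d3.
suff : S = 0%N by rewrite S1.
by rewrite /S SE; apply: small_ones => //; rewrite sz Xn.
Qed.

(** Some block has two leaves, one of which may be deleted. *)
Lemma known_notfull : (2 < K)%N -> K <> #|{: X}| -> known j y.
Proof.
move=> K3 KX.
have [e [x [ex bx]]] : exists e x, e <> x /\ branch j y e x.
  apply: contrapT => N; apply: KX; rewrite -(card_im j) /K /nblocks /blocks card_in_imset //.
  move=> _ _ /imP[a ->] /imP[b ->] /(blockP (quart_quartets Y) y (im_mem j a) (im_mem j b)) ab.
  by congr (j _); apply: contrapT => h; apply: N; exists a, b.
have [d [d' [h1 h2 h3]]] := nblocks3 yj K3 e.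
exact: (known_remove (remove_from_block (jy := jy) ex bx h1 h2 h3)).
Qed.

End LevelUp.

(** What is left after the previous lemmas are the two extensions from which
    deletion always leads to equal places: four leaves with y on the middle edge,
    and a star with y at its center.  They are the only unknown amalgamation
    among those with the deleted leaf, and [known_target] applies. *)
Lemma level_up n : (3 <= n)%N -> level n -> level n.+1.
Proof.
move=> n3 Ln X Y j y jy Xn; have [yj _] := jy.
have X2 : (1 < #|{: X}|)%N by rewrite Xn ltnS; apply: leq_trans n3.
have [x _] : exists x : X, True by have /card_gt0P[x _] := ltnW X2; exists x.
have dn : #|{: rem_dom x}| = n by have := card_rem x; rewrite Xn => -[].
have d2 : (1 < #|{: rem_dom x}|)%N by rewrite dn; apply: leq_trans n3.
have iy := rem_iy x jy; have kx := rem_kx x.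
have [y0i _] := iy.
have Ki : known (rem_i j x) (rem_y x jy) by apply: Ln.
have N0 := rem_ne x jy.
have K1 := nblocks_gt1 jy X2.
have sing (C : amalgamation (rem_i j x) (rem_k x)) :
    am_inl C (rem_y x jy) != am_inr C x ->
    nblocks (@quart (am_str C)) (im (am_inr C)) (am_inl C (rem_y x jy)) = 2 ->
    nsingle (@quart (am_str C)) (im (am_inr C)) (am_inl C (rem_y x jy)) = 1%N ->
    known (am_inr C) (am_inl C (rem_y x jy)).
  move=> NC; exact: (known_single n3 Ln (am_one_point iy kx NC) Xn).
have tgt : (forall C : amalgamation (rem_i j x) (rem_k x),
    am_inl C (rem_y x jy) != am_inr C x ->
    am_code (rem_y x jy) x C <> am_code (rem_y x jy) x (rem_am j x) ->
    known (am_inr C) (am_inl C (rem_y x jy))) -> known j y.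
  exact: (known_target iy kx Ki N0).
have Ki1 := nblocks_gt1 iy d2.
have [K2|K2] := eqVneq (nblocks (@quart Y) (im j) y) 2.
  have [S1|S1] := eqVneq (nsingle (@quart Y) (im j) y) 1%N.
    exact: (known_single n3 Ln jy Xn K2 S1).
  have [a [d [Nad sz SE]]] := two_blocks_card yj K2.
  have [a2|a3] := leqP #|xblock j y a| 2; last exact: (known_block n3 Ln jy Xn a3).
  have [d2'|d3] := leqP #|xblock j y d| 2; last exact: (known_block n3 Ln jy Xn d3).
  have [n3' S0] : n = 3 /\ nsingle (@quart Y) (im j) y = 0%N.
    rewrite Xn in sz; split; last by rewrite SE; apply: small_ones => //; rewrite sz.
    have : (n.+1 <= 4)%N by rewrite -sz; apply: leq_add a2 d2'.
    by rewrite ltnS => n3'; apply/eqP; rewrite eqn_leq n3' n3.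
  have iS := nsingle3 iy (etrans dn n3').
  (* Over the three remaining leaves y is on the edge at a leaf a0, whose block
     receives x; adding x to the other block gives type (2, 1). *)
  have [a0 [code0 k2 b1]] : exists a0,
    [/\ am_code (rem_y x jy) x (rem_am j x) =
          Some (false, xblock (rem_i j x) (rem_y x jy) a0),
        nblocks (@quart (rem_cod j x)) (im (rem_i j x)) (rem_y x jy) = 2 &
        #|xblock (rem_i j x) (rem_y x jy) a0| = 1%N].
    case: (am_specP iy kx N0 d2) => [_ _ _ SE'|_ _ KE _|a0 code0 _ KE SE'].
    - by move: S1; rewrite (SE' : nsingle (@quart Y) (im j) y = 1%N).
    - by move: Ki1; rewrite -ltnS -KE K2.
    - exists a0; have k2 := etrans (esym KE) K2; split=> //.
      move: SE'; rewrite (iS k2); have [//|_ SE'] := eqVneq #|xblock _ _ a0| 1%N.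
      by move: S1; rewrite (SE' : nsingle (@quart Y) (im j) y = 1%N).
  apply: tgt => C NC; rewrite code0 => codeC.
  case: (am_specP iy kx NC d2) => [_ _ KE SE'|_ _ KE _|b codeb _ KE SE'].
  - exact: sing.
  - apply: (known_notfull Ln (am_one_point iy kx NC) Xn); first by rewrite KE k2.
    by rewrite KE k2 Xn n3'.
  - apply: sing => //; first by rewrite KE k2.
    rewrite SE' (iS k2); have [b1'|//] := eqVneq #|xblock _ _ b| 1%N.
    have [ab|nab] := boolP (branch (rem_i j x) (rem_y x jy) a0 b).
      by case: codeC; rewrite codeb; congr (Some (_, _)); apply/esym/eqP; rewrite xblock_eq.
    have := cardsC (xblock (rem_i j x) (rem_y x jy) a0).
    by rewrite -(xblock_compl y0i k2 nab) b1 b1' dn n3'.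
have {K1}K3 : (2 < nblocks (@quart Y) (im j) y)%N by rewrite ltn_neqAle eq_sym K2.
have [KX|/eqP KX] := eqVneq (nblocks (@quart Y) (im j) y) #|{: X}|; last first.
  exact: (known_notfull Ln jy Xn K3 KX).
have [sp|N] := pselect (same_place (rem_i j x) (rem_k x) (rem_y x jy) x); last first.
  exact: (known_remove Ln Xn N).
(* y is at the center of the star, with and without x; every other
   amalgamation is a cherry. *)
have [code0 KE] : am_code (rem_y x jy) x (rem_am j x) = Some (false, set0) /\
    nblocks (@quart (rem_cod j x)) (im (rem_i j x)) (rem_y x jy) = n.
  case: (am_specP iy kx N0 d2) => [_ _ KE _|code0 _ KE _|a0 _ _ KE _].
  - by move: K2; rewrite (KE : nblocks (@quart Y) (im j) y = 2).
  - by split=> //; apply: succn_inj; rewrite -KE -Xn -KX.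
  - have := nblocks_le (rem_i j x) (rem_y x jy).
    by rewrite -KE dn (KX : nblocks (@quart _) _ _ = _) Xn ltnn.
apply: tgt => C NC; rewrite code0 => codeC.
case: (am_specP iy kx NC d2) => [_ _ KE' SE'|//|b _ cov _ _]; first exact: sing.
by move: n3; rewrite -KE (covering_same iy sp d2 cov).
Qed.

Lemma known_one_point (X Y : treeStr) (i : embedding X Y) y : one_point i y -> known i y.
Proof.
(* Up from three leaves, then down to the small cases. *)
have up n : level (n + 3) by elim: n => [|n IH]; [apply: level3 | apply: level_up; rewrite ?leq_addl].
have lev n : level n.
  by have := up n; rewrite !addnS addn0 => /level_down/level_down/level_down.
by move=> iy; apply: (lev #|{: X}|).
Qed.

(** Let y and z be attached to the edge at one leaf a of X, with z closer to a.
    Then y has the type (2, 0) over X with z, and z has the type (2, 1) over X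
    with y; adding them in both orders gives (u - v)u = u^2. *)
Lemma uv0_from_leaf_ext (X Y : treeStr) (i : embedding X Y) y : one_point i y -> #|{: X}| = 3 ->
  nblocks (@quart Y) (im i) y = 2 -> psi i = u -> u * v = 0.
Proof.
move=> iy X3 K2 pi; have [yi _] := iy; have py := branch_place yi.
have X2 : (1 < #|{: X}|)%N by rewrite X3.
have [b [d [_ _ SE]]] := two_blocks_card yi K2.
have S1 := nsingle3 iy X3 K2.
have [a a1] : exists a, #|xblock i y a| = 1%N.
  move: SE; rewrite S1; have [bE _|_] := eqVneq #|xblock i y b| 1%N; first by exists b.
  by have [dE _|//] := eqVneq #|xblock i y d| 1%N; exists d.
have cov : covering i i y y a by have [] := two_blocksP a K2.
have /asboolP[C codeC] := realized_join iy iy cov X2.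
have NC : am_inl C y != am_inr C y.
  by apply/eqP=> E; move: codeC; rewrite /am_code E eqxx.
have innerC : am_inner y y C = xblock i y a.
  by move: codeC; rewrite /am_code (negbTE NC) => -[].
(* The block of y that receives z is the singleton of a. *)
have wC : psi (am_inr C) = u - v.
  rewrite (known_one_point (am_one_point iy iy NC)) /weight.
  case: (am_specP iy iy NC X2); rewrite codeC.
  - by [].
  - by case=> /eqP; rewrite (negbTE (xblock_neq0 iy a)).
  - move=> a' [/eqP]; rewrite xblock_eq // => aa' _ -> ->.
    have -> : xblock i y a' = xblock i y a by apply/esym/eqP; rewrite xblock_eq.
    by rewrite a1 S1 K2 /wt /= mulr0n addr0.
have ND : am_inl (flip C) y != am_inr (flip C) y by rewrite eq_sym.
have wD : psi (am_inl C) = u.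
  rewrite (known_one_point (am_one_point iy iy ND)) /weight.
  (* From z, the point y lies in the direction of the two other leaves; their
     block is not a singleton. *)
  have [w wa wD] : exists2 w, w \notin xblock i y a & w \in am_inner y y (flip C).
    have : a \in am_inner y y C by rewrite innerC inE (place_refl py).
    rewrite mem_am_inner => /existsP[w h]; exists w; last first.
      rewrite mem_am_inner; apply/existsP; exists a.
      change (quart (am_inl C y) (am_inl C (i w)) (am_inr C y) (am_inl C (i a))).
      rewrite !am_comm.
      by have Hq := quart_quartets (am_str C); quart_sym Hq.
    have [_ _ _ _ [aw _]] := quart_ne (quart_quartets _) h.
    have /eqP/cards1P[t Et] := a1.
    have : a \in xblock i y a by rewrite inE (place_refl py).
    rewrite Et !inE => /eqP<-; apply/eqP=> E; apply: aw; by rewrite E.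
  have D0 : am_inner y y (flip C) <> set0 by move=> E; rewrite E inE in wD.
  have codeD c : am_code y y (flip C) = Some c -> am_inner y y (flip C) = c.2.
    by rewrite /am_code (negbTE ND) => -[<-].
  case: (am_specP iy iy ND X2) => [/codeD/D0[]|/codeD/D0[]|b' /codeD inner_b _ -> ->].
  - rewrite K2 S1.
    have wb : branch i y b' w by move: wD; rewrite [am_inner _ _ _]inner_b inE.
    have -> : xblock i y b' = ~: xblock i y a.
      apply: etrans (xblock_compl yi K2 _); last by rewrite inE in wa; exact: wa.
      by apply/eqP; rewrite xblock_eq.
    have := cardsC (xblock i y a); rewrite a1 X3 add1n => -[->].
    by rewrite /wt /= mulr1n addrK.
have : psi (am_inl C) * u = psi (am_inr C) * u by rewrite -pi -!psi_comp am_embE.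
rewrite wC wD mulrBl => /eqP; rewrite -subr_eq0 opprB addrCA subrr addr0 => /eqP.
by rewrite mulrC.
Qed.

Lemma psi_uv0 : u * v = 0.
Proof.
exact: (uv0_from_leaf_ext (ext_one_point end_placeP) card_tripod leaf_ext_nblocks).
Qed.

End Generate.

(** * The isomorphism *)

Lemma rmorph_wt (R S : comPzRingType) (g : {rmorphism R -> S}) (u v : R) k s :
  g (wt u v k s) = wt (g u) (g v) k s.
Proof.
rewrite /wt; case: ifP => _; last case: ifP => _.
- by rewrite rmorphB rmorphD rmorphMn.
- by rewrite !rmorphD rmorph1.
- rewrite rmorphB rmorphMn (rmorphD g 1) rmorph1.
  by rewrite (rmorphD g (v + 2%:R)) (rmorphD g v) rmorph_nat.
Qed.

Lemma rmorph_center (R S : comPzRingType) (g : {rmorphism R -> S}) (c u : R) c' u' :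
  g c = c' -> g u = u' -> g (c + 1 + u *+ 2) = c' + 1 + u' *+ 2.
Proof. move=> <- <-; by rewrite (rmorphD g (c + 1)) (rmorphD g c) rmorphMn rmorph1. Qed.

Lemma wt3_center (R : comPzRingType) (u v : R) :
  v + 2%:R + u - (1 + u) *+ 3 + 1 + u *+ 2 = v.
Proof. ring. Qed.

Lemma leaf_ext_nsingle :
  nsingle (@quart (ext_ts end_placeP)) (im leaf_ext) (ext_pt end_placeP) = 1%N.
Proof. exact: (nsingle3 (ext_one_point end_placeP) card_tripod leaf_ext_nblocks). Qed.

Lemma center_ext_nblocks :
  nblocks (@quart (ext_ts eq_placeP)) (im center_ext) (ext_pt eq_placeP) = 3.
Proof.
have iy := ext_one_point eq_placeP; have X3 := card_tripod.
have := nblocks_le center_ext (ext_pt eq_placeP); rewrite X3 leq_eqVlt => /predU1P[//|K3].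
have K1 : (1 < nblocks (@quart (ext_ts eq_placeP)) (im center_ext) (ext_pt eq_placeP))%N.
  by apply: (nblocks_gt1 iy); rewrite X3.
have K2 : nblocks (@quart (ext_ts eq_placeP)) (im center_ext) (ext_pt eq_placeP) = 2.
  by apply/eqP; rewrite eqn_leq -ltnS K3.
have [H _] := two_blocksP (None : tripod) K2.
have := H (Some None) (Some (Some tt)); rewrite !ext_branch /eq_place /=.
by move=> /(_ isT isT).
Qed.

(** Every embedding is a composite of one-point extensions. *)
Lemma eq_measure (R : comPzRingType) (psi chi : forall X Y, embedding X Y -> R) :
  (forall X Y (i : embedding X Y), bijective i -> psi X Y i = 1) ->
  (forall X Y Z (j : embedding Y Z) (i : embedding X Y),
     psi X Z (emb_comp j i) = psi Y Z j * psi X Y i) ->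
  (forall X Y (i : embedding X Y), bijective i -> chi X Y i = 1) ->
  (forall X Y Z (j : embedding Y Z) (i : embedding X Y),
     chi X Z (emb_comp j i) = chi Y Z j * chi X Y i) ->
  (forall X Y (i : embedding X Y) y, one_point i y -> psi X Y i = chi X Y i) ->
  forall X Y (i : embedding X Y), psi X Y i = chi X Y i.
Proof.
move=> psi_iso psi_comp chi_iso chi_comp E X Y i.
have [n] := ubnP (#|{: Y}| - #|{: X}|); elim: n X i => // n IH X i le.
have [bi|/factor_one_point[X1 [i1 [j [y [iy -> lt]]]]]] := pselect (bijective i).
  by rewrite psi_iso ?chi_iso.
rewrite psi_comp chi_comp (E _ _ _ _ iy) IH //.
by apply: leq_trans lt _.
Qed.

Section ThetaClasses.

Definition cls (X Y : treeStr) (i : embedding X Y) : Theta := quo_pi Theta_relation (sym i).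

Lemma cls_eq x y : Theta_relation (x - y) -> quo_pi Theta_relation x = quo_pi Theta_relation y.
Proof. by move=> h; apply/quo_piP; apply: ideal_gen. Qed.

Lemma cls_iso (X Y : treeStr) (i : embedding X Y) : bijective i -> cls i = 1.
Proof. by move=> bi; apply: cls_eq; apply: Theta_iso. Qed.

Lemma cls_comp (X Y Z : treeStr) (j : embedding Y Z) (i : embedding X Y) :
  cls (emb_comp j i) = cls j * cls i.
Proof.
apply: etrans (cls_eq (Theta_comp j i)) _.
exact: (rmorphM (quo_pi Theta_relation)).
Qed.

Lemma cls_sum (X Y X' : treeStr) (i : embedding X Y) (k : embedding X X')
    (I : finType) (A : I -> amalgamation i k) : enumerates A ->
  cls i = \sum_a cls (am_inr (A a)).
Proof.
case=> A1 A2; have eA : am_enumeration (fun a : 'I_#|I| => A (enum_val a)).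
  split=> [B|a b /A2/enum_val_inj//]; have [a h] := A1 B.
  by exists (enum_rank a); rewrite enum_rankK.
apply: etrans (cls_eq (Theta_amalg eA)) _.
apply: etrans (rmorph_sum (quo_pi Theta_relation) _ _ _) _.
by rewrite (reindex _ (onW_bij _ (enum_val_bij I))).
Qed.

Definition uT : Theta := cls leaf_ext.
Definition vT : Theta := cls center_ext + 1 + uT *+ 2.

Lemma uvT0 : uT * vT = 0.
Proof. exact: (psi_uv0 cls_iso cls_comp cls_sum). Qed.

Lemma cls_one_point (X Y : treeStr) (i : embedding X Y) y : one_point i y ->
  cls i = weight uT vT (@quart Y) (im i) y.
Proof. exact: (known_one_point cls_iso cls_comp cls_sum). Qed.

End ThetaClasses.

Lemma to_Zuv : exists f : {rmorphism Theta -> Zuv},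
  forall X Y (i : embedding X Y), f (cls i) = mu uZ vZ i.
Proof.
apply: (Theta_lift (psi := @mu Zuv uZ vZ)); first exact: Zuv_neq0.
- by move=> *; apply: mu_iso.
- by move=> *; apply: (mu_comp uvZ0).
- by move=> *; apply: (mu_additive uvZ0).
Qed.

Lemma from_Zuv : (1 : Theta) != 0 -> exists g : {rmorphism Zuv -> Theta}, g uZ = uT /\ g vZ = vT.
Proof.
move=> T1; pose h (j : 'I_2) : nonzero_ring T1 := if j == 0 then uT else vT.
pose F : {rmorphism {mpoly int[2]} -> nonzero_ring T1} := mmap intr h.
have FX j : F 'X_j = h j by rewrite /F /= mmapX mmap1U.
have F0 p : uvP p -> F p = 0.
  by move=> ->; rewrite rmorphM !FX; apply: uvT0.
have [g gE] := quo_lift (S := Theta) F0.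
by exists g; split; [apply: etrans (gE 'X_0) (FX _) | apply: etrans (gE 'X_1) (FX _)].
Qed.

Theorem theorem1p1 :
  exists f : {rmorphism Theta -> Zuv}, bijective f.
Proof.
have [f fE] := to_Zuv.
have T1 : (1 : Theta) != 0.
  apply/eqP=> E; have := Zuv_neq0; rewrite -(rmorph1 f) E rmorph0 eqxx //.
have [g [gu gv]] := from_Zuv T1.
have fu : f uT = uZ.
  rewrite fE (mu_one_point uvZ0 (ext_one_point end_placeP)) /weight.
  by rewrite leaf_ext_nblocks leaf_ext_nsingle /wt /= mulr1n addrK.
have fv : f vT = vZ.
  rewrite /vT (rmorph_center (fE _ _ center_ext) fu).
  rewrite (mu_one_point uvZ0 (ext_one_point eq_placeP)) /weight center_ext_nblocks /wt /=.
  exact: wt3_center.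
exists f; exists g => [x|x].
- have gf : forall X Y (i : embedding X Y), g (f (cls i)) = cls i.
    apply: (eq_measure (psi := fun X Y i => g (f (@cls X Y i))) (chi := cls)).
    + move=> X Y i bi; apply: etrans (congr1 (fun t => g (f t)) (cls_iso bi)) _.
      exact: etrans (congr1 g (rmorph1 f)) (rmorph1 g).
    + move=> X Y Z j i; apply: etrans (congr1 (fun t => g (f t)) (cls_comp j i)) _.
      exact: etrans (congr1 g (rmorphM f (cls j) (cls i))) (rmorphM g _ _).
    + exact: cls_iso.
    + exact: cls_comp.
    + move=> X Y i y iy; apply: etrans (congr1 g (etrans (fE _ _ i) (mu_one_point uvZ0 iy))) _.
      apply: etrans (rmorph_wt g _ _ _ _) _; rewrite gu gv.
      exact: esym (cls_one_point iy).
  rewrite -[x]quo_reprK; move: (repr x) => p.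
  have := @malg_hom_eq _ _ (g \o f \o quo_pi Theta_relation) (quo_pi Theta_relation).
  by apply=> -[X Y i]; apply: gf.
- rewrite -[x]quo_reprK; move: (repr x) => p.
  have := @mpoly_hom_eq 2 _ (f \o g \o quo_pi uvP) (quo_pi uvP).
  apply=> j /=; have [->|->] : j = 0 \/ j = 1.
  + by case: j => -[|[|//]] lt; [left | right]; apply/val_inj.
  + by apply: etrans (congr1 f gu) fu.
  + by apply: etrans (congr1 f gv) fv.
Qed.
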